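(* Let $(v,\theta)$ be a weak solution on $[0,T]$ of the three-dimensional inviscid Boussinesq system with initial data $(v_{\mathrm{in}},\theta_{\mathrm{in}})$. Let $1\le p\le\infty$ and $\frac1p+\frac1{p'}=1$. Suppose $v\in L^\infty([0,T];B^{1/3}_{\infty,c(\mathbb{N})}(\mathbb{T}^3))$ and - if $1\le p<2$: $\theta\in C([0,T];L^p(\mathbb{T}^3))\cap L^2([0,T];B^{1/3}_{p',c(\mathbb{N})}(\mathbb{T}^3))$; - if $p\ge 2$: $\theta\in C([0,T];L^p(\mathbb{T}^3))\cap L^p([0,T];B^{1/3}_{p,c(\mathbb{N})}(\mathbb{T}^3))$. Then for all $t\in[0,T]$, $\|v(t)\|_{L^2(\mathbb{T}^3)}^2=\|v_{\mathrm{in}}\|_{L^2(\mathbb{T}^3)}^2+2\int_0^t\int_{\mathbb{T}^3}\theta(x,s)v_3(x,s)\,dx\,ds$ and $\|\theta(t)\|_{L^p(\mathbb{T}^3)}=\|\theta_{\mathrm{in}}\|_{L^p(\mathbb{T}^3)}$.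
   Context: $\mathbb{T}^3=\mathbb{R}^3/\mathbb{Z}^3$, $e_3=(0,0,1)^T$. The inviscid Boussinesq system is $\partial_t v+(v\cdot\nabla)v+\nabla p=\theta e_3$, $\partial_t\theta+v\cdot\nabla\theta=0$, $\nabla\cdot v=0$ on $\mathbb{T}^3\times(0,T)$, with $(v,\theta)|_{t=0}=(v_{\mathrm{in}},\theta_{\mathrm{in}})$. Weak solution: $(v_{\mathrm{in}},\theta_{\mathrm{in}})\in C^\infty(\mathbb{T}^3)$, $v_{\mathrm{in}}$ divergence-free; $(v,\theta)\in C(\mathbb{T}^3\times[0,T])$ with $v(\cdot,t)$ distributionally divergence-free for a.e. $t$, and for all divergence-free $\phi\in C_c^\infty([0,T);(C^\infty(\mathbb{T}^3))^3)$: $-\int v_{\mathrm{in}}\cdot\phi(x,0)\,dx-\int_0^T\!\int\partial_s\phi\cdot v=\int_0^T\!\int(\nabla\phi:v\otimes v+\theta e_3\cdot\phi)$, and for all $\varphi\in C_c^\infty([0,T);C^\infty(\mathbb{T}^3))$: $-\int\theta_{\mathrm{in}}\varphi(x,0)\,dx-\int_0^T\!\int\partial_s\varphi\,\theta=\int_0^T\!\int v\cdot\nabla\varphi\,\theta$ (integrals over $\mathbb{T}^3$). Littlewood–Paley on $\mathbb{T}^3$: let $\chi,\varphi$ be smooth radial functions on $\mathbb{R}^3$ with values in $[0,1]$, $\mathrm{supp}\,\chi\subset\{|\xi|\le 4/3\}$, $\chi\equiv1$ on $|\xi|\le3/4$, $\mathrm{supp}\,\varphi\subset\{3/4\le|\xi|\le8/3\}$,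 and $\chi(\xi)+\sum_{j\ge0}\varphi(2^{-j}\xi)=1$. For a distribution $f=\sum_{k\in\mathbb{Z}^3}\hat f(k)e^{2\pi i k\cdot x}$, set $\Delta_j f=0$ for $j\le-2$, $\Delta_{-1}f=\sum_k\chi(k)\hat f(k)e^{2\pi ik\cdot x}$, $\Delta_jf=\sum_k\varphi(2^{-j}k)\hat f(k)e^{2\pi ik\cdot x}$ for $j\ge0$. For $s\in\mathbb{R}$, $1\le p\le\infty$: $B^s_{p,\infty}(\mathbb{T}^3)$ is the set of periodic distributions with $\sup_j 2^{js}\|\Delta_ju\|_{L^p(\mathbb{T}^3)}<\infty$, and $B^s_{p,c(\mathbb{N})}(\mathbb{T}^3)=\{u\in B^s_{p,\infty}(\mathbb{T}^3):2^{js}\|\Delta_ju\|_{L^p(\mathbb{T}^3)}\to0\text{ as }j\to\infty\}$. *)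

(* Defs.v *)
From HB Require Import structures.
From mathcomp Require Import all_boot all_order all_algebra.
From mathcomp Require Import all_classical all_reals all_analysis.
Set Implicit Arguments. Unset Strict Implicit. Unset Printing Implicit Defensive.
Import Order.TTheory GRing.Theory Num.Theory.
Import numFieldNormedType.Exports.
Local Open Scope classical_set_scope.
Local Open Scope ring_scope.

Section Boussinesq.
Variable R : realType.

Local Notation mu := (@lebesgue_measure R).
Local Notation pt := 'rV[R]_3.

Definition e3 (i : 'I_3) : pt := delta_mx 0 i.

Definition vec3 (a b c : R) : pt :=
  \row_(i < 3) (if nat_of_ord i == 0%N then a
                else if nat_of_ord i == 1%N then b else c).

Definition eucl (x : pt) : R := Num.sqrt (\sum_(i < 3) x 0 i ^+ 2).

(* spatial integral over T^3 = [0,1]^3 of a periodic function (iterated) *)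
Definition unitI : set R := [set a | 0 <= a <= 1].
Definition intT3 (f : pt -> R) : R :=
  \int[mu]_(a in unitI) \int[mu]_(b in unitI) \int[mu]_(c in unitI) f (vec3 a b c).

Definition cube : set pt := [set x | forall i, 0 <= x 0 i <= 1].

Definition periodic3 (g : pt -> R) : Prop := forall x i, g (x + e3 i) = g x.

Definition dirD (d : option 'I_3) (f : pt -> R -> R) : pt -> R -> R :=
  match d with
  | Some i => fun x s => 'D_(e3 i) (fun y => f y s) x
  | None => fun x s => 'D_1 (f x) s
  end.
Definition derivable_dir (d : option 'I_3) (f : pt -> R -> R) (x : pt) (s : R) : Prop :=
  match d with
  | Some i => derivable (fun y => f y s) x (e3 i)
  | None => derivable (f x) s 1
  end.
Fixpoint iterD (l : seq (option 'I_3)) (f : pt -> R -> R) : pt -> R -> R :=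
  match l with [::] => f | d :: l' => dirD d (iterD l' f) end.

Definition smooth_xt (f : pt -> R -> R) : Prop :=
  forall l : seq (option 'I_3),
    continuous (fun p : pt * R => iterD l f p.1 p.2) /\
    forall d x s, derivable_dir d (iterD l f) x s.
Definition smooth_x (g : pt -> R) : Prop := smooth_xt (fun x _ => g x).

Definition dx (i : 'I_3) (f : pt -> R -> R) : pt -> R -> R := dirD (Some i) f.
Definition dt (f : pt -> R -> R) : pt -> R -> R := dirD None f.
Definition dx0 (i : 'I_3) (g : pt -> R) : pt -> R := fun x => 'D_(e3 i) g x.

Definition test_scalar (T : R) (phi : pt -> R -> R) : Prop :=
  smooth_xt phi /\ (forall s, periodic3 (phi^~ s)) /\
  exists T', T' < T /\ forall x s, T' <= s -> phi x s = 0.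

Definition test_vector (T : R) (phi : 'I_3 -> pt -> R -> R) : Prop :=
  (forall i, smooth_xt (phi i) /\ forall s, periodic3 ((phi i)^~ s)) /\
  (exists T', T' < T /\ forall i x s, T' <= s -> phi i x s = 0) /\
  (forall x s, 0 <= s -> \sum_(i < 3) dx i (phi i) x s = 0).

Definition timeI (a b : R) : set R := [set s | a <= s <= b].

Definition ae_on (T : R) (P : R -> Prop) : Prop :=
  exists N : set R, mu.-negligible N /\ forall t, 0 <= t <= T -> ~ N t -> P t.

Definition cont_T3 (T : R) (f : pt -> R -> R) : Prop :=
  {within [set p : pt * R | 0 <= p.2 <= T], continuous (fun p : pt * R => f p.1 p.2)} /\
  forall s, 0 <= s <= T -> periodic3 (f^~ s).

Definition weak_solution (T : R) (vin : 'I_3 -> pt -> R) (thin : pt -> R)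
    (v : 'I_3 -> pt -> R -> R) (th : pt -> R -> R) : Prop :=
  (forall i, smooth_x (vin i) /\ periodic3 (vin i)) /\
  (smooth_x thin /\ periodic3 thin) /\
  (forall x, \sum_(i < 3) dx0 i (vin i) x = 0) /\
  (forall i, cont_T3 T (v i)) /\ cont_T3 T th /\
  ae_on T (fun t => forall psi, smooth_x psi -> periodic3 psi ->
     intT3 (fun x => \sum_(i < 3) v i x t * dx0 i psi x) = 0) /\
  (forall phi, test_vector T phi ->
     - intT3 (fun x => \sum_(i < 3) vin i x * phi i x 0)
     - \int[mu]_(s in timeI 0 T) intT3 (fun x => \sum_(i < 3) dt (phi i) x s * v i x s)
     = \int[mu]_(s in timeI 0 T) intT3 (fun x =>
          \sum_(i < 3) \sum_(j < 3) dx j (phi i) x s * (v i x s * v j x s)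
          + th x s * phi ord_max x s)) /\
  (forall phi, test_scalar T phi ->
     - intT3 (fun x => thin x * phi x 0)
     - \int[mu]_(s in timeI 0 T) intT3 (fun x => dt phi x s * th x s)
     = \int[mu]_(s in timeI 0 T) intT3 (fun x =>
          (\sum_(i < 3) v i x s * dx i phi x s) * th x s)).

(* L^q(T^3) norm, 1 <= q <= oo, for continuous periodic functions
   (for continuous f the essential sup equals the sup over the unit cube) *)
Definition Lq (q : \bar R) (f : pt -> R) : R :=
  match q with
  | +oo%E => sup [set `|f x| | x in cube]
  | r%:E => (intT3 (fun x => `|f x| `^ r)) `^ r^-1
  | -oo%E => 0
  end.

Definition conj_exp (p : \bar R) : \bar R :=
  match p with
  | r%:E => if r == 1 then +oo%E else (r / (r - 1))%:E
  | _ => 1%:E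
  end.

Definition LP_pair (chi vphi : pt -> R) : Prop :=
  smooth_x chi /\ smooth_x vphi /\
  (forall x y, eucl x = eucl y -> chi x = chi y /\ vphi x = vphi y) /\
  (forall x, 0 <= chi x <= 1 /\ 0 <= vphi x <= 1) /\
  (forall x, chi x != 0 -> eucl x <= 4 / 3) /\
  (forall x, eucl x <= 3 / 4 -> chi x = 1) /\
  (forall x, vphi x != 0 -> 3 / 4 <= eucl x <= 8 / 3) /\
  (forall x, (fun N : nat => chi x + \sum_(j < N) vphi ((2 ^- j) *: x)) @ \oo --> (1:R)).

(* Delta_j u for j = n - 1 (n : nat), so n = 0 is Delta_{-1}; the Fourier
   multiplier applied to the real-valued u, written in real form
   sum_k m(k) \int u(y) cos(2 pi k.(x-y)) dy  (m is even, being radial).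
   The sum over k in Z^3 is over a box containing the support of m. *)
Definition LPmult (chi vphi : pt -> R) (n : nat) (k : pt) : R :=
  match n with 0%N => chi k | m.+1 => vphi ((2 ^- m) *: k) end.

Definition LPblock (chi vphi : pt -> R) (n : nat) (u : pt -> R) (x : pt) : R :=
  let N := (3 * 2 ^ n.+1)%N in
  \sum_(a < (2 * N).+1) \sum_(b < (2 * N).+1) \sum_(c < (2 * N).+1)
    let k := vec3 (a%:R - N%:R) (b%:R - N%:R) (c%:R - N%:R) in
    LPmult chi vphi n k *
    intT3 (fun y => u y * cos (2 * pi * \sum_(i < 3) k 0 i * (x 0 i - y 0 i))).

(* 2^{j/3} with j = n - 1 *)
Definition wgt (n : nat) : R := 2 `^ ((n%:R - 1) / 3).

Definition besov_c (chi vphi : pt -> R) (q : \bar R) (u : pt -> R) : Prop :=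
  (exists M : R, forall n, wgt n * Lq q (LPblock chi vphi n u) <= M) /\
  (fun n => wgt n * Lq q (LPblock chi vphi n u)) @ \oo --> (0:R).

Definition besov_norm (chi vphi : pt -> R) (q : \bar R) (u : pt -> R) : \bar R :=
  ereal_sup (range (fun n => (wgt n * Lq q (LPblock chi vphi n u))%:E)).

Definition Ltime (r : \bar R) (T : R) (g : R -> \bar R) : Prop :=
  match r with
  | +oo%E => exists M : R, ae_on T (fun t => (g t <= M%:E)%E)
  | r'%:E => (\int[mu]_(t in timeI 0 T) (g t `^ r')%E < +oo)%E
  | -oo%E => False
  end.

Definition L_besov (chi vphi : pt -> R) (r q : \bar R) (T : R) (f : pt -> R -> R) : Prop :=
  ae_on T (fun t => besov_c chi vphi q (f^~ t)) /\
  Ltime r T (fun t => besov_norm chi vphi q (f^~ t)).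

Definition C_Lq (q : \bar R) (T : R) (f : pt -> R -> R) : Prop :=
  forall t0, 0 <= t0 <= T ->
    (fun t => Lq q (fun x => f x t - f x t0)) @ within (timeI 0 T) (nbhs t0) --> (0:R).

End Boussinesq.

(* Main.v *)
Require Import Defs.
From HB Require Import structures.
From mathcomp Require Import all_boot all_order all_algebra.
From mathcomp Require Import all_classical all_reals all_analysis.
From mathcomp Require Import measurable_realfun ring lra.
Import Order.TTheory GRing.Theory Num.Theory.
Import numFieldNormedType.Exports.
Local Open Scope classical_set_scope.
Local Open Scope ring_scope.
Set Implicit Arguments. Unset Strict Implicit. Unset Printing Implicit Defensive.

(** Regularise by convolution with the Jackson kernel [jack N], [N = 2 ^ J]:
    it is nonnegative, even, of mass one and a trigonometric polynomial, so the
    Littlewood-Paley sum of a regularised function is finite and Bernstein's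
    inequality applies to every block.  Testing the weak formulation with
    [bump(s) * jack N (x - y)] makes [th_N] an integral in time, and for smooth
    [beta] one finds that [int beta(th_N)] changes by the time integral of the flux
    [sum_i int beta''(th_N) d_i th_N (v_i th)_N].  Since [v_N] is divergence free,
    [(v_i th)_N] may be replaced by the Constantin-E-Titi commutator
    [(v_i th)_N - (v_i)_N th_N].  With [a_n] the weighted L^2 norms of the blocks
    of [th], [A] their supremum and [V] the Besov bound on [v], its L^2 norm is
    [O(V A N^(-2/3))], while that of [d_i th_N] is at most
    [C N^(2/3) sum_n 2^(-|n - J|/3) a_n].  The product tends to zero
    at almost every time because [a_n] does, and it is dominated by [C V A^2].
    The velocity is treated with the test field [K * K * v(tau)] frozen at
    time [tau], differentiating [int v_N(t) v_N(tau)] along the diagonal.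
    Finally [beta(z) = (z^2 + d)^(p/2)] with [d -> 0] gives finite [p], and the
    even moments [z^(2n)] determine the sup norm. *)

(** * Integrals of continuous functions *)

(** Squaring the Fejer kernel is forced: the commutator bound needs a kernel whose second moment is
    [O(N^(-2))], and that of the normalised Fejer kernel is only of order [1/N]. The exponent [1/3]
    is exactly critical: two increments and one gradient each bring a factor [N^(-1/3)], which just
    cancels the [N] lost to the derivative, so that nothing but the decay of [a_n] produces
    convergence. One [L^2] argument serves every [p], because the space and time exponents assumed
    on [th] are always at least 2, the torus has mass one, and [beta''] is bounded on the range of
    the bounded function [th]. The velocity cannot be its own test field, being merely continuous in
    time; frozen at [tau] and regularised it is a divergence-free trigonometric polynomial, hence
    admissible. The solution is extended to all times by constants outside [[0, T]], which makes it
    globally continuous. Fubini, parameter integrals and differentiation under the integral can then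
    be derived from compactness and the fundamental theorem of calculus; measure theory enters
    through the almost-everywhere hypotheses and the final dominated convergence. *)

(* locked: conversion would otherwise unfold the Lebesgue integral *)
HB.lock Definition J (R : realType) (a b : R) (f : R -> R) : R :=
  \int[@lebesgue_measure R]_(x in timeI a b) f x.
Arguments J {R}.

Section OneDim.
Variable R : realType.
Local Notation mu := (@lebesgue_measure R).

Lemma JE (a b : R) (f : R -> R) : J a b f = \int[mu]_(x in timeI a b) f x.
Proof. by rewrite J.unlock. Qed.

Lemma timeIE (a b : R) : timeI a b = `[a, b]%classic.
Proof. by apply/seteqP; split=> x /=; rewrite /timeI /= in_itv. Qed.

Lemma timeI_measurable (a b : R) : measurable (timeI a b).
Proof. by rewrite timeIE; exact: measurable_itv. Qed.

Lemma cont_integrable (a b : R) (f : R -> R) : continuous f ->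
  mu.-integrable (timeI a b) (EFin \o f).
Proof.
move=> cf; rewrite timeIE; apply: continuous_compact_integrable.
  exact: segment_compact.
by apply: continuous_subspaceT.
Qed.

Lemma JD a b (f g : R -> R) : continuous f -> continuous g ->
  J a b (fun x => f x + g x) = J a b f + J a b g.
Proof.
move=> cf cg; rewrite !JE; apply: RintegralD.
- exact: timeI_measurable.
- exact: cont_integrable.
- exact: cont_integrable.
Qed.

Lemma JZ a b c (f : R -> R) : continuous f -> J a b (fun x => c * f x) = c * J a b f.
Proof.
move=> cf; rewrite !JE; apply: RintegralZl; [exact: timeI_measurable|exact: cont_integrable].
Qed.

Lemma J_ext a b (f g : R -> R) : (forall x, a <= x <= b -> f x = g x) -> J a b f = J a b g.
Proof. by move=> fg; rewrite !JE; apply: eq_Rintegral => x /[!inE] /= ?; apply: fg. Qed.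

Lemma J_le a b (f g : R -> R) : continuous f -> continuous g ->
  (forall x, a <= x <= b -> f x <= g x) -> J a b f <= J a b g.
Proof.
move=> cf cg fg; rewrite !JE; apply: le_Rintegral => //; first exact: timeI_measurable.
- exact: cont_integrable.
- exact: cont_integrable.
Qed.

Lemma JB a b x (f : R -> R) : continuous f -> a <= x -> x <= b ->
  J a b f - J a x f = J x b f.
Proof.
move=> cf ax xb; rewrite !JE !timeIE Rintegral_itvB //.
- rewrite Rintegral_itv_obnd_cbnd //.
  apply: (@integrableS _ _ _ mu (timeI x b)); last exact: cont_integrable.
  + exact: timeI_measurable.
  + exact: measurable_itv.
  + by rewrite timeIE; apply: subset_itvr; rewrite bnd_simp.
- by rewrite -timeIE; exact: cont_integrable.
Qed.

(* [is_derive] without its type-class behaviour *)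
Definition der (V : normedModType R) (f : V -> R) (x v : V) (l : R) : Prop :=
  is_derive x v f l.

Section Der.
Variable V : normedModType R.
Implicit Types (f g : V -> R) (x v : V).

Lemma der_cst (c : R) x v : der (fun _ => c) x v 0.
Proof. exact: is_derive_cst. Qed.

Lemma derD f g x v a b : der f x v a -> der g x v b -> der (fun y => f y + g y) x v (a + b).
Proof. exact: is_deriveD. Qed.

Lemma derN f x v a : der f x v a -> der (fun y => - f y) x v (- a).
Proof. exact: is_deriveN. Qed.

Lemma derM f g x v a b : der f x v a -> der g x v b ->
  der (fun y => f y * g y) x v (a * g x + f x * b).
Proof.
move=> da db; rewrite addrC [X in _ + X]mulrC; exact: (@is_deriveM _ _ f g x v a b da db).
Qed.

Lemma derZ f x v a c : der f x v a -> der (fun y => c * f y) x v (c * a).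
Proof. by move=> da; exact: (@is_deriveZ _ _ _ f c x v a da). Qed.

Lemma der_sum n (F : 'I_n -> V -> R) (dF : 'I_n -> R) x v :
  (forall i, der (F i) x v (dF i)) ->
  der (fun y => \sum_(i < n) F i y) x v (\sum_(i < n) dF i).
Proof.
move=> H; have -> : (fun y => \sum_(i < n) F i y) = \sum_(i < n) F i.
  by apply: funext => y; rewrite fct_sumE.
exact: is_derive_sum.
Qed.

Lemma der_ex f x v l : der f x v l -> derivable f x v.
Proof. by case. Qed.

Lemma der_val f x v l : der f x v l -> 'D_v f x = l.
Proof. by case. Qed.

Lemma der_unique f x v a b : der f x v a -> der f x v b -> a = b.
Proof. by move=> [_ <-] [_ <-]. Qed.

(** Caratheodory's form of differentiability. The factorisation is asked only near 0 because the
    energy balance of the velocity is known only for times in [[0, T]]. *)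
Lemma der_slope_near f x v (q : R -> R) :
  (\forall h \near (0 : R), f (h *: v + x) - f x = h * q h) -> {for 0, continuous q} ->
  der f x v (q 0).
Proof.
move=> Hq cq.
have H : (fun h : R => h^-1 *: (f (h *: v + x) - f x)) @ 0^' --> q 0.
  apply: (@cvg_trans _ (q @ 0^')); last exact: cvg_within_filter.
  apply: near_eq_cvg; near=> h.
  have -> : f (h *: v + x) - f x = h * q h by near: h; exact: nbhs_dnbhs.
  rewrite /GRing.scale /= mulrA mulVf ?mul1r //.
  by near: h; exact: nbhs_dnbhs_neq.
split; first by apply/cvg_ex; exists (q 0).
exact: cvg_lim H.
Unshelve. all: by end_near. Qed.

Lemma der_slope f x v (q : R -> R) :
  (forall h, f (h *: v + x) - f x = h * q h) -> {for 0, continuous q} ->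
  der f x v (q 0).
Proof. by move=> Hq; apply: der_slope_near; exact: filterE. Qed.

End Der.

Lemma der_id (x : R) : der (fun y => y) x (1 : R) 1.
Proof. exact: is_derive_id. Qed.

Lemma der_comp (f : R -> R) (g : R -> R) (x df dg : R) :
  der f x (1 : R) df -> der g (f x) (1 : R) dg -> der (fun y => g (f y)) x (1 : R) (dg * df).
Proof. by move=> d1 d2; exact: (@is_derive1_comp _ g f x dg df d2 d1). Qed.

Lemma der_cont (F f : R -> R) : (forall x : R, der F x (1 : R) (f x)) -> continuous F.
Proof.
by move=> dF x; apply: differentiable_continuous; apply/derivable1_diffP; case: (dF x).
Qed.

Section Cont.
Variable X : topologicalType.
Implicit Types f g : X -> R.

Lemma c_cst (c : R) : continuous (fun _ : X => c).
Proof. by move=> x; exact: cst_continuous. Qed.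

Lemma cD f g : continuous f -> continuous g -> continuous (fun x => f x + g x).
Proof. by move=> cf cg x; apply: cvgD; [exact: cf|exact: cg]. Qed.

Lemma cM f g : continuous f -> continuous g -> continuous (fun x => f x * g x).
Proof. by move=> cf cg x; apply: cvgM; [exact: cf|exact: cg]. Qed.

Lemma cN f : continuous f -> continuous (fun x => - f x).
Proof. by move=> cf x; apply: cvgN; exact: cf. Qed.

Lemma c_abs f : continuous f -> continuous (fun x => `|f x|).
Proof. by move=> cf x; apply: cvg_norm; exact: cf. Qed.

Lemma cX f n : continuous f -> continuous (fun x => f x ^+ n).
Proof.
move=> cf; elim: n => [|n IH]; first exact: c_cst.
by under eq_fun do rewrite exprS; exact: cM.
Qed.

Lemma c_sum n (F : 'I_n -> X -> R) : (forall i, continuous (F i)) ->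
  continuous (fun x => \sum_(i < n) F i x).
Proof.
elim: n F => [|n IH] F cF.
  by under eq_fun do rewrite big_ord0; exact: c_cst.
under eq_fun do rewrite big_ord_recl; apply: cD; first exact: cF.
by apply: IH => i; exact: cF.
Qed.

Lemma c_comp (Y : topologicalType) (g : Y -> R) (h : X -> Y) :
  continuous g -> continuous h -> continuous (fun x => g (h x)).
Proof. by move=> cg ch x; apply: (cvg_comp h g); [exact: ch|exact: cg]. Qed.

Lemma c_pair (Y Z : topologicalType) (g : X -> Y) (h : X -> Z) :
  continuous g -> continuous h -> continuous (fun x => (g x, h x)).
Proof. by move=> cg ch x; apply: cvg_pair; [exact: cg|exact: ch]. Qed.

Lemma c_comp2 (Y Z : topologicalType) (g : Y -> Z -> R) (h : X -> Y) (k : X -> Z) :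
  continuous (fun p : Y * Z => g p.1 p.2) -> continuous h -> continuous k ->
  continuous (fun x => g (h x) (k x)).
Proof.
move=> cg ch ck x.
apply: (@cvg_comp _ _ _ (fun x => (h x, k x)) (fun p : Y * Z => g p.1 p.2)).
  exact: (c_pair ch ck).
exact: (cg (h x, k x)).
Qed.

Lemma c_fst (Y : topologicalType) : continuous (fun p : X * Y => p.1).
Proof. by move=> p; exact: cvg_fst. Qed.

Lemma c_snd (Y : topologicalType) : continuous (fun p : Y * X => p.2).
Proof. by move=> p; exact: cvg_snd. Qed.

Lemma c_fst' (Y Z : topologicalType) (h : X -> Y * Z) :
  continuous h -> continuous (fun x => (h x).1).
Proof. by move=> ch x; apply: (cvg_comp h fst); [exact: ch|exact: cvg_fst]. Qed.

Lemma c_snd' (Y Z : topologicalType) (h : X -> Y * Z) :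
  continuous h -> continuous (fun x => (h x).2).
Proof. by move=> ch x; apply: (cvg_comp h snd); [exact: ch|exact: cvg_snd]. Qed.

Lemma c_cst' (Y : topologicalType) (c : Y) : continuous (fun _ : X => c).
Proof. by move=> x; exact: cst_continuous. Qed.

Lemma c_id : continuous (fun x : X => x).
Proof. by move=> x; exact: cvg_id. Qed.

End Cont.

Lemma J_FTC (a b : R) (f F : R -> R) : a <= b -> continuous f -> continuous F ->
  (forall x : R, a < x < b -> der F x (1 : R) (f x)) -> J a b f = F b - F a.
Proof.
rewrite le_eqVlt => /predU1P[<-|ab] cf cF dF.
  by rewrite JE timeIE set_itv1 Rintegral_set1 subrr.
rewrite JE /Rintegral timeIE (@continuous_FTC2 _ f F a b) //.
- by apply: continuous_subspaceT.
- split; first by move=> x; rewrite in_itv /= => /dF [].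
  + by apply: cvg_at_right_filter; exact: cF.
  + by apply: cvg_at_left_filter; exact: cF.
- by move=> x; rewrite in_itv /= => /dF [? <-]; rewrite derive1E.
Qed.

Lemma J_cst (a b c : R) : a <= b -> J a b (fun _ => c) = c * (b - a).
Proof.
move=> ab; have H x : a < x < b -> der (fun x => c * x) x (1 : R) c.
  by move=> _; rewrite -[X in der _ _ _ X]mulr1; apply: derZ; exact: der_id.
rewrite (@J_FTC a b (fun _ => c) _ ab _ _ H) ?mulrBr //.
- by move=> x; exact: cst_continuous.
- by move=> x; apply: cvgM; [exact: cvg_cst|exact: cvg_id].
Qed.

Lemma J_der (a x : R) (f : R -> R) : continuous f -> a < x -> der (fun t => J a t f) x (1 : R) (f x).
Proof.
move=> cf ax.
have := @continuous_FTC1_closed R f a x (x + 1).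
have -> : (fun t => (\int[mu]_(t0 in `[a, t]) f t0)) = (fun t => J a t f).
  by apply: funext => t; rewrite JE timeIE.
move=> [] //.
- by rewrite ltrDl.
- by rewrite -timeIE; exact: cont_integrable.
- exact: cf.
- by move=> d; rewrite derive1E => e; split.
Qed.

(** The signed integral from 0 differs near [x] by a constant from the integral starting at [- B], a
    point to the left of both [x] and 0, so the one-sided fundamental theorem applies. *)
Lemma prim_ex (f : R -> R) : continuous f -> exists F : R -> R, forall x : R, der F x (1 : R) (f x).
Proof.
move=> cf; pose F t := if 0 <= t then J 0 t f else - J t 0 f.
exists F => x; pose B := `|x| + 1.
have Bx : - B < x by rewrite /B; have := ler_norm (- x); rewrite normrN; lra.
have B0 : - B <= 0 by rewrite /B; have := normr_ge0 x; lra.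
have E : \forall t \near x, J (- B) t f - J (- B) 0 f = F t.
  near=> t; have Bt : - B < t by near: t; exact: lt_nbhsr.
  rewrite /F; case: ifPn => t0; first by rewrite JB.
  by rewrite -[RHS]/(- J t 0 f) -(@JB (- B) 0 t) ?opprB // ltW // ltNge.
apply: (near_eq_is_derive E).
rewrite -[X in is_derive _ _ _ X]addr0.
exact: (derD (J_der cf Bx) (der_cst (- J (- B) 0 f) x (1 : R))).
Unshelve. all: by end_near. Qed.

End OneDim.

Ltac cont1 := lazymatch goal with
  | |- continuous (fun zz => zz) => exact: c_id
  | |- continuous (fun _ => ?c) => exact: c_cst'
  | |- continuous (fun _ => _ + _) => apply: cD
  | |- continuous (fun _ => - _) => apply: cN
  | |- continuous (fun _ => _ * _) => apply: cM
  | |- continuous (fun _ => _ ^+ _) => apply: cX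
  | |- continuous (fun _ => `|_|) => apply: c_abs
  | |- continuous (fun _ => \sum_(i < _) _) => apply: c_sum => ?
  | |- continuous (fun _ => (_, _)) => apply: c_pair
  | |- continuous fst => exact: c_fst
  | |- continuous snd => exact: c_snd
  | |- continuous (fun _ => fst _) => apply: c_fst'
  | |- continuous (fun _ => snd _) => apply: c_snd'
  end.
Ltac contH := match goal with
  | H : continuous ?f |- continuous ?f => exact: H
  | H : continuous ?f |- continuous (fun _ => ?f _) => apply: (c_comp H)
  | H : continuous (fun zz => ?f zz.1 zz.2) |- continuous (fun _ => ?f _ _) => apply: (c_comp2 H)
  | H : forall i, continuous (?f i) |- continuous (?f ?j) => exact: (H j)
  | H : forall i, continuous (?f i) |- continuous (fun _ => ?f ?j _) => apply: (c_comp (H j))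
  | H : forall i, continuous (fun zz => ?f i zz.1 zz.2) |- continuous (fun _ => ?f ?j _ _) =>
      apply: (c_comp2 (H j))
  end.
Ltac cont := repeat (first [cont1 | contH]).

Section OneDim2.
Variable R : realType.
Local Notation mu := (@lebesgue_measure R).

Lemma J_abs_le (a b M : R) (f : R -> R) : a <= b -> continuous f ->
  (forall x, a <= x <= b -> `|f x| <= M) -> `|J a b f| <= M * (b - a).
Proof.
move=> ab cf fM; rewrite ler_norml; apply/andP; split.
  rewrite -mulNr -J_cst //; apply: J_le => //; first exact: c_cst.
  by move=> x /fM; rewrite ler_norml => /andP[].
rewrite -J_cst //; apply: J_le => //; first exact: c_cst.
by move=> x /fM; rewrite ler_norml => /andP[].
Qed.

Lemma c_slice (X Y : topologicalType) (F : X -> Y -> R) (x : X) :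
  continuous (fun p : X * Y => F p.1 p.2) -> continuous (F x).
Proof. by move=> cF; apply: (c_comp2 cF) => y; [exact: cst_continuous|exact: cvg_id]. Qed.

(** The tube lemma in near-covering form: compactness of [K] makes the neighbourhood of [x0] uniform
    in [y]. *)
Lemma unif_near (X Y : topologicalType) (F : X -> Y -> R) (K : set Y) x0 (e : R) :
  compact K -> continuous (fun p : X * Y => F p.1 p.2) -> 0 < e ->
  \forall x \near x0, forall y, K y -> `|F x y - F x0 y| <= e.
Proof.
move=> cK cF e0.
apply: (proj1 (compact_near_coveringP K) cK X (nbhs x0) (fun x y => `|F x y - F x0 y| <= e)).
move=> y Ky; have e2 : 0 < e / 2 by rewrite divr_gt0.
have cG : continuous (fun p : Y * X => F p.2 p.1).
  by apply: (c_comp2 cF); [exact: c_snd|exact: c_fst].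
have cH : continuous (fun p : Y * X => F x0 p.1).
  by apply: (c_comp2 cF); [move=> ?; exact: cst_continuous|exact: c_fst].
have /cvgrPdist_lt/(_ _ e2) := cG (y, x0).
have /cvgrPdist_lt/(_ _ e2) := cH (y, x0).
apply: filterS2 => -[y' x'] /= H1 H2.
rewrite (_ : _ - _ = (F x0 y - F x0 y') - (F x0 y - F x' y')); last by ring.
by apply: le_trans (ler_normB _ _) _; rewrite (splitr e); apply: lerD; exact: ltW.
Qed.

Lemma timeI_compact (a b : R) : compact (timeI a b).
Proof. by rewrite timeIE; exact: segment_compact. Qed.

(** [X] is an arbitrary space so that the result can be applied with products as parameter and
    iterated over nested integrals. *)
Lemma J_param (X : topologicalType) (a b : R) (F : X -> R -> R) : a <= b ->
  continuous (fun p : X * R => F p.1 p.2) -> continuous (fun x => J a b (F x)).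
Proof.
move=> ab cF x0; apply/cvgrPdist_le => e e0.
have e1 : 0 < e / (b - a + 1) by rewrite divr_gt0 // ltr_wpDl // subr_ge0.
have := @unif_near X R F (timeI a b) x0 _ (@timeI_compact a b) cF e1.
apply: filterS => x H.
rewrite distrC -mulN1r -JZ; last exact: c_slice.
rewrite -JD; [|exact: c_slice|by apply: cM; [exact: c_cst|exact: c_slice]].
apply: le_trans (J_abs_le ab _ (M := e / (b - a + 1)) _) _.
- by apply: cD; [exact: c_slice|apply: cM; [exact: c_cst|exact: c_slice]].
- by move=> t abt; rewrite mulN1r; exact: H.
- rewrite mulrAC ler_pdivrMr; last by rewrite ltr_wpDl // subr_ge0.
  by rewrite ler_wpM2l ?lerDl // ltW.
Qed.

Lemma J_prim (a b : R) (f F : R -> R) : a <= b -> continuous f ->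
  (forall x : R, der F x (1 : R) (f x)) -> J a b f = F b - F a.
Proof.
by move=> ab cf dF; apply: J_FTC => //; exact: der_cont dF.
Qed.

Lemma der_affine (s h x : R) : der (fun y : R => s + y * h) x (1 : R) h.
Proof.
rewrite -[X in der _ _ _ X](_ : 0 + (1 * h + x * 0) = h); last by ring.
by apply: derD; [exact: der_cst|apply: derM; [exact: der_id|exact: der_cst]].
Qed.

Lemma c_affine (s h : R) : continuous (fun y : R => s + y * h).
Proof. exact: (der_cont (der_affine s h)). Qed.

(* the mean-value form of the fundamental theorem, valid for either sign of h *)
Lemma J_slope (f F : R -> R) (s h : R) : continuous f ->
  (forall x : R, der F x (1 : R) (f x)) ->
  F (s + h) - F s = h * J 0 1 (fun y => f (s + y * h)).
Proof.
move=> cf dF; have cfa : continuous (fun y : R => f (s + y * h)).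
  by apply: (c_comp cf); exact: c_affine.
rewrite -JZ // (@J_prim 0 1 _ (fun y => F (s + y * h))) ?ler01 //.
- by rewrite mul1r mul0r addr0.
- by apply: cM => //; exact: c_cst.
- by move=> x; rewrite mulrC; apply: der_comp; [exact: der_affine|exact: dF].
Qed.

(** Both sides, as functions of the upper limit [b], vanish at [a] and have the same derivative; no
    product measure is involved. *)
Lemma J_fubini (a b c d : R) (f : R -> R -> R) : a <= b -> c <= d ->
  continuous (fun p : R * R => f p.1 p.2) ->
  J a b (fun x => J c d (fun y => f x y)) = J c d (fun y => J a b (fun x => f x y)).
Proof.
move=> ab cd cf.
have cf' : continuous (fun p : R * R => f p.2 p.1).
  by apply: (c_comp2 cf); [exact: c_snd|exact: c_fst].
have cfy y : continuous (f^~ y) := @c_slice R R (fun u v => f v u) y cf'.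
have cI : continuous (fun x => J c d (f x)) by exact: J_param.
(* The primitive in [t], rescaled to the fixed interval [[0, 1]]: it makes sense on both sides of
   [a], and its joint continuity follows from [J_param]. *)
pose P y t := (t - a) * J 0 1 (fun s => f (a + s * (t - a)) y).
have PE y t : a <= t -> P y t = J a t (f^~ y).
  move=> at_; have [F dF] := prim_ex (cfy y).
  by rewrite (J_prim at_ (cfy y) dF) /P -(J_slope _ _ (cfy y) dF) (addrC a) subrK.
have PD y t h : P y (t + h) - P y t = h * J 0 1 (fun s => f (t + s * h) y).
  have [F dF] := prim_ex (cfy y).
  rewrite /P -!(J_slope _ _ (cfy y) dF).
  by rewrite !(addrC a) !subrK; ring.
have cQ (s : R) : continuous (fun p : R * R => J 0 1 (fun r => f (s + r * p.1) p.2)).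
  apply: (@J_param (R * R)%type 0 1 (fun p r => f (s + r * p.1) p.2)); first exact: ler01.
  by cont.
have cP : continuous (fun p : R * R => P p.2 p.1).
  apply: cM; first by apply: cD; [exact: c_fst|exact: c_cst].
  apply: (@c_comp2 R _ _ _ (fun h y => J 0 1 (fun r => f (a + r * h) y)) (fun p => p.1 - a) snd).
  - exact: cQ.
  - by apply: cD; [exact: c_fst|exact: c_cst].
  - exact: c_snd.
pose psi t := J c d (fun y => P y t).
have dpsi t : der psi t (1 : R) (J c d (f t)).
  have -> : J c d (f t) = J c d (fun y => J 0 1 (fun r => f (t + r * 0) y)).
    apply: J_ext => y _; rewrite -[LHS]mulr1 -{1}(subr0 1) -J_cst ?ler01 //.
    by apply: J_ext => r _; rewrite mulr0 addr0.
  apply: (@der_slope R R psi t 1 (fun h => J c d (fun y => J 0 1 (fun r => f (t + r * h) y)))).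
    have cQh h : continuous (fun y => J 0 1 (fun r => f (t + r * h) y)).
      exact: (@c_slice R R (fun h y => J 0 1 (fun r => f (t + r * h) y)) h (cQ t)).
    have cPt s : continuous (P^~ s) by exact: (@c_slice R R (fun s y => P y s) s cP).
    move=> h; rewrite /psi -JZ // -mulN1r -JZ // -JD //; last by cont.
    by apply: J_ext => y _; rewrite mulN1r [_ *: _]mulr1 (addrC h) PD.
  exact: (J_param cd (cQ t)).
rewrite (J_prim ab cI dpsi) /psi.
rewrite -[RHS]subr0; congr (_ - _); first by apply: J_ext => y _; exact: PE.
rewrite -[RHS](mul0r (d - c)) -J_cst //; apply: J_ext => y _.
by rewrite /P subrr mul0r.
Qed.

(** With a primitive [F], the integral over [[s, s + 1]] is [F (s + 1) - F s], whose derivative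
    [f (s + 1) - f s] vanishes. *)
Lemma J_shift (f : R -> R) (h : R) : continuous f -> (forall x, f (x + 1) = f x) ->
  J 0 1 (fun x => f (x + h)) = J 0 1 f.
Proof.
move=> cf pf; have [F dF] := prim_ex cf.
have E s : F (s + 1) - F s = J 0 1 (fun x => f (x + s)).
  rewrite (J_slope _ _ cf dF) mul1r; apply: J_ext => x _.
  by rewrite mulr1 addrC.
rewrite -E; have -> : J 0 1 f = F (0 + 1) - F 0.
  by rewrite E; apply: J_ext => x _; rewrite addr0.
apply: (is_derive_0_is_cst (f := fun s => F (s + 1) - F s)) => s.
rewrite -[X in is_derive _ _ _ X](_ : f (s + 1) * (1 + 0) - f s = 0); last by rewrite pf addr0 mulr1 subrr.
apply: derD; last by apply: derN; exact: dF.
apply: (@der_comp R (fun s => s + 1) F); last exact: dF.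
by apply: derD; [exact: der_id|exact: der_cst].
Qed.

(** Nonpositive discriminant, tested at the minimiser [s = b / c]. Both Cauchy-Schwarz inequalities
    below rest on it. *)
Lemma quad_CS (a b c : R) : 0 <= a -> 0 <= c ->
  (forall s, 0 <= a - 2 * s * b + s ^+ 2 * c) -> b ^+ 2 <= a * c.
Proof.
rewrite [0 <= c]le_eqVlt => a0 /predU1P[<-|c0] H.
  rewrite mulr0; have [->|b0] := eqVneq b 0; first by rewrite expr0n.
  (* When [c = 0] the expression is affine in [s], and this [s] gives it the value -1. *)
  have := H ((a + 1) / (2 * b)); rewrite mulr0 addr0.
  by rewrite (_ : 2 * _ * b = a + 1); [lra|field].
have := H (b / c); have -> : a - 2 * (b / c) * b + (b / c) ^+ 2 * c = (a * c - b ^+ 2) / c.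
  by field; exact: lt0r_neq0.
by rewrite pmulr_lge0 ?invr_gt0 // subr_ge0.
Qed.

Lemma J_ge0 (a b : R) (f : R -> R) : (forall x, 0 <= f x) -> 0 <= J a b f.
Proof. by move=> f0; rewrite JE; apply: Rintegral_ge0 => x _; exact: f0. Qed.

(** The weight [w] plays the role of a measure; taking it to be the modulus of a kernel yields
    Jensen-type bounds for convolutions. *)
Lemma J_CS (a b : R) (w f g : R -> R) : continuous w -> continuous f -> continuous g ->
  (forall x, 0 <= w x) ->
  (J a b (fun x => w x * (f x * g x))) ^+ 2 <=
  J a b (fun x => w x * f x ^+ 2) * J a b (fun x => w x * g x ^+ 2).
Proof.
move=> cw cf cg w0.
have c1 : continuous (fun x => w x * f x ^+ 2) by apply: cM => //; exact: cX.
have c2 : continuous (fun x => w x * g x ^+ 2) by apply: cM => //; exact: cX.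
have c3 : continuous (fun x => w x * (f x * g x)) by apply: cM => //; exact: cM.
apply: quad_CS => [||s].
- by apply: J_ge0 => x; rewrite mulr_ge0 // sqr_ge0.
- by apply: J_ge0 => x; rewrite mulr_ge0 // sqr_ge0.
- have : 0 <= J a b (fun x => w x * (f x - s * g x) ^+ 2).
    by apply: J_ge0 => x; rewrite mulr_ge0 // sqr_ge0.
  have -> : (fun x => w x * (f x - s * g x) ^+ 2) = (fun x => w x * f x ^+ 2 +
      ((- (2 * s)) * (w x * (f x * g x)) + s ^+ 2 * (w x * g x ^+ 2))).
    by apply: funext => x; ring.
  have c4 : continuous (fun x => s ^+ 2 * (w x * g x ^+ 2)) by apply: cM => //; exact: c_cst.
  have c5 : continuous (fun x => - (2 * s) * (w x * (f x * g x))) by apply: cM => //; exact: c_cst.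
  rewrite JD //; last exact: cD.
  by rewrite JD // !JZ // mulNr addrA.
Qed.

End OneDim2.

(** * Integration of continuous functions over the unit cube *)

HB.lock Definition I3 (R : realType) (f : 'rV[R]_3 -> R) : R := intT3 f.
Arguments I3 {R}.

Section Three.
Variable R : realType.
Local Notation pt := 'rV[R]_3.

Lemma ord3P (P : 'I_3 -> Prop) : P ord0 -> P (lift ord0 ord0) -> P ord_max -> forall i, P i.
Proof.
move=> P0 P1 P2 i; case: i => -[|[|[|i]]] Hi //.
- by rewrite (_ : Ordinal Hi = ord0) //; apply: val_inj.
- by rewrite (_ : Ordinal Hi = lift ord0 ord0) //; apply: val_inj.
- by rewrite (_ : Ordinal Hi = ord_max) //; apply: val_inj.
Qed.

Lemma sum3 (F : 'I_3 -> R) : \sum_(i < 3) F i = F ord0 + F (lift ord0 ord0) + F ord_max.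
Proof.
rewrite !big_ord_recl big_ord0 addr0 addrA; congr (_ + _ + F _); exact: val_inj.
Qed.

Lemma vec3E (x : pt) : x = vec3 (x 0 ord0) (x 0 (lift ord0 ord0)) (x 0 ord_max).
Proof. by apply/rowP; elim/ord3P; rewrite !mxE. Qed.

Lemma I3E (f : pt -> R) : I3 f = intT3 f.
Proof. by rewrite I3.unlock. Qed.

Lemma intT3E (f : pt -> R) :
  I3 f = J 0 1 (fun a => J 0 1 (fun b => J 0 1 (fun c => f (vec3 a b c)))).
Proof.
rewrite I3E /intT3 JE; apply: eq_Rintegral => a _.
by rewrite JE; apply: eq_Rintegral => b _; rewrite JE.
Qed.

Lemma c_coord (X : topologicalType) (f : X -> pt) i :
  continuous f -> continuous (fun x => f x 0 i).
Proof. by move=> cf x; apply: (cvg_comp f (fun y : pt => y 0 i)); [exact: cf|exact: coord_continuous]. Qed.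

Lemma c_vec3 (X : topologicalType) (f g h : X -> R) :
  continuous f -> continuous g -> continuous h -> continuous (fun x => vec3 (f x) (g x) (h x)).
Proof.
move=> cf cg ch.
have -> : (fun x => vec3 (f x) (g x) (h x)) = (fun x => f x *: e3 R ord0 + g x *: e3 R (lift ord0 ord0) + h x *: e3 R ord_max).
  by apply: funext => x; apply/rowP; elim/ord3P; rewrite !mxE /=; ring.
move=> x; apply: cvgD; [apply: cvgD|]; apply: cvgZr_tmp; [exact: cf|exact: cg|exact: ch].
Qed.

Lemma c_addv (X : topologicalType) (f g : X -> pt) :
  continuous f -> continuous g -> continuous (fun x => f x + g x).
Proof. by move=> cf cg x; apply: cvgD; [exact: cf|exact: cg]. Qed.

Lemma c_oppv (X : topologicalType) (f : X -> pt) :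
  continuous f -> continuous (fun x => - f x).
Proof. by move=> cf x; apply: cvgN; exact: cf. Qed.

Lemma c_scalev (X : topologicalType) (f : X -> R) (g : X -> pt) :
  continuous f -> continuous g -> continuous (fun x => f x *: g x).
Proof. by move=> cf cg x; apply: cvgZ; [exact: cf|exact: cg]. Qed.
End Three.

Ltac cont2 := lazymatch goal with
  | |- continuous (fun _ => fun_of_matrix _ _ _) => apply: c_coord
  | |- continuous (fun _ => vec3 _ _ _) => apply: c_vec3
  | |- continuous (vec3 ?a ?b) => apply: (@c_vec3 _ _ (fun=> a) (fun=> b) (fun c => c))
  | |- continuous (@GRing.add _ ?a) =>
      first [apply: (@cD _ _ (fun=> a) (fun b => b)) | apply: (@c_addv _ _ (fun=> a) (fun b => b))]
  | |- continuous (@GRing.mul _ ?a) => apply: (@cM _ _ (fun=> a) (fun b => b))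
  | |- continuous (@GRing.opp _) =>
      first [apply: (@cN _ _ (fun b => b)) | apply: (@c_oppv _ _ (fun b => b))]
  | |- continuous (@GRing.scale _ _ ?a) => apply: (@c_scalev _ _ (fun=> a) (fun b => b))
  | |- continuous (fun _ => GRing.scale _ _) => apply: c_scalev
  | |- continuous (fun _ => @GRing.add _ _ _) => first [apply: cD | apply: c_addv]
  | |- continuous (fun _ => @GRing.opp _ _) => first [apply: cN | apply: c_oppv]
  | |- _ => cont1
  end.
Ltac cont ::= repeat (first [cont2 | contH]).

Section Three2.
Variable R : realType.
Local Notation pt := 'rV[R]_3.

Lemma cube_vec3 (a b c : R) : 0 <= a <= 1 -> 0 <= b <= 1 -> 0 <= c <= 1 -> cube (vec3 a b c).
Proof. by move=> ha hb hc; elim/ord3P; rewrite !mxE. Qed.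

Lemma I3_ext (f g : pt -> R) : (forall x, cube x -> f x = g x) -> I3 f = I3 g.
Proof.
move=> fg; rewrite !intT3E; apply: J_ext => a ha; apply: J_ext => b hb.
by apply: J_ext => c hc; apply: fg; exact: cube_vec3.
Qed.

Lemma I3_param (X : topologicalType) (F : X -> pt -> R) :
  continuous (fun p : X * pt => F p.1 p.2) -> continuous (fun x => I3 (F x)).
Proof.
move=> cF; rewrite (funext (fun x => intT3E (F x))).
apply: (@J_param _ X _ _ (fun x a => J 0 1 (fun b => J 0 1 (fun c => F x (vec3 a b c))))) => //.
apply: (@J_param _ (X * R)%type _ _ (fun x b => J 0 1 (fun c => F x.1 (vec3 x.2 b c)))) => //.
apply: (@J_param _ ((X * R) * R)%type _ _ (fun x c => F x.1.1 (vec3 x.1.2 x.2 c))) => //.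
by cont.
Qed.

Lemma c_in1 (f : pt -> R) a b : continuous f -> continuous (fun c : R => f (vec3 a b c)).
Proof. by move=> cf; cont. Qed.

Lemma c_in2 (f : pt -> R) a : continuous f -> continuous (fun b : R => J 0 1 (fun c : R => f (vec3 a b c))).
Proof. by move=> cf; apply: (@J_param _ R 0 1 (fun b c => f (vec3 a b c))) => //; cont. Qed.

Lemma c_in3 (f : pt -> R) : continuous f ->
  continuous (fun a : R => J 0 1 (fun b : R => J 0 1 (fun c : R => f (vec3 a b c)))).
Proof.
move=> cf; apply: (@J_param _ R 0 1 (fun a b => J 0 1 (fun c => f (vec3 a b c)))) => //.
by apply: (@J_param _ (R * R)%type 0 1 (fun x c => f (vec3 x.1 x.2 c))) => //; cont.
Qed.

Lemma I3D (f g : pt -> R) : continuous f -> continuous g ->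
  I3 (fun x => f x + g x) = I3 f + I3 g.
Proof.
move=> cf cg; rewrite !intT3E -JD; [|exact: c_in3|exact: c_in3].
apply: J_ext => a _; rewrite -JD; [|exact: c_in2|exact: c_in2].
by apply: J_ext => b _; rewrite -JD //; exact: c_in1.
Qed.

Lemma I3Z (c : R) (f : pt -> R) : continuous f -> I3 (fun x => c * f x) = c * I3 f.
Proof.
move=> cf; rewrite !intT3E -JZ; last exact: c_in3.
apply: J_ext => a _; rewrite -JZ; last exact: c_in2.
by apply: J_ext => b _; rewrite -JZ //; exact: c_in1.
Qed.

Lemma I3N (f : pt -> R) : continuous f -> I3 (fun x => - f x) = - I3 f.
Proof. by move=> cf; rewrite -mulN1r -I3Z //; apply: I3_ext => x _; rewrite mulN1r. Qed.

Lemma I3B (f g : pt -> R) : continuous f -> continuous g ->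
  I3 (fun x => f x - g x) = I3 f - I3 g.
Proof. by move=> cf cg; rewrite I3D ?I3N //; cont. Qed.

Lemma I3_cst (c : R) : I3 (fun _ => c) = c.
Proof. by rewrite intT3E !J_cst // subr0 !mulr1. Qed.

Lemma I3_sum n (F : 'I_n -> pt -> R) : (forall i, continuous (F i)) ->
  I3 (fun x => \sum_(i < n) F i x) = \sum_(i < n) I3 (F i).
Proof.
elim: n F => [|n IH] F cF.
  by rewrite big_ord0 -[RHS](I3_cst 0); apply: I3_ext => x _; rewrite big_ord0.
rewrite big_ord_recl -IH //; rewrite -I3D //; last by cont.
by apply: I3_ext => x _; rewrite big_ord_recl.
Qed.

Lemma I3_le (f g : pt -> R) : continuous f -> continuous g ->
  (forall x, cube x -> f x <= g x) -> I3 f <= I3 g.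
Proof.
move=> cf cg fg; rewrite !intT3E; apply: J_le; [exact: c_in3|exact: c_in3|move=> a ha].
apply: J_le; [exact: c_in2|exact: c_in2|move=> b hb].
apply: J_le; [exact: c_in1|exact: c_in1|move=> c hc].
by apply: fg; exact: cube_vec3.
Qed.

Lemma I3_ge0 (f : pt -> R) : (forall x, 0 <= f x) -> 0 <= I3 f.
Proof. by move=> f0; rewrite intT3E; do 3! (apply: J_ge0 => ?). Qed.

Lemma I3_abs (f : pt -> R) : continuous f -> `|I3 f| <= I3 (fun x => `|f x|).
Proof.
move=> cf; rewrite ler_norml; apply/andP; split.
  by rewrite lerNl -I3N //; apply: I3_le; [cont|cont|move=> x _; rewrite -normrN ler_norm].
by apply: I3_le; [cont|cont|move=> x _; rewrite ler_norm].
Qed.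

Lemma I3_bound (f : pt -> R) M : continuous f -> (forall x, cube x -> `|f x| <= M) -> `|I3 f| <= M.
Proof.
move=> cf fM; apply: le_trans (I3_abs cf) _; rewrite -[leRHS]I3_cst.
by apply: I3_le => //; cont.
Qed.

Lemma I3_J (a b : R) (F : pt -> R -> R) : a <= b ->
  continuous (fun p : pt * R => F p.1 p.2) ->
  I3 (fun x => J a b (F x)) = J a b (fun s => I3 (fun x => F x s)).
Proof.
move=> ab cF; rewrite [LHS]intT3E.
transitivity (J 0 1 (fun a0 => J a b (fun s => J 0 1 (fun b0 => J 0 1 (fun c => F (vec3 a0 b0 c) s))))).
  apply: J_ext => x _.
  transitivity (J 0 1 (fun b0 => J a b (fun s => J 0 1 (fun c => F (vec3 x b0 c) s)))).
    by apply: J_ext => y _; apply: J_fubini => //; cont.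
  apply: J_fubini => //.
  by apply: (@J_param _ (R * R)%type 0 1 (fun p c => F (vec3 x p.1 c) p.2)) => //; cont.
rewrite (funext (fun s => intT3E (F^~ s))); apply: J_fubini => //.
apply: (@J_param _ (R * R)%type 0 1 (fun p b0 => J 0 1 (fun c => F (vec3 p.1 b0 c) p.2))) => //.
by apply: (@J_param _ ((R * R) * R)%type 0 1 (fun p c => F (vec3 p.1.1 p.2 c) p.1.2)) => //; cont.
Qed.

Lemma I3_fubini (F : pt -> pt -> R) : continuous (fun p : pt * pt => F p.1 p.2) ->
  I3 (fun x => I3 (fun y => F x y)) = I3 (fun y => I3 (fun x => F x y)).
Proof.
move=> cF; rewrite [RHS]intT3E.
transitivity (J 0 1 (fun a => I3 (fun x => J 0 1 (fun b => J 0 1 (fun c => F x (vec3 a b c)))))).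
  rewrite -I3_J //; first by rewrite (funext (fun x => intT3E (F x))).
  apply: (@J_param _ (pt * R)%type 0 1 (fun p b => J 0 1 (fun c => F p.1 (vec3 p.2 b c)))) => //.
  by apply: (@J_param _ ((pt * R) * R)%type 0 1 (fun p c => F p.1.1 (vec3 p.1.2 p.2 c))) => //; cont.
apply: J_ext => a _; rewrite I3_J //.
  by apply: J_ext => b _; rewrite I3_J //; cont.
by apply: (@J_param _ (pt * R)%type 0 1 (fun p c => F p.1 (vec3 a p.2 c))) => //; cont.
Qed.

Lemma vec3S0 a b c : vec3 (a + 1) b c = vec3 a b c + e3 R ord0.
Proof. by apply/rowP; elim/ord3P; rewrite !mxE /= ?addr0. Qed.
Lemma vec3S1 a b c : vec3 a (b + 1) c = vec3 a b c + e3 R (lift ord0 ord0).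
Proof. by apply/rowP; elim/ord3P; rewrite !mxE /= ?addr0. Qed.
Lemma vec3S2 a b c : vec3 a b (c + 1) = vec3 a b c + e3 R ord_max.
Proof. by apply/rowP; elim/ord3P; rewrite !mxE /= ?addr0. Qed.

Lemma I3_shift (f : pt -> R) (h : pt) : continuous f -> periodic3 f ->
  I3 (fun x => f (x + h)) = I3 f.
Proof.
move=> cf pf; pose h0 := h 0 ord0; pose h1 := h 0 (lift ord0 ord0); pose h2 := h 0 ord_max.
have E a b c : vec3 a b c + h = vec3 (a + h0) (b + h1) (c + h2).
  by apply/rowP; elim/ord3P; rewrite !mxE /=.
rewrite !intT3E.
rewrite -[RHS](J_shift h0); last 2 first.
- exact: c_in3.
- move=> a; apply: J_ext => b _; apply: J_ext => c _; by rewrite vec3S0 pf.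
apply: J_ext => a _; rewrite -[RHS](J_shift h1); last 2 first.
- exact: c_in2.
- move=> b; apply: J_ext => c _; by rewrite vec3S1 pf.
apply: J_ext => b _; rewrite -[RHS](J_shift h2); last 2 first.
- exact: c_in1.
- by move=> c; rewrite vec3S2 pf.
by apply: J_ext => c _; rewrite E.
Qed.

Lemma I3_CS (w f g : pt -> R) : continuous w -> continuous f -> continuous g ->
  (forall x, 0 <= w x) ->
  (I3 (fun x => w x * (f x * g x))) ^+ 2 <=
  I3 (fun x => w x * f x ^+ 2) * I3 (fun x => w x * g x ^+ 2).
Proof.
move=> cw cf cg w0.
apply: quad_CS => [||s].
- by apply: I3_ge0 => x; rewrite mulr_ge0 // sqr_ge0.
- by apply: I3_ge0 => x; rewrite mulr_ge0 // sqr_ge0.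
- have : 0 <= I3 (fun x => w x * (f x - s * g x) ^+ 2).
    by apply: I3_ge0 => x; rewrite mulr_ge0 // sqr_ge0.
  have -> : (fun x => w x * (f x - s * g x) ^+ 2) = (fun x => w x * f x ^+ 2 +
      ((- (2 * s)) * (w x * (f x * g x)) + s ^+ 2 * (w x * g x ^+ 2))).
    by apply: funext => x; ring.
  by rewrite I3D ?I3D ?I3Z ?mulNr ?addrA //; cont.
Qed.

(** The difference quotient in [s] is the mean of [dF] over the segment from [s] to [s + h], which
    is jointly continuous in [h] and [y]; [der_slope] then applies to its integral. *)
Lemma I3_der (F dF : R -> pt -> R) :
  (forall s y, der (F^~ y) s (1 : R) (dF s y)) ->
  continuous (fun p : R * pt => F p.1 p.2) -> continuous (fun p : R * pt => dF p.1 p.2) ->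
  forall s : R, der (fun s => I3 (F s)) s (1 : R) (I3 (dF s)).
Proof.
move=> HF cF cdF s.
have -> : I3 (dF s) = I3 (fun y => J 0 1 (fun r => dF (s + r * 0) y)).
  apply: I3_ext => y _; rewrite -[LHS]mulr1 -{1}(subr0 1) -J_cst ?ler01 //.
  by apply: J_ext => r _; rewrite mulr0 addr0.
have cQ : continuous (fun p : R * pt => J 0 1 (fun r => dF (s + r * p.1) p.2)).
  by apply: (@J_param _ (R * pt)%type 0 1 (fun p r => dF (s + r * p.1) p.2)) => //; cont.
apply: (@der_slope _ _ (fun s => I3 (F s)) s 1 (fun h => I3 (fun y => J 0 1 (fun r => dF (s + r * h) y)))).
  move=> h; rewrite -I3Z; last exact: (@c_slice _ _ _ (fun h y => J 0 1 (fun r => dF (s + r * h) y)) h cQ).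
  have cFs s' : continuous (F s') by exact: (@c_slice _ _ _ F s' cF).
  rewrite -I3B //; apply: I3_ext => y _; rewrite [_ *: _]mulr1 (addrC h).
  by apply: (J_slope (f := fun s => dF s y) (F := F^~ y)) => //; cont.
exact: (I3_param cQ).
Qed.

(** Partial derivatives are handled as a relation valid at all points, so that the rules of calculus
    compose without separate derivability conditions. *)
Definition pdv (i : 'I_3) (f df : pt -> R) := forall x, der f x (e3 R i) (df x).

(** Reduces directional derivatives to one real variable, where the chain rule is available. *)
Lemma der_line (f : pt -> R) (x v : pt) (l : R) :
  der (fun s : R => f (s *: v + x)) 0 (1 : R) l <-> der f x v l.
Proof.
have E : (fun h : R => h^-1 *: (((fun s : R => f (s *: v + x)) \o shift (0 : R)) (h *: (1 : R)) - f (0 *: v + x)))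
  = (fun h : R => h^-1 *: ((f \o shift x) (h *: v) - f x)).
  by apply: funext => h /=; rewrite addr0 [h *: 1]mulr1 scale0r add0r.
split => -[d e]; split.
- by move: d; rewrite /derivable E.
- by move: e; rewrite /derive E.
- by rewrite /derivable E.
- by rewrite /derive E.
Qed.

End Three2.

(** * Partial derivatives and integration by parts *)

Section Partial.
Variable R : realType.
Local Notation pt := 'rV[R]_3.
Implicit Types (f g df dg : pt -> R) (i : 'I_3).

Lemma pdv_line i f df (x : pt) (s : R) : pdv i f df ->
  der (fun s : R => f (x + s *: e3 R i)) s (1 : R) (df (x + s *: e3 R i)).
Proof.
move=> H; have [d e] := H (x + s *: e3 R i).
have E : (fun h : R => h^-1 *: (((fun s : R => f (x + s *: e3 R i)) \o shift s) (h *: (1 : R)) - f (x + s *: e3 R i)))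
  = (fun h : R => h^-1 *: ((f \o shift (x + s *: e3 R i)) (h *: e3 R i) - f (x + s *: e3 R i))).
  apply: funext => h /=; congr (_ *: (f _ - _)).
  by rewrite [h *: 1]mulr1 scalerDl addrCA.
by split; [rewrite /derivable E|rewrite /derive E].
Qed.

Lemma pdv_ext i f g df : (forall x, f x = g x) -> pdv i f df -> pdv i g df.
Proof. by move=> fg H; rewrite -(funext fg). Qed.

Lemma pdvD i f g df dg : pdv i f df -> pdv i g dg -> pdv i (fun x => f x + g x) (fun x => df x + dg x).
Proof. by move=> hf hg x; apply: derD. Qed.

Lemma pdvN i f df : pdv i f df -> pdv i (fun x => - f x) (fun x => - df x).
Proof. by move=> hf x; apply: derN. Qed.

Lemma pdvM i f g df dg : pdv i f df -> pdv i g dg ->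
  pdv i (fun x => f x * g x) (fun x => df x * g x + f x * dg x).
Proof. by move=> hf hg x; apply: derM. Qed.

Lemma pdvZ i c f df : pdv i f df -> pdv i (fun x => c * f x) (fun x => c * df x).
Proof. by move=> hf x; apply: derZ. Qed.

Lemma pdv_cst i (c : R) : pdv i (fun _ => c) (fun _ => 0).
Proof. by move=> x; exact: der_cst. Qed.

Lemma pdv_comp i (b db : R -> R) f df : (forall z : R, der b z (1 : R) (db z)) -> pdv i f df ->
  pdv i (fun x => b (f x)) (fun x => db (f x) * df x).
Proof.
move=> hb hf x; apply/der_line.
apply: (@der_comp _ (fun s : R => f (s *: e3 R i + x)) b); first exact/der_line.
by rewrite scale0r add0r; exact: hb.
Qed.

Lemma pdv_val i f df x : pdv i f df -> 'D_(e3 R i) f x = df x.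
Proof. by move=> H; exact: der_val (H x). Qed.

Lemma pdv_incr i f df x (h : R) : pdv i f df -> continuous df ->
  f (x + h *: e3 R i) - f x = J 0 1 (fun s => h * df (x + s *: (h *: e3 R i))).
Proof.
move=> hf cdf.
have := @J_slope R (fun s => df (x + s *: e3 R i)) (fun s => f (x + s *: e3 R i)) 0 h _ (fun s => pdv_line x s hf).
rewrite !add0r scale0r addr0 => -> //; last by cont.
rewrite -JZ; first by apply: J_ext => s _; rewrite add0r scalerA.
by cont.
Qed.

Lemma pdv_I3 i (F dF : pt -> pt -> R) :
  (forall y, pdv i (F^~ y) (dF^~ y)) ->
  continuous (fun p : pt * pt => F p.1 p.2) -> continuous (fun p : pt * pt => dF p.1 p.2) ->
  pdv i (fun x => I3 (F x)) (fun x => I3 (dF x)).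
Proof.
move=> H cF cdF x; apply/der_line.
have := @I3_der R (fun s y => F (s *: e3 R i + x) y) (fun s y => dF (s *: e3 R i + x) y) _ _ _ 0.
rewrite scale0r add0r; apply; last 2 first.
- by cont.
- by cont.
move=> s y; have := pdv_line x s (H y).
rewrite (_ : (fun s : R => F (x + s *: e3 R i) y) = (fun s : R => F (s *: e3 R i + x) y)); last first.
  by apply: funext => r; rewrite addrC.
by rewrite addrC.
Qed.

(** The integral of the translate of [f] by [s] along axis [i] does not depend on [s], and its
    derivative at 0 is [I3 df]. *)
Lemma pdv_I30 i f df : pdv i f df -> continuous f -> continuous df -> periodic3 f -> I3 df = 0.
Proof.
move=> hf cf cdf pf.
have := @I3_der R (fun s y => f (y + s *: e3 R i)) (fun s y => df (y + s *: e3 R i)) _ _ _ 0.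
rewrite scale0r => H; have {H} : der (fun _ : R => I3 f) 0 (1 : R) (I3 df).
  rewrite -(_ : I3 (fun y => df (y + 0)) = I3 df); last by apply: I3_ext => y _; rewrite addr0.
  rewrite -(_ : (fun s : R => I3 (fun y => f (y + s *: e3 R i))) = (fun _ => I3 f)); last first.
    by apply: funext => s; exact: I3_shift.
  by apply: H; [move=> s y; exact: pdv_line|cont|cont].
by move=> H; exact: (der_unique H (der_cst _ _ _)).
Qed.

End Partial.

(** * Periodic functions *)

Section Periodic.
Variable R : realType.
Local Notation pt := 'rV[R]_3.
Implicit Types f g : pt -> R.

Lemma per_shift f h : periodic3 f -> periodic3 (fun x => f (x + h)).
Proof. by move=> pf x i; rewrite addrAC pf. Qed.

Lemma per_int f i (z : int) x : periodic3 f -> f (x + z%:~R *: e3 R i) = f x.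
Proof.
move=> pf; have H n y : f (y + n%:R *: e3 R i) = f y.
  elim: n y => [|n IH] y; first by rewrite scale0r addr0.
  by rewrite -natr1 scalerDl scale1r addrA pf.
case: z => n; first exact: H.
by rewrite NegzE -[LHS](H n.+1) -addrA -scalerDl -[X in _ + X%:R]/(n.+1) mulrNz addNr scale0r addr0.
Qed.

(** Fractional parts of the coordinates. One representative serves all periodic functions, so that
    [f] and its regularisation can be moved to it together. *)
Lemma cube_rep (x : pt) : exists2 y, cube y & forall f, periodic3 f -> f x = f y.
Proof.
exists (\row_i (x 0 i - (Num.floor (x 0 i))%:~R)).
  move=> i; rewrite mxE; have := floor_le (x 0 i); have := floorD1_gt (x 0 i).
  by rewrite intrD; lra.
move=> f pf; pose z i := - Num.floor (x 0 i).
rewrite -(per_int ord0 (z ord0) x pf) -(per_int (lift ord0 ord0) (z (lift ord0 ord0)) _ pf).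
rewrite -(per_int ord_max (z ord_max) _ pf); congr f.
by apply/rowP; elim/ord3P; rewrite !mxE /= ?mulr0 ?addr0 ?mulr1 /z mulrNz.
Qed.

Lemma cube_compact : compact (@cube R).
Proof.
have -> : @cube R = [set v : pt | forall i, (fun _ => `[0, 1]%classic) i (v 0 i)].
  by apply/seteqP; split => x /= H i; have := H i; rewrite /= in_itv.
by apply: (@rV_compact R 3 (fun _ => `[0, 1]%classic)) => i; exact: segment_compact.
Qed.

Lemma cube_bounded f : continuous f -> exists M, forall x, cube x -> `|f x| <= M.
Proof.
move=> cf; have c0 : @cube R !=set0 by exists 0 => i; rewrite mxE lexx ler01.
have [x _ H] := @compact_EVT_max _ R (fun x => `|f x|) (@cube R) c0 cube_compact
  (continuous_subspaceT (c_abs cf)).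
by exists `|f x| => y cy; apply: H; rewrite inE.
Qed.

Lemma per_bounded f : continuous f -> periodic3 f -> exists M, forall x, `|f x| <= M.
Proof.
move=> /cube_bounded[M H] pf; exists M => x.
by have [y cy ->] := cube_rep x; [exact: H|].
Qed.

Lemma sup_ub f : continuous f -> periodic3 f -> forall x, `|f x| <= Lq +oo f.
Proof.
move=> cf pf x; have [y cy ->] := cube_rep x; last by [].
apply: ub_le_sup; last by exists y.
by have [M H] := cube_bounded cf; exists M => _ [z cz <-]; exact: H.
Qed.

Lemma sup_le f M : (forall x, cube x -> `|f x| <= M) -> Lq +oo f <= M.
Proof.
move=> H; apply: ge_sup; last by move=> _ [x cx <-]; exact: H.
by exists `|f 0|; exists 0 => // i; rewrite mxE lexx ler01.
Qed.

End Periodic.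

(** * Convolution with a continuous kernel *)

Section Conv.
Variable R : realType.
Local Notation pt := 'rV[R]_3.
Implicit Types (f g K u : pt -> R).

(** A correlation rather than a convolution; the two agree for the even kernels used here, by [cvE].
    In this form translations and derivatives of [u] pass inside with no condition on [K] beyond
    continuity. *)
Definition cv K u (x : pt) : R := I3 (fun y => K y * u (x + y)).

Definition even3 K := forall y : pt, K (- y) = K y.

Lemma cv_joint (X : topologicalType) K (u : X -> pt -> R) : continuous K ->
  continuous (fun p : X * pt => u p.1 p.2) -> continuous (fun p : X * pt => cv K (u p.1) p.2).
Proof.
move=> cK cu; apply: (@I3_param _ (X * pt)%type (fun p y => K y * u p.1 (p.2 + y))).
by cont.
Qed.

Lemma cv_cont K u : continuous K -> continuous u -> continuous (cv K u).
Proof.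
move=> cK cu; apply: (@I3_param _ pt (fun x y => K y * u (x + y))).
by cont.
Qed.

Lemma cv_per K u : periodic3 u -> periodic3 (cv K u).
Proof. by move=> pu x i; apply: I3_ext => y _; rewrite addrAC pu. Qed.

Lemma perN (f : pt -> R) (h : pt) : periodic3 f -> periodic3 (fun x => f (h - x)).
Proof.
by move=> pf x i; rewrite -(pf (h - (x + e3 R i)) i) opprD !addrA subrK.
Qed.

Lemma perM f g : periodic3 f -> periodic3 g -> periodic3 (fun x => f x * g x).
Proof. by move=> pf pg x i; rewrite pf pg. Qed.

Lemma cvE K u x : continuous K -> periodic3 K -> even3 K -> continuous u -> periodic3 u ->
  cv K u x = I3 (fun y => K (x - y) * u y).
Proof.
move=> cK pK eK cu pu; rewrite -[RHS](I3_shift x); last 2 first.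
- by cont.
- by apply: perM => //; exact: perN.
by apply: I3_ext => y _; rewrite opprD addrCA subrr addr0 eK (addrC y).
Qed.

(** Evenness makes the kernel [K (x - y)] symmetric, so Fubini exchanges the roles of [f] and [g].
    This is what moves a second regularisation from one factor to the other. *)
Lemma cv_adj K f g : continuous K -> periodic3 K -> even3 K ->
  continuous f -> periodic3 f -> continuous g -> periodic3 g ->
  I3 (fun x => cv K f x * g x) = I3 (fun x => f x * cv K g x).
Proof.
move=> cK pK eK cf pf cg pg.
transitivity (I3 (fun x => I3 (fun y => K (x - y) * f y * g x))).
  apply: I3_ext => x _; rewrite cvE // mulrC -I3Z; last by cont.
  by apply: I3_ext => y _; rewrite mulrC.
rewrite I3_fubini; last by cont.
apply: I3_ext => y _; rewrite (cvE y) // -I3Z; last by cont.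
by apply: I3_ext => x _; rewrite -(eK (x - y)) opprB; ring.
Qed.

Lemma cvD K f g x : continuous K -> continuous f -> continuous g ->
  cv K (fun x => f x + g x) x = cv K f x + cv K g x.
Proof.
move=> cK cf cg; rewrite -I3D; [|by cont|by cont].
by apply: I3_ext => y _; rewrite mulrDr.
Qed.

Lemma cvZ K c f x : continuous K -> continuous f ->
  cv K (fun x => c * f x) x = c * cv K f x.
Proof.
move=> cK cf; rewrite -I3Z; last by cont.
by apply: I3_ext => y _; rewrite mulrCA.
Qed.

Lemma cvB K f g x : continuous K -> continuous f -> continuous g ->
  cv K (fun x => f x - g x) x = cv K f x - cv K g x.
Proof.
move=> cK cf cg; rewrite -[X in _ + X]mulN1r -cvZ // -cvD //; last by cont.
by apply: I3_ext => y _; rewrite mulN1r.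
Qed.

Lemma cv_shift K f h x : cv K (fun x => f (x + h)) x = cv K f (x + h).
Proof. by apply: I3_ext => y _; rewrite addrAC. Qed.

Lemma pdv_cv i K u du : continuous K -> continuous u -> continuous du -> pdv i u du ->
  pdv i (cv K u) (cv K du).
Proof.
move=> cK cu cdu H.
apply: (@pdv_I3 _ i (fun x y => K y * u (x + y)) (fun x y => K y * du (x + y))); [|by cont|by cont].
move=> y; apply: pdvZ => x; apply/der_line; have /der_line := H (x + y).
by under eq_fun do rewrite addrA.
Qed.

Lemma pdv_cvK i K dK u : continuous K -> periodic3 K -> even3 K -> continuous dK ->
  continuous u -> periodic3 u -> pdv i K dK ->
  pdv i (cv K u) (fun x => I3 (fun y => dK (x - y) * u y)).
Proof.
move=> cK pK eK cdK cu pu H.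
apply: (@pdv_ext _ i (fun x => I3 (fun y => K (x - y) * u y))); first by move=> x; rewrite cvE.
apply: (@pdv_I3 _ i (fun x y => K (x - y) * u y) (fun x y => dK (x - y) * u y)); [|by cont|by cont].
move=> y x; rewrite -[X in der _ _ _ X]addr0 -(mulr0 (K (x - y))).
apply: derM; last exact: der_cst.
apply/der_line; have /der_line := H (x - y).
by under eq_fun do rewrite addrA.
Qed.

End Conv.

(** * Properties shared by the [L^2] norm and the sup norm *)

Section Norms.
Variable R : realType.
Local Notation pt := 'rV[R]_3.
Implicit Types (f g K u : pt -> R).

(** The interface through which every Littlewood-Paley estimate is proved once for both norms: the
    velocity is measured in sup norm, the transported scalar in [L^2]. [sn_line] is Minkowski's
    inequality along a segment, for Bernstein's inequality and increments; [sn_cv] is Young's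
    inequality; [sn_sup] controls errors of uniform approximation. *)
Record snorm (nrm : (pt -> R) -> R) : Prop := SNorm {
  sn_ge0 : forall f, 0 <= nrm f;
  snD : forall f g, continuous f -> periodic3 f -> continuous g -> periodic3 g ->
    nrm (fun x => f x + g x) <= nrm f + nrm g;
  sn_line : forall (W : R -> R) (h : pt) f, continuous W -> continuous f -> periodic3 f ->
    nrm (fun x => J 0 1 (fun s => W s * f (x + s *: h))) <= J 0 1 (fun s => `|W s|) * nrm f;
  sn_cv : forall K f, continuous K -> continuous f -> periodic3 f ->
    nrm (cv K f) <= I3 (fun y => `|K y|) * nrm f;
  sn_shift : forall (h : pt) f, continuous f -> periodic3 f -> nrm (fun x => f (x + h)) <= nrm f;
  sn_sup : forall f M, continuous f -> (forall x, cube x -> `|f x| <= M) -> nrm f <= M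
}.

Definition n2 f : R := Num.sqrt (I3 (fun x => f x ^+ 2)).

Lemma n2_ge0 f : 0 <= n2 f. Proof. exact: sqrtr_ge0. Qed.

Lemma n2_sqr f : n2 f ^+ 2 = I3 (fun x => f x ^+ 2).
Proof. by rewrite sqr_sqrtr // I3_ge0 // => x; exact: sqr_ge0. Qed.

Lemma n2_CS f g : continuous f -> continuous g -> `|I3 (fun x => f x * g x)| <= n2 f * n2 g.
Proof.
move=> cf cg; rewrite -(@ler_pXn2r _ 2) ?nnegrE ?mulr_ge0 ?n2_ge0 //.
rewrite exprMn !n2_sqr real_normK ?num_real //.
have E (h : pt -> R) : I3 (fun x => 1 * h x) = I3 h by apply: I3_ext => x _; rewrite mul1r.
by have := I3_CS (@c_cst R pt 1) cf cg (fun _ => ler01); rewrite !E.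
Qed.

Lemma le_n2 f (M : R) : 0 <= M -> I3 (fun x => f x ^+ 2) <= M ^+ 2 -> n2 f <= M.
Proof. by move=> M0 H; rewrite -(@ler_pXn2r _ 2) ?nnegrE ?n2_ge0 // n2_sqr. Qed.

Lemma n2_snorm : snorm n2.
Proof.
split.
- exact: n2_ge0.
- move=> f g cf _ cg _; apply: le_n2; first by rewrite addr_ge0 ?n2_ge0.
  rewrite (_ : I3 _ = I3 (fun x => f x ^+ 2) + (2 * I3 (fun x => f x * g x) + I3 (fun x => g x ^+ 2))).
    have -> : (n2 f + n2 g) ^+ 2 = n2 f ^+ 2 + (2 * (n2 f * n2 g) + n2 g ^+ 2) by ring.
    rewrite !n2_sqr lerD2l lerD2r ler_pM2l //.
    by apply: le_trans (ler_norm _) (n2_CS cf cg).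
  rewrite -I3Z; last by cont.
  rewrite -I3D; [|by cont|by cont]; rewrite -I3D; [|by cont|by cont].
  by apply: I3_ext => x _; ring.
- move=> W h f cW cf pf; have J0 : 0 <= J 0 1 (fun s => `|W s|) by apply: J_ge0 => s.
  apply: le_n2; first by rewrite mulr_ge0 ?n2_ge0.
  have c1 : continuous (fun x : pt => J 0 1 (fun s => W s * f (x + s *: h))).
    by apply: (@J_param _ pt 0 1 (fun x s => W s * f (x + s *: h))) => //; cont.
  have c2 : continuous (fun x : pt => J 0 1 (fun s => `|W s| * f (x + s *: h) ^+ 2)).
    by apply: (@J_param _ pt 0 1 (fun x s => `|W s| * f (x + s *: h) ^+ 2)) => //; cont.
  (* Cauchy-Schwarz with weight [|W|] and first factor 1, at each [x]. Exchanging the integrals and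
     translating then leaves the [L^2] norm of [f]. The clause for [cv] repeats this with [|K|]. *)
  apply: (@le_trans _ _ (I3 (fun x => J 0 1 (fun s => `|W s|) * J 0 1 (fun s => `|W s| * f (x + s *: h) ^+ 2)))).
    apply: I3_le; [by cont|by cont|move=> x _].
    have -> : J 0 1 (fun s => `|W s|) = J 0 1 (fun s => `|W s| * 1 ^+ 2).
      by apply: J_ext => s _; rewrite expr1n mulr1.
    apply: (@le_trans _ _ ((J 0 1 (fun s => `|W s| * (1 * `|f (x + s *: h)|))) ^+ 2)).
      rewrite -real_normK ?num_real // ler_pXn2r ?nnegrE //; last first.
        by apply: J_ge0 => s; rewrite mul1r mulr_ge0.
      rewrite ler_norml; apply/andP; split.
        rewrite lerNl -mulN1r -JZ; last by cont.
        apply: J_le; [by cont|by cont|move=> s _]; rewrite mul1r -normrM mulN1r -normrN.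
        exact: ler_norm.
      apply: J_le; [by cont|by cont|move=> s _]; rewrite mul1r -normrM.
      exact: ler_norm.
    have := @J_CS R 0 1 (fun s => `|W s|) (fun _ => 1) (fun s => `|f (x + s *: h)|).
    move=> /(_ _ _ _ _)/le_trans -> //; [by cont|by cont|by cont|].
    rewrite ler_wpM2l //; first by apply: J_ge0 => s; rewrite expr1n mulr1.
    by apply: J_le; [by cont|by cont|move=> s _]; rewrite real_normK ?num_real.
  rewrite I3Z // exprMn expr2 -mulrA ler_wpM2l // I3_J //; last by cont.
  rewrite n2_sqr mulrC -JZ; last by cont.
  apply: J_le; [|by cont|].
    by apply: (@I3_param _ R (fun s x => `|W s| * f (x + s *: h) ^+ 2)); cont.
  move=> s _; rewrite I3Z; last by cont.
  rewrite mulrC ler_wpM2r // (I3_shift (f := fun x => f x ^+ 2)) //; first by cont.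
  by move=> x i; rewrite pf.
- move=> K f cK cf pf; have K0 : 0 <= I3 (fun s => `|K s|) by apply: I3_ge0 => s.
  apply: le_n2; first by rewrite mulr_ge0 ?n2_ge0.
  have c1 := cv_cont cK cf.
  have c2 : continuous (fun x : pt => I3 (fun y => `|K y| * f (x + y) ^+ 2)).
    by apply: (@I3_param _ pt (fun x s => `|K s| * f (x + s) ^+ 2)) => //; cont.
  apply: (@le_trans _ _ (I3 (fun x => I3 (fun s => `|K s|) * I3 (fun s => `|K s| * f (x + s) ^+ 2)))).
    apply: I3_le; [by cont|by cont|move=> x _].
    have -> : I3 (fun s => `|K s|) = I3 (fun s => `|K s| * 1 ^+ 2).
      by apply: I3_ext => s _; rewrite expr1n mulr1.
    apply: (@le_trans _ _ ((I3 (fun s => `|K s| * (1 * `|f (x + s)|))) ^+ 2)).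
      rewrite -real_normK ?num_real // ler_pXn2r ?nnegrE //; last first.
        by apply: I3_ge0 => s; rewrite mul1r mulr_ge0.
      apply: le_trans (I3_abs _) _; first by cont.
      by apply: I3_le; [by cont|by cont|move=> s _]; rewrite mul1r normrM.
    have := @I3_CS R (fun s => `|K s|) (fun _ => 1) (fun s => `|f (x + s)|).
    move=> /(_ _ _ _ _)/le_trans -> //; [by cont|by cont|by cont|].
    rewrite ler_wpM2l //; first by apply: I3_ge0 => s; rewrite expr1n mulr1.
    by apply: I3_le; [by cont|by cont|move=> s _]; rewrite real_normK ?num_real.
  rewrite I3Z // exprMn expr2 -mulrA ler_wpM2l // I3_fubini //; last by cont.
  rewrite n2_sqr mulrC -I3Z; last by cont.
  apply: I3_le; [|by cont|].
    by apply: (@I3_param _ pt (fun s x => `|K s| * f (x + s) ^+ 2)); cont.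
  move=> s _; rewrite I3Z; last by cont.
  rewrite mulrC ler_wpM2r // (I3_shift (f := fun x => f x ^+ 2)) //; first by cont.
  by move=> x i; rewrite pf.
- move=> h f cf pf; rewrite /n2 (I3_shift (f := fun x => f x ^+ 2)) //; first by cont.
  by move=> x i; rewrite pf.
- move=> f M cf H; have M0 : 0 <= M.
    by apply: le_trans (normr_ge0 (f 0)) (H 0 _) => i; rewrite mxE lexx ler01.
  apply: le_n2 => //; rewrite -[leRHS]I3_cst; apply: I3_le; [by cont|by cont|move=> x cx].
  by rewrite -real_normK ?num_real // ler_pXn2r ?nnegrE //; exact: H.
Qed.

Lemma sup_ge0 f : 0 <= Lq +oo f.
Proof.
rewrite /Lq; have [H|H] := pselect (has_sup [set `|f x| | x in @cube R]); last by rewrite sup_out.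
have [_ [y cy _]] := H.1; apply: le_trans (normr_ge0 (f y)) _.
by apply: ub_le_sup; [exact: H.2|exists y].
Qed.

Lemma sup_snorm : snorm (@Lq R +oo%E).
Proof.
split.
- exact: sup_ge0.
- move=> f g cf pf cg pg; apply: sup_le => x _; apply: le_trans (ler_normD _ _) _.
  by apply: lerD; exact: sup_ub.
- move=> W h f cW cf pf; apply: sup_le => x _.
  rewrite mulrC -JZ; last by cont.
  have H s : `|W s * f (x + s *: h)| <= Lq +oo f * `|W s|.
    by rewrite normrM mulrC ler_wpM2r //; exact: sup_ub.
  rewrite ler_norml; apply/andP; split.
    rewrite lerNl -mulN1r -JZ; last by cont.
    apply: J_le; [by cont|by cont|move=> s _]; rewrite mulN1r.
    by apply: le_trans (H s); rewrite -normrN ler_norm.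
  apply: J_le; [by cont|by cont|move=> s _].
  by apply: le_trans (H s); exact: ler_norm.
- move=> K f cK cf pf; apply: sup_le => x _.
  rewrite mulrC -I3Z; last by cont.
  apply: le_trans (I3_abs _) _; first by cont.
  apply: I3_le; [by cont|by cont|move=> s _].
  by rewrite normrM mulrC ler_wpM2r //; exact: sup_ub.
- move=> h f cf pf; apply: sup_le => x _; exact: sup_ub.
- by move=> f M cf H; exact: sup_le.
Qed.

End Norms.

(** * Fejer and Jackson kernels *)

Section CosCont.
Variable R : realType.
Lemma c_cos (X : topologicalType) (f : X -> R) : continuous f -> continuous (fun x => cos (f x)).
Proof. by move=> cf; apply: (c_comp (@continuous_cos R) cf). Qed.
Lemma c_sin (X : topologicalType) (f : X -> R) : continuous f -> continuous (fun x => sin (f x)).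
Proof. by move=> cf; apply: (c_comp (@continuous_sin R) cf). Qed.
End CosCont.

Ltac cont3 := lazymatch goal with
  | |- continuous (fun _ => cos _) => apply: c_cos
  | |- continuous (fun _ => sin _) => apply: c_sin
  | |- _ => cont2
  end.
Ltac cont ::= repeat (first [cont3 | contH]).

Section Fejer.
Variable R : realType.
Implicit Types (s p : R) (N m l : nat).

Lemma der_cos (f : R -> R) (x df : R) : der f x (1 : R) df ->
  der (fun y => cos (f y)) x (1 : R) (- sin (f x) * df).
Proof. by move=> d; apply: (der_comp d); exact: is_derive_cos. Qed.

Lemma der_sin (f : R -> R) (x df : R) : der f x (1 : R) df ->
  der (fun y => sin (f y)) x (1 : R) (cos (f x) * df).
Proof. by move=> d; apply: (der_comp d); exact: is_derive_sin. Qed.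

Lemma cos_periodz p (z : int) : cos (p + 2 * pi * z%:~R) = cos p.
Proof.
have H n (q : R) : cos (q + 2 * pi * n%:R) = cos q.
  rewrite (_ : 2 * pi * n%:R = pi *+ 2 *+ n); first exact: (periodicn (@cosD2pi R)).
  by rewrite -[pi *+ 2]mulr_natl -[RHS]mulr_natr.
case: z => n; first exact: H.
rewrite NegzE -[LHS](H n.+1); congr cos.
by rewrite mulrNz -[n.+1%:~R]/(n.+1%:R); ring.
Qed.

Lemma sin_periodz p (z : int) : sin (p + 2 * pi * z%:~R) = sin p.
Proof. by rewrite -!cosBpihalf addrAC cos_periodz. Qed.

Lemma J01_cst (c : R) : J 0 1 (fun _ => c) = c.
Proof. by rewrite J_cst // subr0 mulr1. Qed.

Lemma J_cos l p : J 0 1 (fun s => cos (2 * pi * l%:R * s + p)) = (l == 0%N)%:R * cos p.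
Proof.
case: l => [|l] /=.
  rewrite mul1r -[RHS]J01_cst.
  by apply: J_ext => s _; rewrite mulr0 mul0r add0r.
rewrite mul0r; set w := 2 * pi * _.
have w0 : w != 0 by rewrite /w !mulf_neq0 // ?pnatr_eq0 // gt_eqF // pi_gt0.
rewrite (@J_prim R 0 1 _ (fun s => w^-1 * sin (w * s + p))) //; last 2 first.
- by cont.
- move=> s; rewrite -[X in der _ _ _ X](_ : w^-1 * (cos (w * s + p) * (w * 1 + 0)) = _); last by field.
  apply: derZ; apply: (@der_sin (fun s => w * s + p)).
  by apply: derD; [apply: derZ; exact: der_id|exact: der_cst].
rewrite mulr1 mulr0 add0r (_ : sin (w + p) = sin p) ?subrr //.
by rewrite addrC -[RHS](sin_periodz p (Posz l.+1)).
Qed.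

(** The Dirichlet kernel in real form. [fej] below sums [N] of them and is left unnormalised, of
    mass [N], so that its Fourier coefficients are natural numbers. *)
Definition dirk (m : nat) s : R := 1 + 2 * \sum_(j < m) cos (2 * pi * (j.+1)%:R * s).
Definition fej (N : nat) s : R := \sum_(m < N) dirk m s.

Lemma c_dirk m : continuous (dirk m).
Proof. by rewrite /dirk; cont. Qed.
Lemma c_fej N : continuous (fej N).
Proof. by rewrite /fej; have := c_dirk => H; cont. Qed.

Lemma dirkS m s : dirk m.+1 s = dirk m s + 2 * cos (2 * pi * m.+1%:R * s).
Proof. by rewrite /dirk big_ord_recr /=; ring. Qed.

Lemma dirkE m s : (1 - cos (2 * pi * s)) * dirk m s =
  cos (2 * pi * m%:R * s) - cos (2 * pi * m.+1%:R * s).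
Proof.
elim: m => [|m IH].
  by rewrite /dirk big_ord0 mulr0 addr0 mulr1 mulr0 mul0r cos0 mulr1.
rewrite dirkS mulrDr IH.
have -> : 2 * pi * m.+2%:R * s = 2 * pi * m.+1%:R * s + 2 * pi * s :> R.
  by rewrite -[m.+2%:R]natr1; ring.
have -> : 2 * pi * m%:R * s = 2 * pi * m.+1%:R * s - 2 * pi * s :> R.
  by rewrite -[m.+1%:R]natr1; ring.
by rewrite cosB cosD; ring.
Qed.

(** The closed form [sin^2 (pi N s) / sin^2 (pi s)] cleared of its denominator: the identities
    [dirkE] telescope. *)
Lemma fejE N s : (1 - cos (2 * pi * s)) * fej N s = 1 - cos (2 * pi * N%:R * s).
Proof.
elim: N => [|N IH]; first by rewrite /fej big_ord0 !mulr0 mul0r cos0 subrr.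
by rewrite /fej big_ord_recr /= mulrDr IH dirkE addrA subrK.
Qed.

Lemma fej_ge0 N s : 0 <= fej N s.
Proof.
(* Away from the integers [fejE] determines the sign. At the remaining points every cosine in the
   sum equals 1. *)
have [c1|c1] := eqVneq (cos (2 * pi * s)) 1; last first.
  have c2 : 0 < 1 - cos (2 * pi * s).
    by rewrite subr_gt0 lt_neqAle c1 cos_le1.
  by rewrite -(pmulr_rge0 _ c2) fejE subr_ge0 cos_le1.
have s1 : sin (2 * pi * s) = 0 by apply: cos1sin0; rewrite c1 normr1.
have H n : cos (2 * pi * n%:R * s) = 1 /\ sin (2 * pi * n%:R * s) = 0.
  elim: n => [|n [IH1 IH2]]; first by rewrite mulr0 mul0r cos0 sin0.
  have -> : 2 * pi * n.+1%:R * s = 2 * pi * n%:R * s + 2 * pi * s :> R.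
    by rewrite -[n.+1%:R]natr1; ring.
  by rewrite cosD sinD IH1 IH2 c1 s1; split; ring.
apply: sumr_ge0 => m _; rewrite /dirk addr_ge0 // mulr_ge0 // sumr_ge0 // => j _.
by rewrite (H j.+1).1.
Qed.

(** The Dirichlet kernel reproduces the frequencies up to [m] and kills the others. The free phase
    [p] covers sines and cosines at once. *)
Lemma J_dirk_cos m l p : J 0 1 (fun s => dirk m s * cos (2 * pi * l%:R * s + p)) =
  (l <= m)%N%:R * cos p.
Proof.
elim: m => [|m IH].
  rewrite leqn0 -J_cos; apply: J_ext => s _.
  by rewrite /dirk big_ord0 mulr0 addr0 mul1r.
(* Product-to-sum formula for the new term. The conditional keeps the difference of frequencies a
   natural number, flipping the phase when the order is reversed. *)
transitivity (J 0 1 (fun s => dirk m s * cos (2 * pi * l%:R * s + p) +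
   (cos (2 * pi * (m.+1 + l)%:R * s + p) +
    cos (2 * pi * (if (l <= m.+1)%N then m.+1 - l else l - m.+1)%N%:R * s +
      if (l <= m.+1)%N then - p else p)))).
  apply: J_ext => s _; rewrite {1}/dirk big_ord_recr /= mulrDr addrA mulrDl -/(dirk m s).
  congr (_ + _).
  have -> : 2 * pi * (m.+1 + l)%:R * s + p = 2 * pi * m.+1%:R * s + (2 * pi * l%:R * s + p).
    by rewrite natrD; ring.
  set A := 2 * pi * m.+1%:R * s; set B := 2 * pi * l%:R * s + p.
  have -> : cos (2 * pi * (if (l <= m.+1)%N then m.+1 - l else l - m.+1)%N%:R * s +
      if (l <= m.+1)%N then - p else p) = cos (A - B).
    rewrite /A /B; case: leqP => lm.
      by congr cos; rewrite natrB //; ring.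
    by rewrite -cosN; congr cos; rewrite natrB 1?ltnW //; ring.
  rewrite cosB (cosD A B); ring.
have cd := c_dirk.
rewrite JD; [|by cont|by cont].
rewrite JD; [|by cont|by cont].
rewrite IH !J_cos addSn mul0r add0r.
have [E|lm] := eqVneq l m.+1.
  by rewrite E leqnn subnn eqxx ltnn mul0r add0r cosN.
case: (leqP l m.+1) => lm'.
  have lm2 : (l < m.+1)%N by rewrite ltn_neqAle lm lm'.
  by rewrite -[(l <= m)%N]ltnS lm2 subn_eq0 leqNgt lm2 /= mul0r addr0.
by rewrite subn_eq0 [(l <= m)%N]leqNgt (ltnW lm') [(l <= m.+1)%N]leqNgt lm' !mul0r addr0.
Qed.

(** Truncated subtraction on [nat] is precisely the triangular Fejer multiplier [max (0, N - l)]. *)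
Lemma J_fej_cos N l p : J 0 1 (fun s => fej N s * cos (2 * pi * l%:R * s + p)) =
  (N - l)%N%:R * cos p.
Proof.
have cd := c_dirk; have cf := c_fej.
elim: N => [|N IH].
  rewrite sub0n mul0r -[RHS](mul0r (1 - 0)) -J_cst //; apply: J_ext => s _.
  by rewrite /fej big_ord0 mul0r.
transitivity (J 0 1 (fun s => fej N s * cos (2 * pi * l%:R * s + p) +
   dirk N s * cos (2 * pi * l%:R * s + p))).
  by apply: J_ext => s _; rewrite /fej big_ord_recr /= mulrDl.
rewrite JD; [|by cont|by cont].
rewrite IH J_dirk_cos -mulrDl -natrD; congr (_%:R * _).
by case: leqP => lN; [rewrite addn1 subSn|rewrite addn0 (eqP (ltnW lN)) (eqP lN)].
Qed.

Lemma J_fej N : J 0 1 (fej N) = N%:R.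
Proof.
have := J_fej_cos N 0 0; rewrite subn0 cos0 mulr1 => <-; apply: J_ext => s _.
by rewrite mulr0 mul0r addr0 cos0 mulr1.
Qed.

(** A Fejer kernel modulated to frequency [N]: the triangles centred at [N] and [-N] combine, with
    opposite signs, into a function linear on [[-N, N]], so the kernel acts as the derivative on
    those frequencies. Its [L^1] norm is at most [4 pi] times the mass [N] of [fej]. *)
Definition dker N s : R := 4 * pi * (fej N s * sin (2 * pi * N%:R * s)).

Lemma c_dker N : continuous (dker N).
Proof. by have := c_fej => cf; rewrite /dker; cont. Qed.

Lemma J_dker N : J 0 1 (fun s => `|dker N s|) <= 4 * pi * N%:R.
Proof.
have cf := c_fej; have cd := c_dker.
rewrite -(J_fej N) -JZ //; apply: J_le; [by cont|by cont|move=> s _].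
rewrite /dker normrM ger0_norm ?mulr_ge0 ?pi_ge0 // ler_wpM2l ?mulr_ge0 ?pi_ge0 //.
rewrite normrM ger0_norm ?fej_ge0 // ler_piMr ?fej_ge0 //.
exact: sin_max.
Qed.

Lemma J_dker_cos N (z : int) p : `|z%:~R : R| <= N%:R ->
  J 0 1 (fun s => dker N s * cos (2 * pi * z%:~R * s + p)) = - (2 * pi * z%:~R * sin p).
Proof.
move=> zN; have cf := c_fej.
have [a Ea] : exists a : nat, a%:R = N%:R + z%:~R :> R.
  exists (absz (Posz N + z)); rewrite -[LHS]/((Posz (absz (Posz N + z)))%:~R) abszE ger0_norm ?intrD //.
  rewrite -(ler0z R) intrD -[N%:Z%:~R]/(N%:R : R); move: zN; rewrite ler_norml; lra.
have [b Eb] : exists b : nat, b%:R = N%:R - z%:~R :> R.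
  exists (absz (Posz N - z)); rewrite -[LHS]/((Posz (absz (Posz N - z)))%:~R) abszE ger0_norm ?intrB //.
  rewrite -(ler0z R) intrB -[N%:Z%:~R]/(N%:R : R); move: zN; rewrite ler_norml; lra.
(* The sine times the cosine splits into frequencies [a = N + z] and [b = N - z], both natural since
   [|z| <= N]; the shift by [pi / 2] writes sines as cosines. *)
transitivity (J 0 1 (fun s => 2 * pi * (fej N s * cos (2 * pi * a%:R * s + (p - pi / 2))) +
   2 * pi * (fej N s * cos (2 * pi * b%:R * s + (- p - pi / 2))))).
  apply: J_ext => s _; rewrite !addrA !cosBpihalf Ea Eb /dker.
  have -> : 2 * pi * (N%:R + z%:~R) * s + p = 2 * pi * N%:R * s + (2 * pi * z%:~R * s + p) by ring.
  have -> : 2 * pi * (N%:R - z%:~R) * s - p = 2 * pi * N%:R * s - (2 * pi * z%:~R * s + p) by ring.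
  by rewrite sinD sinB; ring.
rewrite JD; [|by cont|by cont].
rewrite JZ; last by cont.
rewrite JZ; last by cont.
rewrite !J_fej_cos !cosBpihalf sinN.
(* The two triangular coefficients are the negative and the positive part of [z]; their signed
   combination is linear in [z]. *)
have Ha : (N - a)%N%:R = Num.max 0 (- z%:~R) :> R.
  case: (leqP a N) => aN.
    by rewrite natrB // Ea max_r; [ring|rewrite -(ler_nat R) Ea in aN; lra].
  rewrite (eqP (ltnW aN)) max_l //; rewrite -(ltr_nat R) Ea in aN; lra.
have Hb : (N - b)%N%:R = Num.max 0 (z%:~R) :> R.
  case: (leqP b N) => bN.
    by rewrite natrB // Eb max_r; [ring|rewrite -(ler_nat R) Eb in bN; lra].
  rewrite (eqP (ltnW bN)) max_l //; rewrite -(ltr_nat R) Eb in bN; lra.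
rewrite Ha Hb; set w : R := z%:~R.
case: (leP 0 w) => w0; first by rewrite max_l ?oppr_le0 //; ring.
by rewrite max_r ?oppr_ge0 1?ltW //; ring.
Qed.

Lemma J_fej_dirk N m : (m <= N)%N ->
  J 0 1 (fun s => fej N s * dirk m s) = N%:R + 2 * N%:R * m%:R - m%:R - m%:R ^+ 2.
Proof.
have cd := c_dirk; have cf := c_fej.
elim: m => [|m IH] mN.
  rewrite !mulr0 expr0n /= addr0 !subr0 -[RHS]J_fej; apply: J_ext => s _.
  by rewrite /dirk big_ord0 mulr0 addr0 mulr1.
transitivity (J 0 1 (fun s => fej N s * dirk m s +
   2 * (fej N s * cos (2 * pi * m.+1%:R * s + 0)))).
  by apply: J_ext => s _; rewrite /dirk big_ord_recr /= addr0; ring.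
rewrite JD; [|by cont|by cont].
rewrite JZ; last by cont.
rewrite IH 1?ltnW // J_fej_cos cos0 natrB // -natr1; ring.
Qed.

(** The mass of the squared Fejer kernel grows like [N^3]; it is the normalising constant of
    Jackson's kernel. *)
Lemma J_fej2 N : J 0 1 (fun s => fej N s ^+ 2) = (2 * N%:R ^+ 3 + N%:R) / 3.
Proof.
have cd := c_dirk; have cf := c_fej.
(* Only the second factor is built up by induction, the first staying at [N]; the right side is the
   sum of the values of [J_fej_dirk] below [n]. *)
have H n : (n <= N)%N -> J 0 1 (fun s => fej N s * fej n s) =
  n%:R * N%:R + (2 * N%:R - 1) * (n%:R * (n%:R - 1) / 2) - (n%:R - 1) * n%:R * (2 * n%:R - 1) / 6.
  elim: n => [|n IH] nN.
    transitivity (J 0 1 (fun _ : R => 0 : R)).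
      by apply: J_ext => s _; rewrite /fej [X in _ * X]big_ord0 mulr0.
    by rewrite J_cst //; ring.
  transitivity (J 0 1 (fun s => fej N s * fej n s + fej N s * dirk n s)).
    by apply: J_ext => s _; rewrite {2}/fej big_ord_recr /= mulrDr.
  rewrite JD; [|by cont|by cont].
  by rewrite IH; [|exact: ltnW]; rewrite J_fej_dirk; [|exact: ltnW]; rewrite -natr1; field.
transitivity (J 0 1 (fun s => fej N s * fej N s)); first by apply: J_ext => s _; rewrite expr2.
by rewrite H //; field.
Qed.

Lemma sin2_half s : sin (pi * s) ^+ 2 = (1 - cos (2 * pi * s)) / 2.
Proof.
have -> : 2 * pi * s = (pi * s) *+ 2 by rewrite -mulr_natr; ring.
by rewrite cos_mulr2n sin2cos2 -mulr_natr; field.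
Qed.

(** By [fejE] the factor [sin^2] turns one of the two Fejer kernels into a number at most 1. The
    integral drops from order [N^3] to order [N], which is the second-moment gain of Jackson's
    kernel. *)
Lemma J_fej2_sin2 N : J 0 1 (fun s => fej N s ^+ 2 * sin (pi * s) ^+ 2) <= N%:R.
Proof.
have cf := c_fej; rewrite -(J_fej N); apply: J_le; [by cont|by cont|move=> s _].
have -> : fej N s ^+ 2 * sin (pi * s) ^+ 2 = fej N s * ((1 - cos (2 * pi * s)) * fej N s / 2).
  by rewrite sin2_half; ring.
rewrite fejE ler_piMr ?fej_ge0 //.
have := cos_geN1 (2 * pi * N%:R * s); lra.
Qed.

Lemma fejN N s : fej N (- s) = fej N s.
Proof.
apply: eq_bigr => m _; rewrite /dirk; congr (_ + 2 * _); apply: eq_bigr => j _.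
by rewrite mulrN cosN.
Qed.

Lemma fejS N s : fej N (s + 1) = fej N s.
Proof.
apply: eq_bigr => m _; rewrite /dirk; congr (_ + 2 * _); apply: eq_bigr => j _.
by rewrite mulrDr mulr1 -[j.+1%:R]/((Posz j.+1)%:~R) cos_periodz.
Qed.

(* Jordan's inequality, in the weak form min(s, 1 - s) <= sin (pi s) *)
Lemma sin_ge_dist s : 0 <= s <= 1 / 2 -> s <= sin (pi * s).
Proof.
(* Half-angle: on [[0, pi / 4]] the cosine is at least [c], with [c^2 = 1/2], so [sin (pi s) = 2 sin
   y cos y >= 2 y c^2 = y], and [y >= s] because [pi >= 2]. *)
move=> /andP[s0 s1]; pose y := pi * s / 2; pose c := cos (pi / 4 : R).
have pi2 := @pi_ge2 R; have pi0 := @pi_gt0 R.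
have c2 : c ^+ 2 = 1 / 2.
  have := cos_mulr2n (pi / 4 : R); rewrite -/c (_ : (pi / 4) *+ 2 = pi / 2); last by rewrite -mulr_natr; field.
  by rewrite cos_pihalf -mulr_natr; lra.
have c0 : 0 <= c by apply: cos_ge0_pihalf; lra.
have yE : pi * s = y *+ 2 by rewrite /y -mulr_natr; field.
have y0 : 0 <= y by rewrite /y; nra.
have y1 : y <= pi / 4 by rewrite /y; nra.
have cc (r : R) : 0 <= r -> r <= pi / 4 -> c <= cos r.
  move=> r0; rewrite le_eqVlt => /predU1P[->//|r1]; rewrite ltW //.
  by rewrite ltr_cos // in_itv /=; apply/andP; split; lra.
have siny : y * c <= sin y.
  have := @J_slope R cos sin 0 y (@continuous_cos R) (fun x => is_derive_sin x).
  rewrite add0r sin0 subr0 => ->; rewrite ler_wpM2l // -[leLHS]J01_cst.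
  apply: J_le; [by cont|by apply: c_cos; cont|move=> r /andP[r0 r1]].
  by rewrite add0r; apply: cc; nra.
rewrite yE sin_mulr2n -mulr_natr.
have H1 : s <= y by rewrite /y; nra.
have H2 : y * c * c <= sin y * cos y.
  by apply: ler_pM => //; [exact: mulr_ge0|exact: cc].
have H3 : y * c * c = y / 2 by rewrite -mulrA -expr2 c2; ring.
by rewrite (mulrC (cos y)); lra.
Qed.

End Fejer.

(** * Real trigonometric polynomials *)

Section Trig.
Variable R : realType.
Local Notation pt := 'rV[R]_3.
Implicit Types (f g K u : pt -> R) (k x y : pt) (Q : pt -> Prop).

Definition dot k x : R := \sum_(i < 3) k 0 i * x 0 i.

Lemma dotDl k l x : dot (k + l) x = dot k x + dot l x.
Proof. by rewrite /dot -big_split; apply: eq_bigr => i _; rewrite mxE mulrDl. Qed.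
Lemma dotDr k x y : dot k (x + y) = dot k x + dot k y.
Proof. by rewrite /dot -big_split; apply: eq_bigr => i _; rewrite mxE mulrDr. Qed.
Lemma dotNl k x : dot (- k) x = - dot k x.
Proof. by rewrite /dot -sumrN; apply: eq_bigr => i _; rewrite mxE mulNr. Qed.
Lemma dotNr k x : dot k (- x) = - dot k x.
Proof. by rewrite /dot -sumrN; apply: eq_bigr => i _; rewrite mxE mulrN. Qed.
Lemma dotZr k (c : R) x : dot k (c *: x) = c * dot k x.
Proof. by rewrite /dot mulr_sumr; apply: eq_bigr => i _; rewrite mxE mulrCA. Qed.
Lemma dotZl k (c : R) x : dot (c *: k) x = c * dot k x.
Proof. by rewrite /dot mulr_sumr; apply: eq_bigr => i _; rewrite mxE mulrA. Qed.
Lemma dot_e k i : dot k (e3 R i) = k 0 i.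
Proof.
rewrite /dot (bigD1 i) //= big1 ?addr0; first by rewrite mxE !eqxx mulr1.
by move=> j ji; rewrite mxE (negbTE ji) andbF mulr0.
Qed.
Lemma dot_el i x : dot (e3 R i) x = x 0 i.
Proof. by rewrite -[RHS]dot_e /dot; apply: eq_bigr => j _; rewrite mulrC. Qed.

Lemma c_dot (X : topologicalType) k (f : X -> pt) : continuous f -> continuous (fun z => dot k (f z)).
Proof. by move=> cf; rewrite /dot; cont. Qed.

(** The phase [p] replaces complex exponentials: sines, derivatives and translates of a mode are
    modes of the same frequency. *)
Definition mode k (p : R) x : R := cos (2 * pi * dot k x + p).

Lemma c_mode k p : continuous (mode k p).
Proof.
rewrite /mode; have cd : continuous (fun x => dot k x) by apply: c_dot; cont.
by cont.
Qed.

Lemma mode_line k p x (v : pt) (s : R) :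
  mode k p (x + s *: v) = cos (2 * pi * dot k v * s + (2 * pi * dot k x + p)).
Proof. by rewrite /mode dotDr dotZr; congr cos; ring. Qed.

Lemma pdv_mode i k p : pdv i (mode k p) (fun x => 2 * pi * k 0 i * mode k (p + pi / 2) x).
Proof.
move=> x; apply/der_line.
have -> : (fun s : R => mode k p (s *: e3 R i + x)) = (fun s => cos (2 * pi * k 0 i * s + (2 * pi * dot k x + p))).
  by apply: funext => s; rewrite addrC mode_line dot_e.
rewrite -[X in der _ _ _ X](_ : - sin (2 * pi * k 0 i * 0 + (2 * pi * dot k x + p)) * (2 * pi * k 0 i * 1 + 0) = _).
  apply: (@der_cos _ (fun s => 2 * pi * k 0 i * s + (2 * pi * dot k x + p))).
  by apply: derD; [apply: derZ; exact: der_id|exact: der_cst].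
by rewrite /mode (addrA _ p) cosDpihalf mulr0 add0r; ring.
Qed.

(** The predicate [Q] restricts the frequencies alone; with amplitudes and phases free, the class is
    stable under derivatives and under convolution with arbitrary continuous functions. *)
Inductive TP Q : (pt -> R) -> Prop :=
| TP0 : TP Q (fun _ => 0)
| TPS f (c : R) k p : TP Q f -> Q k -> TP Q (fun x => f x + c * mode k p x).

Lemma TP_ext Q f g : (forall x, f x = g x) -> TP Q f -> TP Q g.
Proof. by move=> fg; rewrite (funext fg). Qed.

Lemma TP_mode Q c k p : Q k -> TP Q (fun x => c * mode k p x).
Proof. by move=> Qk; apply: TP_ext (TPS c p (TP0 Q) Qk) => x; rewrite add0r. Qed.

Lemma TPD Q f g : TP Q f -> TP Q g -> TP Q (fun x => f x + g x).
Proof.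
move=> Hf; elim=> [|h c k p _ IH Qk]; first by apply: TP_ext Hf => x; rewrite addr0.
by apply: TP_ext (TPS c p IH Qk) => x; rewrite addrA.
Qed.

Lemma TPZ Q c f : TP Q f -> TP Q (fun x => c * f x).
Proof.
elim=> [|h d k p _ IH Qk]; first by apply: TP_ext (TP0 Q) => x; rewrite mulr0.
by apply: TP_ext (TPS (c * d) p IH Qk) => x; rewrite mulrDr mulrA.
Qed.

Lemma TP_sum Q n (F : 'I_n -> pt -> R) : (forall i, TP Q (F i)) -> TP Q (fun x => \sum_(i < n) F i x).
Proof.
elim: n F => [|n IH] F HF; first by apply: TP_ext (TP0 Q) => x; rewrite big_ord0.
apply: TP_ext (TPD (HF ord0) (IH (fun i => F (lift ord0 i)) (fun i => HF _))) => x.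
by rewrite big_ord_recl.
Qed.

Lemma TP_sub Q Q' f : (forall k, Q k -> Q' k) -> TP Q f -> TP Q' f.
Proof. by move=> QQ; elim=> [|h c k p _ IH Qk]; [exact: TP0|apply: TPS => //; exact: QQ]. Qed.

Lemma TP_cont Q f : TP Q f -> continuous f.
Proof.
by elim=> [|h c k p _ IH Qk]; [cont|have cm := @c_mode k p; cont].
Qed.

Lemma TP_pdv Q f i : TP Q f -> exists2 df, TP Q df & pdv i f df.
Proof.
elim=> [|h c k p _ [dh Tdh Hdh] Qk]; first by exists (fun _ => 0); [exact: TP0|exact: pdv_cst].
exists (fun x => dh x + c * (2 * pi * k 0 i * mode k (p + pi / 2) x)).
  by apply: TPD => //; apply: TPZ; exact: TP_mode.
by apply: pdvD => //; apply: pdvZ; exact: pdv_mode.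
Qed.

Definition intv k := forall i, k 0 i \is a Num.int.

Lemma mode_per k p : intv k -> periodic3 (mode k p).
Proof.
move=> ik x i; rewrite /mode dotDr dot_e; have /intrP[z ->] := ik i.
by rewrite mulrDr addrAC cos_periodz.
Qed.

Lemma TP_per Q f : (forall k, Q k -> intv k) -> TP Q f -> periodic3 f.
Proof.
move=> QI; elim=> [|h c k p _ IH Qk]; first by [].
by move=> x i; rewrite IH mode_per //; exact: QI.
Qed.

Definition Qc (b : 'I_3 -> R) k := intv k /\ forall i, `|k 0 i| <= b i.

Lemma mode_mul k p l q x : mode k p x * mode l q x =
  1 / 2 * mode (k + l) (p + q) x + 1 / 2 * mode (k - l) (p - q) x.
Proof.
rewrite /mode !dotDl dotNl.
set A := 2 * pi * dot k x + p; set B := 2 * pi * dot l x + q.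
have -> : 2 * pi * (dot k x + dot l x) + (p + q) = A + B by rewrite /A /B; ring.
have -> : 2 * pi * (dot k x - dot l x) + (p - q) = A - B by rewrite /A /B; ring.
by rewrite cosB (cosD A B); field.
Qed.

Lemma TPM b1 b2 f g : TP (Qc b1) f -> TP (Qc b2) g -> TP (Qc (fun i => b1 i + b2 i)) (fun x => f x * g x).
Proof.
move=> Hf Hg; elim: Hf => [|h c k p _ IH [ik bk]].
  by apply: TP_ext (TP0 _) => x; rewrite mul0r.
suff H : TP (Qc (fun i => b1 i + b2 i)) (fun x => mode k p x * g x).
  by apply: TP_ext (TPD IH (TPZ c H)) => x; rewrite mulrDl mulrA.
elim: Hg => [|h' d l q _ IH' [il bl]].
  by apply: TP_ext (TP0 _) => x; rewrite mulr0.
have Q1 : Qc (fun i => b1 i + b2 i) (k + l).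
  by split=> i; rewrite mxE ?rpredD // (le_trans (ler_normD _ _)) // lerD.
have Q2 : Qc (fun i => b1 i + b2 i) (k - l).
  by split=> i; rewrite !mxE ?rpredB // (le_trans (ler_normB _ _)) // lerD.
apply: TP_ext (TPD IH' (TPZ d (TPD (TP_mode (1 / 2) (p + q) Q1) (TP_mode (1 / 2) (p - q) Q2)))) => x.
by rewrite [in RHS]mulrDr [X in _ = _ + X]mulrCA (mode_mul k).
Qed.

Lemma TP_refl b f x : TP (Qc b) f -> TP (Qc b) (fun y => f (x - y)).
Proof.
elim=> [|h c k p _ IH [ik bk]]; first exact: TP0.
have Qk : Qc b (- k) by split=> i; rewrite mxE ?rpredN ?normrN.
apply: TP_ext (TPD IH (TP_mode c (p + 2 * pi * dot k x) Qk)) => y; congr (_ + _ * _).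
by rewrite /mode dotNl dotDr dotNr; congr cos; ring.
Qed.

(** The cosine of a difference separates [x] from [y], so each mode of [K] contributes two modes in
    [x] whose amplitudes are integrals against [u]. *)
Lemma TP_conv Q K u : TP Q K -> continuous u -> TP Q (fun x => I3 (fun y => K (x - y) * u y)).
Proof.
move=> HK cu; elim: HK => [|h c k p Hh IH Qk].
  by apply: TP_ext (TP0 _) => x; rewrite -[LHS]I3_cst; apply: I3_ext => y _; rewrite mul0r.
have ch := TP_cont Hh; have cm q := @c_mode k q.
apply: TP_ext (TPD IH (TPD (TP_mode (c * I3 (fun y => mode k 0 y * u y)) p Qk)
   (TP_mode (c * I3 (fun y => mode k (- (pi / 2)) y * u y)) (p - pi / 2) Qk))) => x.
rewrite [c * _ * _]mulrC [c * I3 (fun y => mode k (- _) y * _) * _]mulrC !mulrA.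
rewrite -I3Z; last by cont.
rewrite -I3Z; last by cont.
rewrite -I3D; [|by cont|by cont]; rewrite -I3D; [|by cont|by cont].
apply: I3_ext => y _; rewrite /mode !dotDr !dotNr.
set A := 2 * pi * dot k x + p; set B := 2 * pi * dot k y.
have -> : 2 * pi * (dot k x - dot k y) + p = A - B by rewrite /A /B; ring.
have -> : 2 * pi * dot k x + (p - pi / 2) = A - pi / 2 by rewrite /A; ring.
by rewrite !cosBpihalf addr0 cosB; ring.
Qed.

(** For [k] nonzero, translation by half a period along a coordinate with [k 0 i != 0] changes the
    sign of the mode but not its integral. *)
Lemma I3_mode k p : intv k -> I3 (mode k p) = (k == 0)%:R * cos p.
Proof.
move=> ik; have [->|k0] := eqVneq k 0.
  rewrite mul1r -[RHS]I3_cst; apply: I3_ext => x _.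
  by rewrite /mode -(scale0r (0 : pt)) dotZl mul0r mulr0 add0r.
rewrite mul0r; have [i ki] : exists i, k 0 i != 0.
  by apply/existsP; apply: contraNT k0 => /existsPn H; apply/eqP/rowP => j; rewrite mxE; have := H j; rewrite negbK => /eqP.
have E := @I3_shift R (mode k p) ((2 * k 0 i)^-1 *: e3 R i) (@c_mode k p) (mode_per p ik).
have E2 : I3 (fun x => mode k p (x + (2 * k 0 i)^-1 *: e3 R i)) = - I3 (mode k p).
  rewrite -I3N; last exact: c_mode.
  apply: I3_ext => x _; rewrite mode_line dot_e /mode.
  have -> : 2 * pi * k 0 i * (2 * k 0 i)^-1 = pi by field.
  by rewrite addrC cosDpi.
by move: E; rewrite E2; lra.
Qed.

(* Bernstein's inequality in integral form, from the Fejer kernel *)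
Lemma TP_bernstein b N i f : TP (Qc b) f -> b i <= N%:R ->
  pdv i f (fun x => J 0 1 (fun s => dker N s * f (x + s *: e3 R i))).
Proof.
move=> Hf bN; elim: Hf => [|h c k p Hh IH [ik bk]].
  move=> x; rewrite (_ : J _ _ _ = 0); first exact: der_cst.
  by rewrite -[RHS]J01_cst; apply: J_ext => s _; rewrite mulr0.
have ch := TP_cont Hh; have cm := @c_mode k p; have cd := @c_dker R N.
move=> x; rewrite (_ : J _ _ _ = J 0 1 (fun s => dker N s * h (x + s *: e3 R i)) +
   c * (2 * pi * k 0 i * mode k (p + pi / 2) x)).
  by apply: derD; [exact: IH|apply: derZ; exact: pdv_mode].
have /intrP[z Ez] := ik i.
have -> : 2 * pi * k 0 i * mode k (p + pi / 2) x = J 0 1 (fun s => dker N s * mode k p (x + s *: e3 R i)).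
  transitivity (J 0 1 (fun s => dker N s * cos (2 * pi * z%:~R * s + (2 * pi * dot k x + p)))).
    rewrite J_dker_cos; last by rewrite -Ez (le_trans (bk i)).
    by rewrite /mode (addrA _ p) cosDpihalf Ez; ring.
  by apply: J_ext => s _; rewrite mode_line dot_e Ez.
rewrite -JZ; last by cont.
rewrite -JD; [|by cont|by cont].
by apply: J_ext => s _; ring.
Qed.

End Trig.

(** * The Jackson kernel and its moments *)

Section Jackson.
Variable R : realType.
Local Notation pt := 'rV[R]_3.
Implicit Types (f g u : pt -> R) (x y : pt) (N : nat).
Local Notation o0 := (ord0 : 'I_3).
Local Notation o1 := (lift ord0 ord0 : 'I_3).
Local Notation o2 := (ord_max : 'I_3).

Definition prod3 (g0 g1 g2 : R -> R) y : R := g0 (y 0 o0) * g1 (y 0 o1) * g2 (y 0 o2).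

Lemma c_prod3 (g0 g1 g2 : R -> R) : continuous g0 -> continuous g1 -> continuous g2 -> continuous (prod3 g0 g1 g2).
Proof. by move=> c0 c1 c2; rewrite /prod3; cont. Qed.

Lemma I3_prod3 (g0 g1 g2 : R -> R) : continuous g0 -> continuous g1 -> continuous g2 ->
  I3 (prod3 g0 g1 g2) = J 0 1 g0 * J 0 1 g1 * J 0 1 g2.
Proof.
move=> c0 c1 c2; rewrite intT3E.
transitivity (J 0 1 (fun a => J 0 1 g1 * J 0 1 g2 * g0 a)); last by rewrite JZ //; ring.
apply: J_ext => a _.
transitivity (J 0 1 (fun b => g0 a * J 0 1 g2 * g1 b)); last by rewrite JZ //; ring.
apply: J_ext => b _.
transitivity (J 0 1 (fun c => g0 a * g1 b * g2 c)); last by rewrite JZ //; ring.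
by apply: J_ext => c _; rewrite /prod3 !mxE.
Qed.

Definition jc N : R := J 0 1 (fun s => fej N s ^+ 2).
(** Jackson's kernel on the circle, the squared Fejer kernel normalised to mass one; [jack] is its
    threefold tensor product. *)
Definition j1 N (s : R) : R := fej N s ^+ 2 / jc N.
Definition jack N : pt -> R := prod3 (j1 N) (j1 N) (j1 N).

Lemma jc_gt0 N : (0 < N)%N -> 0 < jc N.
Proof.
move=> N0; rewrite /jc J_fej2 divr_gt0 // addr_gt0 ?mulr_gt0 ?exprn_gt0 ?ltr0n //.
Qed.

Lemma c_j1 N : continuous (j1 N).
Proof. by have := @c_fej R => cf; rewrite /j1; cont. Qed.

Lemma c_jack N : continuous (jack N).
Proof. by apply: c_prod3; exact: c_j1. Qed.

Lemma j1_ge0 N s : 0 <= j1 N s.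
Proof. by rewrite divr_ge0 ?sqr_ge0 //; apply: J_ge0 => r; exact: sqr_ge0. Qed.

Lemma jack_ge0 N y : 0 <= jack N y.
Proof. exact: (mulr_ge0 (mulr_ge0 (j1_ge0 _ _) (j1_ge0 _ _)) (j1_ge0 _ _)). Qed.

Lemma jack_even N : even3 (jack N).
Proof. by move=> y; rewrite /jack /prod3 !mxE /j1 !fejN. Qed.

Lemma jack_per N : periodic3 (jack N).
Proof.
move=> y; elim/ord3P; rewrite /jack /prod3 !mxE /= ?addr0; congr (_ * _ * _); rewrite /j1 fejS //.
Qed.

Lemma J_j1 N : (0 < N)%N -> J 0 1 (j1 N) = 1.
Proof.
move=> N0; have cf := @c_fej R; have := jc_gt0 N0 => c0.
transitivity (J 0 1 (fun s => (jc N)^-1 * fej N s ^+ 2)); first by apply: J_ext => s _; rewrite mulrC.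
by rewrite JZ ?mulVf ?gt_eqF //; cont.
Qed.

Lemma I3_jack N : (0 < N)%N -> I3 (jack N) = 1.
Proof. by move=> N0; rewrite I3_prod3 ?J_j1 ?mulr1 //; exact: c_j1. Qed.

(** The constant comes from [N / ((2 N^3 + N) / 3) = 3 / (2 N^2 + 1)]. *)
Lemma J_j1_sin2 N : (0 < N)%N -> J 0 1 (fun s => j1 N s * sin (pi * s) ^+ 2) <= 3 / 2 / N%:R ^+ 2.
Proof.
move=> N0; have cf := @c_fej R; have := jc_gt0 N0 => c0.
rewrite (_ : J 0 1 _ = J 0 1 (fun s => (jc N)^-1 * (fej N s ^+ 2 * sin (pi * s) ^+ 2))); last first.
  by apply: J_ext => s _; rewrite /j1; ring.
rewrite JZ; last by cont.
rewrite mulrC ler_pdivrMr //; apply: le_trans (J_fej2_sin2 R N) _.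
have n0 : 0 < N%:R :> R by rewrite ltr0n.
rewrite /jc J_fej2; set n : R := N%:R.
have -> : 3 / 2 / n ^+ 2 * ((2 * n ^+ 3 + n) / 3) = n + 1 / 2 / n by field; rewrite gt_eqF.
by rewrite lerDl !divr_ge0 // ltW.
Qed.

Lemma I3_jack_sin2 N i : (0 < N)%N -> I3 (fun y => jack N y * sin (pi * y 0 i) ^+ 2) <= 3 / 2 / N%:R ^+ 2.
Proof.
move=> N0; have c1 := @c_j1 N.
have cs : continuous (fun s => j1 N s * sin (pi * s) ^+ 2) by cont.
elim/ord3P: i.
- rewrite (_ : I3 _ = I3 (prod3 (fun s => j1 N s * sin (pi * s) ^+ 2) (j1 N) (j1 N))).
    by rewrite I3_prod3 // !J_j1 // !mulr1; exact: J_j1_sin2.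
  by apply: I3_ext => y _; rewrite /jack /prod3; ring.
- rewrite (_ : I3 _ = I3 (prod3 (j1 N) (fun s => j1 N s * sin (pi * s) ^+ 2) (j1 N))).
    by rewrite I3_prod3 // !J_j1 // mulr1 mul1r; exact: J_j1_sin2.
  by apply: I3_ext => y _; rewrite /jack /prod3; ring.
- rewrite (_ : I3 _ = I3 (prod3 (j1 N) (j1 N) (fun s => j1 N s * sin (pi * s) ^+ 2))).
    by rewrite I3_prod3 // !J_j1 // !mul1r; exact: J_j1_sin2.
  by apply: I3_ext => y _; rewrite /jack /prod3; ring.
Qed.

(** [s2] and [dst] are periodic substitutes for [|y|^2] and [|y|], comparable with the distance to
    the integer lattice. The first is suited to moments, the second to increments. *)
Definition s2 y : R := \sum_(i < 3) sin (pi * y 0 i) ^+ 2.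
Definition dst y : R := \sum_(i < 3) `|sin (pi * y 0 i)|.

Lemma c_s2 : continuous s2. Proof. by rewrite /s2; cont. Qed.
Lemma c_dst : continuous dst. Proof. by rewrite /dst; cont. Qed.
Lemma s2_ge0 y : 0 <= s2 y. Proof. by apply: sumr_ge0 => i _; exact: sqr_ge0. Qed.
Lemma dst_ge0 y : 0 <= dst y. Proof. by apply: sumr_ge0. Qed.

Lemma I3_jack_s2 N : (0 < N)%N -> I3 (fun y => jack N y * s2 y) <= 9 / 2 / N%:R ^+ 2.
Proof.
move=> N0; have cj := @c_jack N.
rewrite (_ : I3 _ = \sum_(i < 3) I3 (fun y => jack N y * sin (pi * y 0 i) ^+ 2)).
  apply: (@le_trans _ _ (\sum_(i < 3) (3 / 2 / N%:R ^+ 2))).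
    by apply: ler_sum => i _; exact: I3_jack_sin2.
  by rewrite sumr_const card_ord -mulr_natr le_eqVlt; apply/orP; left; apply/eqP; ring.
rewrite -I3_sum; last by move=> i; cont.
by apply: I3_ext => y _; rewrite /s2 mulr_sumr.
Qed.

Lemma dst_s2 y : dst y ^+ 2 <= 3 * s2 y.
Proof.
rewrite /dst /s2 !sum3.
rewrite -!(real_normK (num_real (sin _))).
set a := `|sin (pi * y 0 o0)|; set b := `|sin (pi * y 0 o1)|; set c := `|sin (pi * y 0 o2)|.
have := sqr_ge0 (a - b); have := sqr_ge0 (a - c); have := sqr_ge0 (b - c); nra.
Qed.

(** Here 29 is [2 + 27]: [(1 + N dst)^2 <= 2 + 6 N^2 s2], and the second moment contributes [6 N^2]
    times [9 / (2 N^2)]. *)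
Lemma I3_jack_w N : (0 < N)%N -> I3 (fun y => jack N y * (1 + N%:R * dst y) ^+ 2) <= 29.
Proof.
move=> N0; have cj := @c_jack N; have cd := c_dst; have cs := c_s2.
have n0 : 0 < N%:R :> R by rewrite ltr0n.
apply: (@le_trans _ _ (I3 (fun y => 2 * jack N y + 6 * N%:R ^+ 2 * (jack N y * s2 y)))).
  apply: I3_le; [by cont|by cont|move=> y _].
  have -> : 2 * jack N y + 6 * N%:R ^+ 2 * (jack N y * s2 y) = jack N y * (2 + 2 * (N%:R ^+ 2 * (3 * s2 y))) by ring.
  rewrite ler_wpM2l ?jack_ge0 //.
  have := ler_wpM2l (sqr_ge0 N%:R) (dst_s2 y); rewrite -exprMn.
  by have := sqr_ge0 (1 - N%:R * dst y); nra.
rewrite I3D; [|by cont|by cont].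
rewrite I3Z // I3Z; last by cont.
rewrite I3_jack //; have := ler_wpM2l (_ : 0 <= 6 * N%:R ^+ 2) (I3_jack_s2 N0).
rewrite mulr_ge0 // => /(_ isT).
have -> : 6 * N%:R ^+ 2 * (9 / 2 / N%:R ^+ 2) = 27 :> R by field; rewrite gt_eqF.
lra.
Qed.

Lemma TP_fej1 N i : TP (Qc (fun j => (j == i)%:R * N%:R)) (fun y => fej N (y 0 i)).
Proof.
have Q0 (l : nat) : (l <= N)%N -> Qc (fun j => (j == i)%:R * N%:R) (l%:R *: e3 R i).
  move=> lN; split=> j; rewrite !mxE eqxx /=; first by rewrite rpredM // ?natr_int.
  case: eqP => _; last by rewrite mulr0 normr0 mul0r.
  by rewrite mulr1 mul1r ger0_norm // ler_nat.
apply: TP_sum => m; apply: TPD.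
  have := TP_mode 1 0 (Q0 0%N (leq0n N)); apply: TP_ext => y.
  by rewrite scale0r /mode -(scale0r (0 : pt)) dotZl mul0r mulr0 addr0 cos0 mulr1.
apply: TPZ; apply: TP_sum => j.
have := TP_mode 1 0 (Q0 j.+1 (leq_trans (ltn_ord j) (ltnW (ltn_ord m)))); apply: TP_ext => y.
by rewrite mul1r /mode dotZl dot_el addr0 mulrA.
Qed.

Lemma TP_jack N : TP (Qc (fun _ => 2 * N%:R)) (jack N).
Proof.
have H i := TPM (TP_fej1 N i) (TP_fej1 N i).
have := TPZ ((jc N)^-1 ^+ 3) (TPM (TPM (H o0) (H o1)) (H o2)).
have E f : TP (Qc (fun _ => 2 * N%:R)) f -> TP (Qc (fun _ => 2 * N%:R)) f by [].
move=> H1; apply: (@TP_ext _ _ _ _ _ (TP_sub _ H1)).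
  by move=> y; rewrite /jack /prod3 /j1; ring.
move=> k [ik bk]; split=> // i; apply: le_trans (bk i) _.
by elim/ord3P: i; rewrite /= ?mul0r ?mul1r ?addr0 ?add0r; lra.
Qed.

(** Uniform continuity in a form that integrates directly against a kernel with small moment of [d].
    Near a zero of [d] the bound [e] suffices; near any other point a large [C] does; compactness
    gives a common [C]. *)
Lemma compact_ctrl (Z : topologicalType) (K : set Z) (g d : Z -> R) (e : R) :
  compact K -> continuous g -> continuous d -> (forall z, 0 <= d z) ->
  (forall z, K z -> d z = 0 -> g z = 0) -> 0 < e ->
  exists2 C, 0 <= C & forall z, K z -> g z <= e + C * d z.
Proof.
move=> cK cg cd d0 dg e0.
have : \forall C \near +oo, K `<=` (fun z => g z <= e + C * d z).
  apply: (proj1 (compact_near_coveringP K) cK R +oo (fun C z => g z <= e + C * d z)) => z Kz.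
  have [dz|dz] := eqVneq (d z) 0.
    have gz := dg z Kz dz.
    have H1 : \forall z' \near z, g z' < e by apply: (cvgr_lt (g z)); [exact: cg|rewrite gz].
    exists ([set z' | g z' < e], [set C : R | 0 <= C]); first by split => //; exact: nbhs_pinfty_ge.
    by move=> [z' C] /= [gz' C0]; rewrite (le_trans (ltW gz')) // lerDl mulr_ge0.
  have dz0 : 0 < d z by rewrite lt_neqAle eq_sym dz d0.
  have H1 : \forall z' \near z, g z' < `|g z| + 1.
    by apply: (cvgr_lt (g z)); [exact: cg|rewrite (le_lt_trans (ler_norm _)) // ltrDl].
  have H2 : \forall z' \near z, d z / 2 < d z'.
    by apply: (cvgr_gt (d z)); [exact: cd|rewrite ltr_pdivrMr // ltr_pMr // ltr1n].
  exists ([set z' | g z' < `|g z| + 1 /\ d z / 2 < d z'], [set C : R | 2 * (`|g z| + 1) / d z <= C]).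
    by split => /=; [exact: filterI|apply: nbhs_pinfty_ge; rewrite num_real].
  move=> [z' C] /= [[gz' dz'] HC]; rewrite (le_trans (ltW gz')) //.
  apply: (@le_trans _ _ (C * d z')); last by rewrite lerDr ltW.
  apply: (@le_trans _ _ (2 * (`|g z| + 1) / d z * (d z / 2))).
    by rewrite le_eqVlt; apply/orP; left; apply/eqP; field.
  by apply: ler_pM => //; rewrite ?divr_ge0 ?mulr_ge0 ?addr_ge0 // ltW.
move=> H; have [C [C0 HC]] : exists C, 0 <= C /\ K `<=` (fun z => g z <= e + C * d z).
  have H0 : \forall C \near +oo, 0 <= C :> R by apply: nbhs_pinfty_ge; rewrite num_real.
  have : \forall C \near (+oo : set_system R), 0 <= C /\ K `<=` (fun z => g z <= e + C * d z).
    exact: filterI.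
  by move=> /filter_ex [C HC]; exists C.
by exists C.
Qed.

(** Inside the unit cube [s2] vanishes only at the corners, which are lattice vectors. *)
Lemma s2_int y : cube y -> s2 y = 0 -> forall f x, periodic3 f -> f (x + y) = f x.
Proof.
move=> cy s0 f x pf.
have H i : exists z : int, y 0 i = z%:~R.
  have : sin (pi * y 0 i) == 0.
    rewrite -sqrf_eq0; move: s0 => /eqP; rewrite psumr_eq0; last by move=> j _; exact: sqr_ge0.
    by move=> /allP/(_ i); rewrite mem_index_enum /= => /(_ isT).
  have /andP[y0 y1] := cy i.
  have [->|yn0] := eqVneq (y 0 i) 0; first by exists 0.
  have [->|yn1] := eqVneq (y 0 i) 1; first by exists 1.
  move=> /eqP E; exfalso; have : 0 < sin (pi * y 0 i); last by rewrite E ltxx.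
  apply: sin_gt0_pi; have p0 := @pi_gt0 R.
  have y0' : 0 < y 0 i by rewrite lt_neqAle eq_sym yn0.
  have y1' : y 0 i < 1 by rewrite lt_neqAle yn1.
  by apply/andP; split; nra.
have [z0 E0] := H o0; have [z1 E1] := H o1; have [z2 E2] := H o2.
have -> : x + y = x + z0%:~R *: e3 R o0 + z1%:~R *: e3 R o1 + z2%:~R *: e3 R o2.
  by apply/rowP; elim/ord3P; rewrite !mxE /= ?mulr0 ?addr0 ?mulr1 ?E0 ?E1 ?E2.
by rewrite !per_int.
Qed.

Lemma cv_unif (T : R) (f : pt -> R -> R) (e : R) :
  continuous (fun p : pt * R => f p.1 p.2) -> (forall s, periodic3 (f^~ s)) -> 0 < e ->
  exists N0, forall N, (N0 <= N)%N -> (0 < N)%N -> forall s x, 0 <= s <= T ->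
    `|cv (jack N) (f^~ s) x - f x s| <= e.
Proof.
move=> cf pf e0; have e2 : 0 < e / 2 by rewrite divr_gt0.
pose g (z : pt * pt * R) := `|f (z.1.1 + z.1.2) z.2 - f z.1.1 z.2|.
pose d (z : pt * pt * R) := s2 z.1.2.
have cs := c_s2.
have cg : continuous g by rewrite /g; cont.
have cd : continuous d by rewrite /d; cont.
have cK : compact ((@cube R `*` @cube R) `*` timeI 0 T).
  by apply: compact_setX; [apply: compact_setX; exact: cube_compact|exact: timeI_compact].
have [//|C C0 HC] := compact_ctrl cK cg cd (fun z => s2_ge0 z.1.2) _ e2.
  move=> [[x y] s] /= [[cx cy] hs]; rewrite /d /g /= => dz.
  by rewrite (s2_int cy dz x (pf s)) subrr normr0.
(* Beyond this threshold the moment term, at most [C] times [9 / (2 N^2)], is below [e / 2]. *)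
have [N0 HN0] : exists N0 : nat, 9 * C / e < N0%:R.
  by exists (Num.truncn (9 * C / e)).+1; exact: truncnS_gt.
exists N0 => N HN N1 s x hs; have [x' cx' Ex] := cube_rep x.
rewrite (Ex _ (pf s)) (Ex _ (cv_per _ (pf s))); move: x' cx' {Ex} => {}x cx.
have cj := @c_jack N.
have cfs : continuous (f^~ s) by move=> z; apply: (@c_comp2 R pt pt R f id (fun _ => s)); cont.
rewrite -[f x s]mul1r -(I3_jack N1) mulrC -I3Z // -I3B; [|by cont|by cont].
apply: le_trans (I3_abs _) _; first by cont.
apply: (@le_trans _ _ (I3 (fun y => e / 2 * jack N y + C * (jack N y * s2 y)))).
  apply: I3_le; [by cont|by cont|move=> y cy].
  have -> : jack N y * f (x + y) s - f x s * jack N y = jack N y * (f (x + y) s - f x s) by ring.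
  rewrite normrM ger0_norm ?jack_ge0 //.
  have -> : e / 2 * jack N y + C * (jack N y * s2 y) = jack N y * (e / 2 + C * s2 y) by ring.
  by rewrite ler_wpM2l ?jack_ge0 //; exact: (HC ((x, y), s)).
rewrite I3D; [|by cont|by cont].
rewrite I3Z // I3Z; last by cont.
rewrite I3_jack // mulr1 [leRHS]splitr lerD2l.
apply: le_trans (ler_wpM2l C0 (I3_jack_s2 N1)) _.
have n1 : 1 <= N%:R :> R by rewrite ler1n.
have n0 : 9 * C / e < N%:R by apply: lt_le_trans HN0 _; rewrite ler_nat.
rewrite ltr_pdivrMr // in n0.
rewrite !mulrA ler_pdivrMr ?exprn_gt0 ?(lt_le_trans ltr01) //.
nra.
Qed.

End Jackson.

(** * Littlewood-Paley blocks *)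

Section LP.
Variable R : realType.
Local Notation pt := 'rV[R]_3.
Variables (chi vphi : pt -> R).
Hypothesis LP : LP_pair chi vphi.
Implicit Types (f g u : pt -> R) (k x y : pt).
Local Notation o0 := (ord0 : 'I_3).
Local Notation o1 := (lift ord0 ord0 : 'I_3).
Local Notation o2 := (ord_max : 'I_3).
Local Notation m := (LPmult chi vphi).
Local Notation blk := (LPblock chi vphi).

Lemma coord_eucl k i : `|k 0 i| <= eucl k.
Proof.
rewrite -sqrtr_sqr ler_sqrt; last by apply: sumr_ge0 => j _; exact: sqr_ge0.
by rewrite (bigD1 i) //= lerDl sumr_ge0 // => j _; exact: sqr_ge0.
Qed.

Lemma euclZ (c : R) k : 0 <= c -> eucl (c *: k) = c * eucl k.
Proof.
move=> c0; rewrite /eucl.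
under eq_bigr do rewrite mxE exprMn.
by rewrite -mulr_sumr sqrtrM ?sqr_ge0 // sqrtr_sqr ger0_norm.
Qed.

Lemma euclN k : eucl (- k) = eucl k.
Proof. by rewrite /eucl; congr Num.sqrt; apply: eq_bigr => i _; rewrite mxE sqrrN. Qed.

Lemma LPmultN n k : m n (- k) = m n k.
Proof.
have [_ [_ [rad _]]] := LP; case: n => [|n] /=; first exact: (rad _ _ (euclN k)).1.
apply: (rad _ _ _).2; rewrite scalerN; exact: euclN.
Qed.

(** Half the side of the summation box in [LPblock]. It exceeds the support radii [4/3] for [n = 0]
    and [(8/3) 2^(n - 1)] for later blocks, and serves as the degree of the block. *)
Definition LPdeg n : nat := (3 * 2 ^ n.+1)%N.

Lemma LPmult_supp n k : m n k != 0 -> eucl k <= (LPdeg n)%:R.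
Proof.
have [_ [_ [_ [_ [chiS [_ [phiS _]]]]]]] := LP; rewrite /LPdeg natrM natrX.
case: n => [|n] /=; first by move=> /chiS; lra.
move=> /phiS /andP[_]; have p2 : 0 < 2 ^+ n :> R by rewrite exprn_gt0.
have c0 : 0 <= 2 ^- n :> R by rewrite invr_ge0 ltW.
by rewrite (euclZ _ c0) ler_pdivrMl // !exprS; lra.
Qed.

Definition kk n (a b c : nat) : pt :=
  vec3 (a%:R - (LPdeg n)%:R) (b%:R - (LPdeg n)%:R) (c%:R - (LPdeg n)%:R).

Lemma kk_Qc n (a b c : 'I_(2 * LPdeg n).+1) : Qc (fun _ => (LPdeg n)%:R) (kk n a b c).
Proof.
have H (a' : 'I_(2 * LPdeg n).+1) : `|a'%:R - (LPdeg n)%:R| <= (LPdeg n)%:R :> R.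
  have : (a'%:R <= (2 * LPdeg n)%:R :> R) by rewrite ler_nat -ltnS ltn_ord.
  by rewrite natrM ler_norml; have := ler0n R a'; lra.
by split; elim/ord3P; rewrite !mxE //= rpredB ?natr_int.
Qed.

Lemma LPblockE n u x : blk n u x =
  \sum_(a < (2 * LPdeg n).+1) \sum_(b < (2 * LPdeg n).+1) \sum_(c < (2 * LPdeg n).+1)
   m n (kk n a b c) * I3 (fun y => mode (kk n a b c) 0 (x - y) * u y).
Proof.
rewrite /LPblock; apply: eq_bigr => a _; apply: eq_bigr => b _; apply: eq_bigr => c _.
rewrite -I3E; congr (_ * _); apply: I3_ext => y _; rewrite mulrC /mode addr0; congr (cos (_ * _) * _).
by apply: eq_bigr => i _; rewrite !mxE.
Qed.

Lemma c_modeR k x u : continuous u -> continuous (fun y => mode k 0 (x - y) * u y).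
Proof. by move=> cu; have cm := @c_mode R k 0; cont. Qed.

Lemma LPblock_TP n u : continuous u -> TP (Qc (fun _ => (LPdeg n)%:R)) (blk n u).
Proof.
move=> cu; rewrite (funext (LPblockE n u)).
apply: TP_sum => a; apply: TP_sum => b; apply: TP_sum => c; apply: TPZ.
apply: TP_conv => //; have := TP_mode 1 0 (kk_Qc a b c).
by apply: TP_ext => x; rewrite mul1r.
Qed.

Lemma LPblockD n f g x : continuous f -> continuous g ->
  blk n (fun y => f y + g y) x = blk n f x + blk n g x.
Proof.
move=> cf cg; rewrite !LPblockE -big_split; apply: eq_bigr => a _.
rewrite -big_split; apply: eq_bigr => b _; rewrite -big_split; apply: eq_bigr => c _.
rewrite /= -mulrDr -I3D; [|exact: c_modeR|exact: c_modeR].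
by congr (_ * _); apply: I3_ext => y _; rewrite mulrDr.
Qed.

Lemma LPblockZ n c f x : continuous f -> blk n (fun y => c * f y) x = c * blk n f x.
Proof.
move=> cf; rewrite !LPblockE mulr_sumr; apply: eq_bigr => a _.
rewrite mulr_sumr; apply: eq_bigr => b _; rewrite mulr_sumr; apply: eq_bigr => d _.
rewrite /= [RHS]mulrCA; congr (_ * _); rewrite -I3Z; last exact: c_modeR.
by apply: I3_ext => y _; rewrite mulrCA.
Qed.

Definition fmode u k x := I3 (fun y => mode k 0 (x - y) * u y).

Lemma c_fmode u k : continuous u -> continuous (fmode u k).
Proof.
move=> cu; have cm := @c_mode R k 0.
by apply: (@I3_param R pt (fun z y => mode k 0 (z - y) * u y)); cont.
Qed.

(** Both operators commute with translations: after Fubini, a shift of the integration variable by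
    [z] moves the convolution across the Fourier multiplier. *)
Lemma LPblock_cv n K u x : continuous K -> continuous u -> periodic3 u ->
  blk n (cv K u) x = cv K (blk n u) x.
Proof.
move=> cK cu pu; have cI k := @c_fmode u k cu.
have E : cv K (blk n u) x = 
  \sum_(a < (2 * LPdeg n).+1) \sum_(b < (2 * LPdeg n).+1) \sum_(c < (2 * LPdeg n).+1)
   m n (kk n a b c) * I3 (fun z => K z * fmode u (kk n a b c) (x + z)).
  transitivity (I3 (fun z => \sum_(a < (2 * LPdeg n).+1) \sum_(b < (2 * LPdeg n).+1) \sum_(c < (2 * LPdeg n).+1)
   (m n (kk n a b c) * (K z * fmode u (kk n a b c) (x + z))))).
    apply: I3_ext => z _; rewrite LPblockE mulr_sumr; apply: eq_bigr => a _.
    by rewrite mulr_sumr; apply: eq_bigr => b _; rewrite mulr_sumr; apply: eq_bigr => c _; rewrite mulrCA.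
  rewrite I3_sum; last by move=> a; cont.
  apply: eq_bigr => a _; rewrite I3_sum; last by move=> b; cont.
  apply: eq_bigr => b _; rewrite I3_sum; last by move=> c; cont.
  by apply: eq_bigr => c _; rewrite I3Z //; cont.
rewrite E LPblockE; apply: eq_bigr => a _; apply: eq_bigr => b _; apply: eq_bigr => c _.
congr (_ * _); have [ik _] := kk_Qc a b c; move: (kk n a b c) ik => k ik; have cm := @c_mode R k 0.
transitivity (I3 (fun y => I3 (fun z => mode k 0 (x - y) * (K z * u (y + z))))).
  by apply: I3_ext => y _; rewrite -I3Z //; cont.
rewrite I3_fubini; last by cont.
apply: I3_ext => z _; rewrite -I3Z; last by cont.
rewrite -(@I3_shift R (fun y => K z * (mode k 0 (x + z - y) * u y)) z); last 2 first.
- by cont.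
- move=> y i; congr (_ * _); rewrite pu; congr (_ * _).
  exact: (perN (x + z) (mode_per 0 ik)).
by apply: I3_ext => y _; rewrite opprD addrACA subrr addr0 mulrCA.
Qed.

Lemma sum_ind N (l : R) : l \is a Num.int -> `|l| <= N%:R ->
  \sum_(a < (2 * N).+1) (a%:R - N%:R == l)%:R = 1 :> R.
Proof.
move=> /intrP[z ->] zN.
have [a0 Ea] : exists a : nat, a%:R = N%:R + z%:~R :> R.
  exists (absz (Posz N + z)); rewrite -[LHS]/((Posz (absz (Posz N + z)))%:~R) abszE ger0_norm ?intrD //.
  rewrite -(ler0z R) intrD -[N%:Z%:~R]/(N%:R : R); move: zN; rewrite ler_norml; lra.
have a1 : (a0 < (2 * N).+1)%N.
  by rewrite ltnS -(ler_nat R) Ea natrM; move: zN; rewrite ler_norml; lra.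
rewrite (bigD1 (Ordinal a1)) //= big1 ?addr0.
  by rewrite Ea addrAC subrr add0r eqxx.
move=> a ha; case: eqP => // E; exfalso; move/eqP: ha; apply; apply: val_inj => /=.
apply/eqP; rewrite -(eqr_nat R) Ea -E; apply/eqP; ring.
Qed.

(** If the multiplier vanishes at [l] both sides are zero; otherwise [l] lies in the box and is hit
    by exactly one triple of indices. *)
Lemma box_sum n (l : pt) : intv l ->
  \sum_(a < (2 * LPdeg n).+1) \sum_(b < (2 * LPdeg n).+1) \sum_(c < (2 * LPdeg n).+1)
    m n (kk n a b c) * (kk n a b c == l)%:R = m n l.
Proof.
move=> il.
have E a b c : (kk n a b c == l)%:R = (a%:R - (LPdeg n)%:R == l 0 o0)%:R *
   ((b%:R - (LPdeg n)%:R == l 0 o1)%:R * (c%:R - (LPdeg n)%:R == l 0 o2)%:R) :> R.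
  rewrite -!natrM !mulnb; congr (nat_of_bool _)%:R; apply/idP/idP.
    by move=> /eqP <-; rewrite !mxE /= !eqxx.
  by move=> /andP[/eqP e0 /andP[/eqP e1 /eqP e2]]; apply/eqP; rewrite (vec3E l) -e0 -e1 -e2.
transitivity (m n l * \sum_(a < (2 * LPdeg n).+1) \sum_(b < (2 * LPdeg n).+1) \sum_(c < (2 * LPdeg n).+1)
    (kk n a b c == l)%:R).
  rewrite mulr_sumr; apply: eq_bigr => a _; rewrite mulr_sumr; apply: eq_bigr => b _.
  by rewrite mulr_sumr; apply: eq_bigr => c _; case: eqP => [->//|_]; rewrite !mulr0.
have [->|/LPmult_supp lS] := eqVneq (m n l) 0; first by rewrite mul0r.
have lb i : `|l 0 i| <= (LPdeg n)%:R by exact: le_trans (coord_eucl l i) lS.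
rewrite -[RHS]mulr1; congr (_ * _).
transitivity ((\sum_(a < (2 * LPdeg n).+1) (a%:R - (LPdeg n)%:R == l 0 o0)%:R) *
  ((\sum_(a < (2 * LPdeg n).+1) (a%:R - (LPdeg n)%:R == l 0 o1)%:R) *
   (\sum_(a < (2 * LPdeg n).+1) (a%:R - (LPdeg n)%:R == l 0 o2)%:R)) : R).
  rewrite mulr_suml; apply: eq_bigr => a _; rewrite mulr_suml mulr_sumr; apply: eq_bigr => b _.
  by rewrite mulr_sumr mulr_sumr; apply: eq_bigr => c _; exact: E.
by rewrite !sum_ind // !mulr1.
Qed.

(** In real form a mode of frequency [k] interacts with both [k] and [- k], each with weight one
    half; evenness of the multiplier recombines them, also when [k = 0]. *)
Lemma LPblock_mode n k p x : intv k -> blk n (mode k p) x = m n k * mode k p x.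
Proof.
move=> ik; have ink : intv (- k) by move=> i; rewrite mxE rpredN.
rewrite LPblockE.
have E l : intv l -> I3 (fun y => mode l 0 (x - y) * mode k p y) =
   1 / 2 * mode k p x * ((l == k)%:R + (l == - k)%:R).
  move=> il.
  have H y : mode l 0 (x - y) * mode k p y =
    1 / 2 * mode (k - l) (2 * pi * dot l x + p) y + 1 / 2 * mode (- l - k) (2 * pi * dot l x - p) y.
    rewrite [k - l]addrC -mode_mul; congr (_ * _).
    by rewrite /mode dotDr dotNr dotNl; congr cos; ring.
  have i1 : intv (k - l) by move=> i; rewrite !mxE rpredB.
  have i2 : intv (- l - k) by move=> i; rewrite !mxE rpredB ?rpredN.
  have cm k' p' := @c_mode R k' p'.
  transitivity (I3 (fun y => 1 / 2 * mode (k - l) (2 * pi * dot l x + p) y + 1 / 2 * mode (- l - k) (2 * pi * dot l x - p) y)).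
    by apply: I3_ext => y _; exact: H.
  rewrite I3D; [|by cont|by cont].
  rewrite !I3Z // !I3_mode // subr_eq0 (eq_sym k) -opprD oppr_eq0 addr_eq0.
  have -> : 1 / 2 * mode k p x * ((l == k)%:R + (l == - k)%:R) =
    1 / 2 * ((l == k)%:R * mode k p x) + 1 / 2 * ((l == - k)%:R * mode k p x) by ring.
  congr (_ * _ + _ * _).
    by case: eqP => [->|_]; rewrite ?mul0r.
  case: eqP => [->|_]; rewrite ?mul0r //; congr (_ * _).
  by rewrite /mode dotNl -cosN; congr cos; ring.
transitivity (\sum_(a < (2 * LPdeg n).+1) \sum_(b < (2 * LPdeg n).+1) \sum_(c < (2 * LPdeg n).+1)
   (1 / 2 * mode k p x * (m n (kk n a b c) * (kk n a b c == k)%:R) +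
    1 / 2 * mode k p x * (m n (kk n a b c) * (kk n a b c == - k)%:R))).
  apply: eq_bigr => a _; apply: eq_bigr => b _; apply: eq_bigr => c _.
  by rewrite E; [ring|have [] := kk_Qc a b c].
transitivity (1 / 2 * mode k p x * m n k + 1 / 2 * mode k p x * m n (- k)); last first.
  by rewrite LPmultN; field.
rewrite -(box_sum n ik) -(box_sum n ink) !mulr_sumr -big_split; apply: eq_bigr => a _.
rewrite !mulr_sumr -big_split; apply: eq_bigr => b _.
by rewrite !mulr_sumr -big_split.
Qed.

Lemma LP_one k : exists N0, forall N, (N0 <= N)%N -> \sum_(n < N) m n k = 1.
Proof.
have [_ [_ [_ [_ [_ [_ [phiS lim]]]]]]] := LP.
pose S N := chi k + \sum_(j < N) vphi (2 ^- j *: k).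
(* For [j >= j0] one has [2 |k| < j0 <= 2^j], so [2^-j k] lies in the inner ball where [vphi]
   vanishes; the series is a finite sum and attains its limit. *)
pose j0 := (Num.truncn (2 * eucl k)).+1.
have v0 j : (j0 <= j)%N -> vphi (2 ^- j *: k) = 0.
  move=> jj; apply/eqP; apply: contraTT isT => /phiS /andP[+ _].
  have p2 : 0 < 2 ^+ j :> R by rewrite exprn_gt0.
  have c0 : 0 <= 2 ^- j :> R by rewrite invr_ge0 ltW.
  rewrite (euclZ _ c0) ler_pdivlMl // => H.
  have H1 : 2 * eucl k < j0%:R by exact: truncnS_gt.
  have H2 : j0%:R <= 2 ^+ j :> R.
    by rewrite -natrX ler_nat (leq_trans jj) // ltnW // ltn_expl.
  lra.
have SE N : (j0 <= N)%N -> S N = S j0.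
  move=> jN; rewrite -(subnKC jN) /S; elim: (N - j0)%N => [|d IH]; first by rewrite addn0.
  by rewrite addnS big_ord_recr /= addrA IH v0 ?addr0 // leq_addr.
have S1 : S j0 = 1.
  apply: (@cvg_unique _ (@norm_hausdorff R R) (S @ \oo)); last exact: lim.
  apply: cvg_near_cst; exists j0 => // N /= jN; exact: SE.
(* The index moves by one because block 0 carries [chi]. *)
exists j0.+1 => -[//|N] jN; by rewrite big_ord_recl /= -[RHS]S1 -(SE N).
Qed.

Lemma LP_sum Q f : (forall k, Q k -> intv k) -> TP Q f ->
  exists N0, forall N, (N0 <= N)%N -> forall x, \sum_(n < N) blk n f x = f x.
Proof.
move=> QI; elim=> [|h c k p Hh [N1 IH] Qk].
  exists 0%N => N _ x; rewrite big1 // => n _.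
  have := @LPblockZ n 0 (fun _ => 0) x (@c_cst R pt 0); rewrite mul0r.
  by rewrite mul0r.
have [N2 H2] := LP_one k; exists (maxn N1 N2) => N; rewrite geq_max => /andP[HN1 HN2] x.
have ch := TP_cont Hh; have cm := @c_mode R k p.
transitivity (\sum_(n < N) (blk n h x + c * mode k p x * m n k)).
  apply: eq_bigr => n _; rewrite LPblockD //; last by cont.
  by rewrite LPblockZ // LPblock_mode; [ring|exact: QI].
by rewrite big_split /= IH // -mulr_sumr H2 // mulr1.
Qed.

(** The regularised function is a trigonometric polynomial, so its Littlewood-Paley series is a
    finite sum, and the blocks commute with the regularisation. *)
Lemma cv_LP N u : (0 < N)%N -> continuous u -> periodic3 u -> exists N0, forall N', (N0 <= N')%N ->
  forall x, cv (jack N) u x = \sum_(n < N') cv (jack N) (blk n u) x.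
Proof.
move=> N0 cu pu; have cj := @c_jack R N.
have [N1 H1] : exists N0, forall N', (N0 <= N')%N -> forall x, \sum_(n < N') blk n (cv (jack N) u) x = cv (jack N) u x.
  apply: (@LP_sum (Qc (fun _ => 2 * N%:R))); first by move=> k [].
  apply: TP_ext (TP_conv (TP_jack R N) cu) => x; rewrite cvE //.
  - exact: jack_per.
  - exact: jack_even.
exists N1 => N' HN x; rewrite -(H1 N' HN); apply: eq_bigr => n _; exact: LPblock_cv.
Qed.

End LP.

(** * Dyadic weights of exponent one third *)

Section Weights.
Variable R : realType.

(** [rho = 2^(1/3)] and [rr] is its inverse. Since index [n] stands for frequency [2^(n - 1)], the
    inverse weight is [rho * rr ^+ n], whence the factor [rho] in later constants. *)
Definition rho : R := 2 `^ (1 / 3).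
Definition rr : R := rho^-1.

Lemma rho_gt0 : 0 < rho. Proof. by rewrite powR_gt0. Qed.
Lemma rr_gt0 : 0 < rr. Proof. by rewrite invr_gt0 rho_gt0. Qed.
Lemma rho3 : rho ^+ 3 = 2.
Proof. by rewrite -powR_mulrn ?powR_ge0 // -powRrM (_ : 1 / 3 * 3 = 1) ?powRr1 //; field. Qed.
Lemma rho_gt1 : 1 < rho.
Proof.
rewrite ltNge; apply/negP => r1; have r0 := rho_gt0.
have := rho3; have : rho ^+ 3 <= 1 by rewrite exprn_ile1 // ltW.
lra.
Qed.
Lemma rr_lt1 : rr < 1. Proof. by rewrite invf_lt1 ?rho_gt0 ?rho_gt1. Qed.
Lemma rhorr : rho * rr = 1. Proof. by rewrite mulfV // gt_eqF // rho_gt0. Qed.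

Lemma wgtE n : (@wgt R n)^-1 = rho * rr ^+ n.
Proof.
have H k : (@wgt R k.+1)^-1 = rr * (@wgt R k)^-1.
  rewrite -invfM /wgt -powRD; last by apply/implyP.
  by congr (_ `^ _)^-1; rewrite -natr1; field.
elim: n => [|n IH]; last by rewrite H IH exprS mulrCA.
by rewrite expr0 mulr1 /wgt sub0r -powRN; congr (_ `^ _); field.
Qed.

Lemma wgt_gt0 n : 0 < @wgt R n. Proof. by rewrite powR_gt0. Qed.

(** The distance [|n - J|]: one of the two truncated differences is always zero. *)
Definition ee (n J : nat) : nat := ((n - J) + (J - n))%N.
(** A bound for the geometric series in [|n - J|]; the 2 counts the two sides of [J]. *)
Definition geoC : R := 2 / (1 - rr).

Lemma geoC_gt0 : 0 < geoC.
Proof. by rewrite divr_gt0 // subr_gt0 rr_lt1. Qed.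

Lemma geo1 n : \sum_(k < n) rr ^+ k <= 1 / (1 - rr).
Proof.
have h : 0 < 1 - rr by rewrite subr_gt0 rr_lt1.
by rewrite ler_pdivlMr // mulrC -opprB mulNr -subrX1 opprB gerBl exprn_ge0 // ltW // rr_gt0.
Qed.

Lemma geo_sum N J : \sum_(n < N) rr ^+ (ee n J) <= geoC.
Proof.
have r0 := rr_gt0; have r1 := rr_lt1.
have H1 M : (M <= J)%N -> \sum_(n < M) rr ^+ (ee n J) <= 1 / (1 - rr).
  move=> MJ; apply: (@le_trans _ _ (\sum_(n < M) rr ^+ (M - n.+1))).
    apply: ler_sum => n _; apply: ler_wiXn2l; [exact: ltW|exact: ltW|].
    rewrite /ee (eqP (ltnW (leq_trans (ltn_ord n) MJ))) add0n.
    by apply: leq_trans (leq_sub2l _ (leqnSn n)) _; exact: leq_sub2r.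
  by rewrite -(big_mkord xpredT (fun n => rr ^+ (M - n.+1))) big_nat_rev /= big_mkord;
     under eq_bigr => n _ do rewrite add0n subnSK // subKn ?(ltnW (ltn_ord n)) //; exact: geo1.
case: (leqP N J) => NJ.
  apply: le_trans (H1 N NJ) _; rewrite /geoC ler_pdivrMr ?subr_gt0 // -mulrA mulVf ?mulr1 ?ler1n //.
  by rewrite gt_eqF // subr_gt0.
rewrite -(subnKC (ltnW NJ)) big_split_ord /=.
have -> : geoC = 1 / (1 - rr) + 1 / (1 - rr) by rewrite /geoC -mulrDl.
apply: lerD; first exact: H1.
apply: le_trans (geo1 (N - J)); apply: ler_sum => n _.
by rewrite /ee addKn (eqP (leq_addr n J)) addn0.
Qed.

(** Since [2 rr = rho^2], passing from [n] up to [J] gains [rho^(2 (J - n))], of which only one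
    factor [rho^(J - n)] is kept. *)
Lemma low_le (J n : nat) : (n <= J)%N -> 2 ^+ n * rr ^+ n <= 2 ^+ J * rr ^+ J * rr ^+ (ee n J).
Proof.
move=> nJ; rewrite /ee (eqP nJ) add0n; move: (J - n)%N (subnKC nJ) => d <-.
have r0 := rr_gt0; have h1 := rhorr; have h3 := rho3.
have -> : 2 ^+ (n + d) * rr ^+ (n + d) * rr ^+ d = 2 ^+ n * rr ^+ n * (2 * (rr * rr)) ^+ d.
  by rewrite !exprD !exprMn; ring.
have -> : 2 * (rr * rr) = rho.
  rewrite -h3 (_ : _ * (rr * rr) = rho * (rho * rr) * (rho * rr)); last by ring.
  by rewrite h1 !mulr1.
rewrite ler_peMr ?exprn_ege1 ?(ltW rho_gt1) // mulr_ge0 ?exprn_ge0 //; exact: ltW.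
Qed.

Lemma high_le (J n : nat) : (J <= n)%N -> 2 ^+ J * rr ^+ n <= 2 ^+ J * rr ^+ J * rr ^+ (ee n J).
Proof. by move=> nJ; rewrite /ee (eqP nJ) addn0 -mulrA -exprD subnKC. Qed.

End Weights.

(** * Increments and gradients from Besov bounds *)

Section Estimates.
Variable R : realType.
Local Notation pt := 'rV[R]_3.
Variables (chi vphi : pt -> R).
Hypothesis LP : LP_pair chi vphi.
Variable nrm : (pt -> R) -> R.
Hypothesis Hn : snorm nrm.
Implicit Types (f g u : pt -> R) (k x y : pt).
Local Notation o0 := (ord0 : 'I_3).
Local Notation o1 := (lift ord0 ord0 : 'I_3).
Local Notation o2 := (ord_max : 'I_3).
Local Notation blk := (LPblock chi vphi).

Lemma c_delta f y : continuous f -> continuous (fun x => f (x + y) - f x).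
Proof. by move=> cf; cont. Qed.

Lemma cv_delta K f y x : continuous K -> continuous f ->
  cv K (fun x => f (x + y) - f x) x = cv K f (x + y) - cv K f x.
Proof. by move=> cK cf; rewrite cvB ?cv_shift //; cont. Qed.

Lemma snN f : continuous f -> periodic3 f -> nrm (fun x => - f x) <= nrm f.
Proof.
move=> cf pf; have := @sn_line _ _ Hn (fun _ => -1) 0 f (@c_cst R R (-1)) cf pf.
rewrite J01_cst normrN1 mul1r; rewrite (_ : (fun x => J 0 1 _) = (fun x => - f x)) //.
by apply: funext => x; rewrite -[RHS]J01_cst; apply: J_ext => s _; rewrite scaler0 addr0 mulN1r.
Qed.

Lemma sn0 : nrm (fun _ => 0) <= 0.
Proof. by apply: (sn_sup Hn); [cont|move=> x _; rewrite normr0]. Qed.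

Lemma sn_sum n (F : 'I_n -> pt -> R) : (forall i, continuous (F i)) -> (forall i, periodic3 (F i)) ->
  nrm (fun x => \sum_(i < n) F i x) <= \sum_(i < n) nrm (F i).
Proof.
elim: n F => [|n IH] F cF pF.
  by rewrite big_ord0; under eq_fun do rewrite big_ord0; exact: sn0.
under eq_fun do rewrite big_ord_recl; rewrite big_ord_recl.
apply: le_trans (snD Hn _ _ _ _) _ => //.
- by apply: c_sum => i.
- by move=> x i; apply: eq_bigr => j _; exact: pF.
- by rewrite lerD2l; apply: IH.
Qed.

Lemma sn_bernstein b N i f : TP (Qc b) f -> b i <= N%:R ->
  exists df, [/\ continuous df, periodic3 df, pdv i f df & nrm df <= 4 * pi * N%:R * nrm f].
Proof.
move=> Tf bN; have cf := TP_cont Tf; have cd := @c_dker R N.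
have pf : periodic3 f by apply: TP_per Tf => k [].
exists (fun x => J 0 1 (fun s => dker N s * f (x + s *: e3 R i))); split.
- by apply: (@J_param _ pt 0 1 (fun x s => dker N s * f (x + s *: e3 R i))) => //; cont.
- by move=> x j; apply: J_ext => s _; rewrite addrAC pf.
- exact: TP_bernstein Tf bN.
- apply: le_trans (sn_line Hn _ cd cf pf) _; rewrite ler_wpM2r ?(sn_ge0 Hn) //.
  exact: J_dker.
Qed.

Lemma sn_incr i f df (h : R) : pdv i f df -> continuous df -> periodic3 df ->
  nrm (fun x => f (x + h *: e3 R i) - f x) <= `|h| * nrm df.
Proof.
move=> Hd cd pd; have := @sn_line _ _ Hn (fun _ => h) (h *: e3 R i) df (@c_cst R R h) cd pd.
rewrite J01_cst; under eq_fun do rewrite -(pdv_incr _ h Hd cd).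
by [].
Qed.

(** By periodicity a step [h > 1/2] may be replaced by [h - 1]; in both cases the length of the step
    is at most [sin (pi h)]. *)
Lemma sn_incr1 i f df (h : R) : 0 <= h <= 1 -> pdv i f df -> periodic3 f -> continuous df -> periodic3 df ->
  nrm (fun x => f (x + h *: e3 R i) - f x) <= `|sin (pi * h)| * nrm df.
Proof.
move=> /andP[h0 h1] Hd pf cd pd; case: (leP h (1 / 2)) => h2.
  apply: le_trans (sn_incr h Hd cd pd) _; rewrite ler_wpM2r ?(sn_ge0 Hn) //.
  rewrite (ger0_norm h0); apply: le_trans (ler_norm _); apply: sin_ge_dist; lra.
rewrite (_ : (fun x => _) = (fun x => f (x + (h - 1) *: e3 R i) - f x)); last first.
  by apply: funext => x; rewrite -(pf (x + (h - 1) *: e3 R i) i) -addrA scalerBl scale1r subrK.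
apply: le_trans (sn_incr (h - 1) Hd cd pd) _; rewrite ler_wpM2r ?(sn_ge0 Hn) //.
rewrite distrC ger0_norm; last by lra.
apply: le_trans (ler_norm _); have := @sin_ge_dist R (1 - h).
rewrite mulrBr mulr1 sinB sinpi cospi mul0r sub0r mulN1r opprK; apply; lra.
Qed.

Lemma sn_delta2 f y : continuous f -> periodic3 f -> nrm (fun x => f (x + y) - f x) <= 2 * nrm f.
Proof.
move=> cf pf; apply: le_trans (snD Hn _ _ _ _) _.
- by cont.
- exact: per_shift.
- by cont.
- by move=> x i; rewrite pf.
rewrite (_ : 2 * nrm f = nrm f + nrm f); last by ring.
by apply: lerD; [exact: (sn_shift Hn)|exact: snN].
Qed.

(** The increment is telescoped along three coordinate steps, each bounded by Bernstein's
    inequality. *)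
Lemma sn_delta b N f y : TP (Qc b) f -> (forall i, b i <= N%:R) -> cube y ->
  nrm (fun x => f (x + y) - f x) <= 4 * pi * N%:R * dst y * nrm f.
Proof.
move=> Tf bN cy; have cf := TP_cont Tf.
have pf : periodic3 f by apply: TP_per Tf => k [].
have H i h : 0 <= h <= 1 -> nrm (fun x => f (x + h *: e3 R i) - f x) <= `|sin (pi * h)| * (4 * pi * N%:R * nrm f).
  move=> hh; have [df [cd pd Hd nd]] := sn_bernstein Tf (bN i).
  by apply: le_trans (sn_incr1 hh Hd pf cd pd) _; rewrite ler_wpM2l.
pose D i x := f (x + y 0 i *: e3 R i) - f x.
have cDD i : continuous (D i) by rewrite /D; cont.
have pD i : periodic3 (D i) by move=> x j; rewrite /D addrAC !pf.
pose h1 := y 0 o0 *: e3 R o0; pose h2 := h1 + y 0 o1 *: e3 R o1.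
have -> : (fun x => f (x + y) - f x) = (fun x => D o0 x + D o1 (x + h1) + D o2 (x + h2)).
  apply: funext => x; rewrite /D (_ : x + y = x + h2 + y 0 o2 *: e3 R o2).
    by rewrite /h2 !addrA; ring.
  by rewrite /h2 /h1 !addrA; apply/rowP; elim/ord3P; rewrite !mxE /= ?mulr0 ?mulr1 ?addr0.
have nD i : nrm (D i) <= `|sin (pi * y 0 i)| * (4 * pi * N%:R * nrm f) by apply: H; exact: cy.
apply: (@le_trans _ _ (nrm (D o0) + nrm (D o1) + nrm (D o2))); last first.
  rewrite (_ : 4 * pi * N%:R * dst y * nrm f = \sum_(i < 3) `|sin (pi * y 0 i)| * (4 * pi * N%:R * nrm f)); last first.
    by rewrite /dst -mulr_suml; ring.
  by rewrite sum3 !lerD.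
apply: le_trans (snD Hn _ _ _ _) _.
- by have c0 := cDD o0; have c1 := cDD o1; cont.
- by move=> x i; rewrite pD (addrAC x) pD.
- by have c2 := cDD o2; cont.
- by move=> x i; rewrite addrAC pD.
apply: lerD; last exact: (sn_shift Hn).
apply: le_trans (snD Hn _ _ _ _) _ => //.
- by have c1 := cDD o1; cont.
- by move=> x i; rewrite addrAC pD.
by rewrite lerD2l; exact: (sn_shift Hn).
Qed.

Lemma LPdeg_le n : (LPdeg n)%:R = 6 * 2 ^+ n :> R.
Proof. by rewrite /LPdeg natrM natrX exprS; ring. Qed.

(** [rho] comes from the weight, [24 pi = 4 pi * 6] from Bernstein's inequality in degree [6 * 2^n],
    and [geoC] from summing over the blocks. *)
Definition C1 : R := rho R * (24 * pi) * geoC R.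

Lemma C1_gt0 : 0 < C1.
Proof.
apply: mulr_gt0 (geoC_gt0 R); apply: mulr_gt0 (rho_gt0 R) _.
by apply: mulr_gt0 (pi_gt0 R).
Qed.

Lemma sn_cv1 N f : (0 < N)%N -> continuous f -> periodic3 f -> nrm (cv (jack N) f) <= nrm f.
Proof.
move=> N0 cf pf; apply: le_trans (sn_cv Hn (@c_jack R N) cf pf) _.
rewrite (_ : I3 _ = 1) ?mul1r // -(I3_jack R N0); apply: I3_ext => y _.
by rewrite ger0_norm ?jack_ge0.
Qed.

Lemma blk_cont n u : continuous u -> continuous (blk n u).
Proof. by move=> cu; exact: TP_cont (LPblock_TP chi vphi n cu). Qed.

Lemma blk_per n u : continuous u -> periodic3 (blk n u).
Proof. by move=> cu; apply: TP_per (LPblock_TP chi vphi n cu) => k []. Qed.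

(** Blocks up to [J] are bounded through their gradient, by [2^n dst y], the others by twice their
    norm; both contributions decay geometrically in [|n - J|]. The scale [J] is independent of the
    degree [N]. *)
Lemma cv_incr u A J y N : (0 < N)%N -> continuous u -> periodic3 u ->
  (forall n, wgt R n * nrm (blk n u) <= A) -> cube y ->
  nrm (fun x => cv (jack N) u (x + y) - cv (jack N) u x) <= C1 * A * rr R ^+ J * (1 + 2 ^+ J * dst y).
Proof.
move=> N0 cu pu HA cy; have cj := @c_jack R N.
have cb n := @blk_cont n u cu; have pb n := @blk_per n u cu.
have A0 : 0 <= A by apply: le_trans (HA 0%N); rewrite mulr_ge0 ?(sn_ge0 Hn) // ltW // wgt_gt0.
have d0 := dst_ge0 y; have p2 := @pi_ge2 R.
have r0 := rr_gt0 R; have rh0 := rho_gt0 R.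
have [N1 /(_ N1 (leqnn _)) H1] := cv_LP LP N0 cu pu.
pose D n x := blk n u (x + y) - blk n u x.
have cDD n : continuous (D n) by exact: (@c_delta (blk n u) y (cb n)).
have pD n : periodic3 (D n) by move=> x i; rewrite /D addrAC !pb.
rewrite (_ : (fun x => _) = (fun x => \sum_(n < N1) cv (jack N) (D n) x)); last first.
  apply: funext => x; rewrite !H1 -sumrB; apply: eq_bigr => n _.
  exact: esym (cv_delta y x cj (cb n)).
apply: le_trans (sn_sum (F := fun n => cv (jack N) (D n)) _ _) _.
- by move=> n; exact: cv_cont.
- by move=> n; exact: cv_per.
apply: (@le_trans _ _ (\sum_(n < N1) (rho R * (24 * pi) * A * rr R ^+ J * (1 + 2 ^+ J * dst y)) * rr R ^+ ee n J)).
  apply: ler_sum => n _; apply: le_trans (sn_cv1 N0 (cDD n) (pD n)) _.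
  have Hb : nrm (blk n u) <= A * (rho R * rr R ^+ n).
    by rewrite -wgtE ler_pdivlMr ?wgt_gt0 // mulrC.
  case: (leqP n J) => nJ.
    apply: le_trans (sn_delta (LPblock_TP chi vphi n cu) (fun _ => lexx _) cy) _.
    rewrite LPdeg_le.
    apply: (@le_trans _ _ (24 * pi * dst y * (A * rho R) * (2 ^+ n * rr R ^+ n))).
      have -> : 24 * pi * dst y * (A * rho R) * (2 ^+ n * rr R ^+ n) = 4 * pi * (6 * 2 ^+ n) * dst y * (A * (rho R * rr R ^+ n)) by ring.
      by rewrite ler_wpM2l // !mulr_ge0 ?exprn_ge0 //; lra.
    apply: (@le_trans _ _ (24 * pi * dst y * (A * rho R) * (2 ^+ J * rr R ^+ J * rr R ^+ ee n J))).
      rewrite ler_wpM2l //; last exact: low_le.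
      by rewrite !mulr_ge0 //; lra.
    have -> : 24 * pi * dst y * (A * rho R) * (2 ^+ J * rr R ^+ J * rr R ^+ ee n J) =
      rho R * (24 * pi) * A * rr R ^+ J * (2 ^+ J * dst y) * rr R ^+ ee n J by ring.
    apply: ler_wpM2r; first by apply: exprn_ge0; exact: ltW.
    apply: ler_wpM2l; last by rewrite lerDr.
    by rewrite !mulr_ge0 ?exprn_ge0 //; lra.
  apply: le_trans (sn_delta2 y (cb n) (pb n)) _.
  apply: (@le_trans _ _ (2 * (A * (rho R * rr R ^+ n)))); first by rewrite ler_wpM2l.
  rewrite -(subnKC (ltnW nJ)) exprD /ee addKn (eqP (leq_addr _ J)) addn0.
  set e := rr R ^+ (n - J); have e0 : 0 <= e by rewrite exprn_ge0 // ltW.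
  have q0 : 0 <= rr R ^+ J by rewrite exprn_ge0 // ltW.
  have -> : 2 * (A * (rho R * (rr R ^+ J * e))) = rho R * 2 * A * rr R ^+ J * 1 * e by ring.
  rewrite ler_wpM2r //; apply: ler_pM => //.
  - by rewrite !mulr_ge0 // ltW.
  - by rewrite ler_wpM2r // ler_wpM2r // ler_wpM2l ?ltW //; lra.
  - by rewrite lerDl mulr_ge0 ?exprn_ge0.
rewrite -mulr_sumr /C1 (_ : _ * geoC R * A * rr R ^+ J * _ = rho R * (24 * pi) * A * rr R ^+ J * (1 + 2 ^+ J * dst y) * geoC R); last by ring.
apply: ler_wpM2l; last exact: geo_sum.
have q0 : 0 <= rr R ^+ J by apply: exprn_ge0; exact: ltW.
have h0 : 0 <= rho R * (24 * pi) by apply: mulr_ge0; lra.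
apply: mulr_ge0; last by rewrite addr_ge0 // mulr_ge0 // exprn_ge0.
by apply: mulr_ge0 => //; apply: mulr_ge0.
Qed.

(** The bound of [cv_incr] is uniform in the kernel degree, so it survives uniform approximation of
    [u] by its regularisations. *)
Lemma besov_incr u A J y : continuous u -> periodic3 u ->
  (forall n, wgt R n * nrm (blk n u) <= A) -> cube y ->
  nrm (fun x => u (x + y) - u x) <= C1 * A * rr R ^+ J * (1 + 2 ^+ J * dst y).
Proof.
move=> cu pu HA cy; apply/ler_addgt0Pr => e e0.
have e2 : 0 < e / 2 by rewrite divr_gt0.
have cu2 : continuous (fun p : pt * R => u p.1) by cont.
have [N0 HN] := @cv_unif R 0 (fun x _ => u x) (e / 2) cu2 (fun _ => pu) e2.
have {HN} H x : `|cv (jack N0.+1) u x - u x| <= e / 2.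
  by apply: (HN N0.+1 (leqnSn _) isT 0); rewrite lexx.
have cj := @c_jack R N0.+1; have cc := cv_cont cj cu; have pc := cv_per (jack N0.+1) pu.
rewrite (_ : (fun x => _) = (fun x => (cv (jack N0.+1) u (x + y) - cv (jack N0.+1) u x) +
   ((u (x + y) - cv (jack N0.+1) u (x + y)) - (u x - cv (jack N0.+1) u x)))); last first.
  by apply: funext => x; ring.
apply: le_trans (snD Hn _ _ _ _) _.
- by cont.
- by move=> x i; rewrite addrAC !pc.
- by cont.
- by move=> x i; rewrite (addrAC x (e3 R i) y) !pc !pu.
apply: lerD; first exact: cv_incr.
apply: (sn_sup Hn); first by cont.
move=> x _; apply: le_trans (ler_normB _ _) _; rewrite [leRHS]splitr.
by apply: lerD; rewrite distrC.
Qed.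

Lemma pdv_unique i f df dg : pdv i f df -> pdv i f dg -> df = dg.
Proof. by move=> h1 h2; apply: funext => x; exact: der_unique (h1 x) (h2 x). Qed.

(** The weighted sum over blocks is retained instead of being bounded by a supremum: the decay of
    the individual terms is what later makes the flux vanish. *)
Lemma cv_grad u i J : continuous u -> periodic3 u ->
  exists df, [/\ continuous df, periodic3 df, pdv i (cv (jack (2 ^ J)) u) df &
    exists N', nrm df <= rho R * (24 * pi) * (2 ^+ J * rr R ^+ J) *
      \sum_(n < N') rr R ^+ ee n J * (wgt R n * nrm (blk n u))].
Proof.
move=> cu pu; set N := (2 ^ J)%N; have N0 : (0 < N)%N by rewrite expn_gt0.
have cj := @c_jack R N; have cb n := @blk_cont n u cu; have pb n := @blk_per n u cu.
have p2 := @pi_ge2 R; have r0 := rr_gt0 R; have rh0 := rho_gt0 R.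
have [N1 /(_ N1 (leqnn _)) H1] := cv_LP LP N0 cu pu.
have H n : exists df, [/\ continuous df, periodic3 df, pdv i (cv (jack N) (blk n u)) df &
    nrm df <= rho R * (24 * pi) * (2 ^+ J * rr R ^+ J) * (rr R ^+ ee n J * (wgt R n * nrm (blk n u)))].
  have wn := wgt_gt0 R n; have n0 := sn_ge0 Hn (blk n u).
  have EB : nrm (blk n u) = rho R * rr R ^+ n * (wgt R n * nrm (blk n u)).
    by rewrite -wgtE mulrA mulVf ?mul1r // gt_eqF.
  set B := wgt R n * nrm (blk n u) in EB *.
  have B0 : 0 <= B by rewrite mulr_ge0 // ltW.
  have [db [cdb pdb Hdb ndb]] := sn_bernstein (LPblock_TP chi vphi n cu) (lexx _) (i := i).
  exists (cv (jack N) db); split.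
  - exact: cv_cont.
  - exact: cv_per.
  - exact: pdv_cv.
  case: (leqP n J) => nJ.
    apply: le_trans (sn_cv1 N0 cdb pdb) _; apply: le_trans ndb _.
    rewrite LPdeg_le EB.
    have -> : 4 * pi * (6 * 2 ^+ n) * (rho R * rr R ^+ n * B) = rho R * (24 * pi) * B * (2 ^+ n * rr R ^+ n) by ring.
    have -> : rho R * (24 * pi) * (2 ^+ J * rr R ^+ J) * (rr R ^+ ee n J * B) = rho R * (24 * pi) * B * (2 ^+ J * rr R ^+ J * rr R ^+ ee n J) by ring.
    by rewrite ler_wpM2l ?low_le // !mulr_ge0 //; lra.
  (* For a block beyond scale [J], Bernstein's inequality is applied after regularisation, which
     caps the degree at [2 N]. *)
  have TK : TP (Qc (fun _ => 2 * N%:R)) (cv (jack N) (blk n u)).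
    apply: TP_ext (TP_conv (TP_jack R N) (cb n)) => x; rewrite cvE //.
    - exact: jack_per.
    - exact: jack_even.
  have bN : 2 * N%:R <= (2 * N)%:R :> R by rewrite natrM.
  have [dk [cdk pdk Hdk ndk]] := sn_bernstein TK bN (i := i).
  have -> : cv (jack N) db = dk by apply: (pdv_unique _ Hdk); exact: pdv_cv.
  apply: le_trans ndk _.
  apply: (@le_trans _ _ (4 * pi * (2 * N)%:R * nrm (blk n u))).
    by rewrite ler_wpM2l ?mulr_ge0 // ?(sn_cv1 N0) //; lra.
  rewrite EB natrM /N natrX.
  have -> : rho R * (24 * pi) * (2 ^+ J * rr R ^+ J) * (rr R ^+ ee n J * B) = rho R * (24 * pi) * B * (2 ^+ J * rr R ^+ J * rr R ^+ ee n J) by ring.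
  apply: (@le_trans _ _ (rho R * (24 * pi) * B * (2 ^+ J * rr R ^+ n))); last first.
    by rewrite ler_wpM2l ?high_le 1?ltnW // !mulr_ge0 //; lra.
  have -> : 4 * pi * (2 * 2 ^+ J) * (rho R * rr R ^+ n * B) = rho R * (8 * pi) * (B * (2 ^+ J * rr R ^+ n)) by ring.
  rewrite -[leRHS]mulrA ler_wpM2r // ?ler_wpM2l ?mulr_ge0 ?exprn_ge0 //; lra.
pose F n := projT1 (cid (H n)).
have HF n : [/\ continuous (F n), periodic3 (F n), pdv i (cv (jack N) (blk n u)) (F n) &
    nrm (F n) <= rho R * (24 * pi) * (2 ^+ J * rr R ^+ J) * (rr R ^+ ee n J * (wgt R n * nrm (blk n u)))].
  exact: (projT2 (cid (H n))).
exists (fun x => \sum_(n < N1) F n x); split.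
- by apply: c_sum => n; case: (HF n).
- by move=> x j; apply: eq_bigr => n _; case: (HF n) => _ + _ _; exact.
- apply: (@pdv_ext _ i (fun x => \sum_(n < N1) cv (jack N) (blk n u) x)); first by move=> x; rewrite H1.
  by move=> x; apply: der_sum => n; case: (HF n) => _ _ + _; exact.
- exists N1; apply: le_trans (sn_sum (F := fun n => F n) _ _) _.
  + by move=> n; case: (HF n).
  + by move=> n; case: (HF n).
  + by rewrite mulr_sumr; apply: ler_sum => n _; case: (HF n).
Qed.

End Estimates.

(** * The commutator flux *)

Opaque C1 geoC rho.

Section Flux.
Variable R : realType.
Local Notation pt := 'rV[R]_3.
Variables (chi vphi : pt -> R).
Hypothesis LP : LP_pair chi vphi.
Implicit Types (f g u w : pt -> R) (k x y : pt).
Local Notation blk := (LPblock chi vphi).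

(** For [N = 2^J] this is the last factor of [besov_incr]. *)
Definition om N y : R := 1 + N%:R * dst y.

Lemma c_om N : continuous (om N).
Proof. by have cd := @c_dst R; rewrite /om; cont. Qed.

Lemma om_ge0 N y : 0 <= om N y.
Proof. by rewrite addr_ge0 // mulr_ge0 ?dst_ge0. Qed.

Lemma om_ge1 N y : 1 <= om N y.
Proof. by rewrite lerDl mulr_ge0 ?dst_ge0. Qed.

Definition comm N w f x : R := cv (jack N) (fun y => w y * f y) x - cv (jack N) w x * cv (jack N) f x.
(** Increments of the velocity are bounded in sup norm and leave only the weight [om]; those of [f]
    are bounded only in [L^2], so their weighted average stays a function of [x]. *)
Definition SS N f x : R := I3 (fun y => jack N y * (om N y * `|f (x + y) - f x|)).

Lemma c_SS N f : continuous f -> continuous (SS N f).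
Proof.
move=> cf; have cj := @c_jack R N; have co := @c_om N.
by apply: (@I3_param R pt (fun x y => jack N y * (om N y * `|f (x + y) - f x|))); cont.
Qed.

Lemma c_comm N w f : continuous w -> continuous f -> continuous (comm N w f).
Proof.
move=> cw cf; have cj := @c_jack R N.
have c1 : continuous (cv (jack N) (fun y => w y * f y)) by apply: cv_cont => //; cont.
have c2 := cv_cont cj cw; have c3 := cv_cont cj cf.
by rewrite /comm; cont.
Qed.

Lemma cvBx N u x : (0 < N)%N -> continuous u ->
  cv (jack N) u x - u x = I3 (fun y => jack N y * (u (x + y) - u x)).
Proof.
move=> N0 cu; have cj := @c_jack R N.
rewrite -[X in _ - X]mulr1 -(I3_jack R N0) -I3Z // /cv -I3B; [|by cont|by cont].
by apply: I3_ext => y _; ring.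
Qed.

(** The constant is [30 = 1 + 29]: one term from the product of increments, and 29 from the product
    of means, where [om <= om^2] brings in [I3_jack_w]. *)
Lemma comm_le N w f (B : R) x : (0 < N)%N -> continuous w -> continuous f -> 0 <= B ->
  (forall y, cube y -> `|w (x + y) - w x| <= B * om N y) ->
  `|comm N w f x| <= 30 * B * SS N f x.
Proof.
move=> N0 cw cf B0 Hw; have cj := @c_jack R N; have co := @c_om N.
have j0 := @jack_ge0 R N.
(* The Constantin-E-Titi identity: the kernel having mass one, the commutator is the covariance of
   the increments of [w] and [f] about their values at [x]. *)
have E : comm N w f x = I3 (fun y => jack N y * ((w (x + y) - w x) * (f (x + y) - f x))) -
    I3 (fun y => jack N y * (w (x + y) - w x)) * I3 (fun y => jack N y * (f (x + y) - f x)).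
  rewrite -!cvBx //.
  have -> : I3 (fun y => jack N y * ((w (x + y) - w x) * (f (x + y) - f x))) =
    cv (jack N) (fun y => w y * f y) x - f x * cv (jack N) w x - w x * cv (jack N) f x + w x * f x.
    rewrite -[w x * f x]mulr1 -(I3_jack R N0) -!I3Z //; [|by cont|by cont].
    rewrite -I3B; [|by cont|by cont]; rewrite -I3B; [|by cont|by cont].
    by rewrite -I3D; [|by cont|by cont]; apply: I3_ext => y _; ring.
  by rewrite /comm; ring.
have S0 : 0 <= SS N f x.
  by apply: I3_ge0 => y; apply: mulr_ge0 => //; apply: mulr_ge0 => //; exact: om_ge0.
have H1 : `|I3 (fun y => jack N y * ((w (x + y) - w x) * (f (x + y) - f x)))| <= B * SS N f x.
  apply: le_trans (I3_abs _) _; first by cont.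
  rewrite -I3Z; last by cont.
  apply: I3_le; [by cont|by cont|move=> y cy].
  rewrite normrM (ger0_norm (j0 y)) normrM [leRHS]mulrCA; apply: ler_wpM2l => //.
  by rewrite mulrA; apply: ler_wpM2r => //; exact: Hw.
have H2 : `|I3 (fun y => jack N y * (w (x + y) - w x))| <= 29 * B.
  apply: le_trans (I3_abs _) _; first by cont.
  apply: (@le_trans _ _ (I3 (fun y => B * (jack N y * om N y ^+ 2)))).
    apply: I3_le; [by cont|by cont|move=> y cy].
    rewrite normrM (ger0_norm (j0 y)) [leRHS]mulrCA; apply: ler_wpM2l => //.
    apply: le_trans (Hw y cy) _; apply: ler_wpM2l => //.
    by rewrite expr2 ler_peMr ?om_ge1 ?om_ge0.
  rewrite I3Z; last by cont.
  by rewrite mulrC; apply: ler_wpM2r => //; exact: I3_jack_w.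
have H3 : `|I3 (fun y => jack N y * (f (x + y) - f x))| <= SS N f x.
  apply: le_trans (I3_abs _) _; first by cont.
  apply: I3_le; [by cont|by cont|move=> y cy].
  rewrite normrM (ger0_norm (j0 y)); apply: ler_wpM2l => //.
  by rewrite ler_peMl ?om_ge1.
rewrite E; apply: le_trans (ler_normB _ _) _.
have -> : 30 * B * SS N f x = B * SS N f x + 29 * B * SS N f x by ring.
by apply: lerD => //; rewrite normrM; apply: ler_pM.
Qed.

(** The moment bound 29 is used twice: in Cauchy-Schwarz at fixed [x], and after Fubini on the
    squared increments. *)
Lemma n2_SS N f (D : R) : (0 < N)%N -> continuous f -> 0 <= D ->
  (forall y, cube y -> n2 (fun x => f (x + y) - f x) <= D * om N y) -> n2 (SS N f) <= 29 * D.
Proof.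
move=> N0 cf D0 HD; have cj := @c_jack R N; have co := @c_om N; have cS := @c_SS N f cf.
have j0 := @jack_ge0 R N; have Hw := I3_jack_w R N0.
have co2 : continuous (fun y => jack N y * om N y ^+ 2) by cont.
have w0 : 0 <= I3 (fun y => jack N y * om N y ^+ 2) by apply: I3_ge0 => y; rewrite mulr_ge0 // sqr_ge0.
apply: le_n2; first by rewrite mulr_ge0.
have cG : continuous (fun x => I3 (fun y => jack N y * `|f (x + y) - f x| ^+ 2)).
  by apply: (@I3_param R pt (fun x y => jack N y * `|f (x + y) - f x| ^+ 2)); cont.
apply: (@le_trans _ _ (I3 (fun x => 29 * I3 (fun y => jack N y * `|f (x + y) - f x| ^+ 2)))).
  apply: I3_le; [by cont|by cont|move=> x _].
  apply: (@le_trans _ _ (I3 (fun y => jack N y * om N y ^+ 2) * I3 (fun y => jack N y * `|f (x + y) - f x| ^+ 2))).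
    by apply: (@I3_CS R (jack N) (om N) (fun y => `|f (x + y) - f x|)) => //; cont.
  apply: ler_wpM2r => //; apply: I3_ge0 => y; rewrite mulr_ge0 // sqr_ge0.
rewrite I3Z // exprMn (_ : 29 ^+ 2 = 29 * 29) ?expr2 // -mulrA ler_wpM2l //.
rewrite I3_fubini; last by cont.
apply: (@le_trans _ _ (I3 (fun y => D ^+ 2 * (jack N y * om N y ^+ 2)))); last first.
  by rewrite I3Z // mulrC -expr2; apply: ler_wpM2r => //; exact: sqr_ge0.
apply: I3_le; [|by cont|move=> y cy].
  by apply: (@I3_param R pt (fun y x => jack N y * `|f (x + y) - f x| ^+ 2)); cont.
rewrite I3Z; last by cont.
rewrite [leRHS]mulrCA; apply: ler_wpM2l => //; rewrite -exprMn.
have -> : I3 (fun x => `|f (x + y) - f x| ^+ 2) = n2 (fun x => f (x + y) - f x) ^+ 2.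
  by rewrite n2_sqr; apply: I3_ext => x _; rewrite real_normK ?num_real.
rewrite ler_pXn2r ?nnegrE ?n2_ge0 //; first exact: HD.
by rewrite mulr_ge0 ?om_ge0.
Qed.

Definition gradN N f i x : R := 'D_(e3 R i) (cv (jack N) f) x.

Lemma TP_cvj N u : continuous u -> periodic3 u -> TP (Qc (fun _ => 2 * N%:R)) (cv (jack N) u).
Proof.
move=> cu pu; apply: TP_ext (TP_conv (TP_jack R N) cu) => x; rewrite cvE //.
- exact: c_jack.
- exact: jack_per.
- exact: jack_even.
Qed.

Lemma gradP N f i : continuous f -> periodic3 f ->
  [/\ pdv i (cv (jack N) f) (gradN N f i), continuous (gradN N f i) & periodic3 (gradN N f i)].
Proof.
move=> cf pf; have [df Td Hd] := TP_pdv i (@TP_cvj N f cf pf).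
have -> : gradN N f i = df by apply: funext => x; exact: pdv_val.
by split => //; [exact: TP_cont Td|apply: TP_per Td => k []].
Qed.

Variables (v : 'I_3 -> pt -> R).
Hypothesis cv_v : forall i, continuous (v i).
Hypothesis pv : forall i, periodic3 (v i).

Definition flux (bpp : R -> R) N f : R :=
  \sum_(i < 3) I3 (fun x => bpp (cv (jack N) f x) * gradN N f i x * cv (jack N) (fun y => v i y * f y) x).

(** Replacing [(v_i f)_N] by [(v_i)_N f_N] gives a term with zero integral, since [z b''(z)] has a
    primitive and the regularised velocity is divergence free. *)
Lemma flux_comm (b bp bpp : R -> R) N f : (forall z : R, der b z (1 : R) (bp z)) ->
  (forall z : R, der bp z (1 : R) (bpp z)) -> continuous bpp ->
  continuous f -> periodic3 f -> (forall x, \sum_(i < 3) gradN N (v i) i x = 0) ->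
  flux bpp N f = \sum_(i < 3) I3 (fun x => bpp (cv (jack N) f x) * gradN N f i x * comm N (v i) f x).
Proof.
move=> db dbp cbpp cf pf dv; have cj := @c_jack R N.
have cfN := cv_cont cj cf; have pfN := cv_per (jack N) pf.
have cvN i := cv_cont cj (@cv_v i); have pvN i := cv_per (jack N) (@pv i).
have Hf i := gradP N i cf pf; have Hv i := gradP N i (@cv_v i) (@pv i).
have cb := der_cont db; have cbp := der_cont dbp.
have cg i : continuous (gradN N f i) by case: (Hf i).
have cgv i : continuous (gradN N (v i) i) by case: (Hv i).
pose fN := cv (jack N) f.
have c2 i : continuous (cv (jack N) (fun y => v i y * f y)) by apply: cv_cont => //; apply: cM.
have E0 : \sum_(i < 3) I3 (fun x => bpp (fN x) * gradN N f i x * (cv (jack N) (v i) x * fN x)) = 0.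
  (* Chosen so that [B' = z b'']; the discarded term is then the velocity against the gradient of
     [B (f_N)]. *)
  pose B z := z * bp z - b z.
  have dB z : der B z (1 : R) (z * bpp z).
    rewrite -[X in der _ _ _ X](_ : (1 * bp z + z * bpp z) + - bp z = _); last by ring.
    by apply: derD; [apply: derM => //; exact: der_id|exact: derN].
  have cB := der_cont dB.
  have H i : I3 (fun x => gradN N (v i) i x * B (fN x) + cv (jack N) (v i) x * (fN x * bpp (fN x) * gradN N f i x)) = 0.
    have [h1 _ _] := Hv i; have [h2 _ _] := Hf i.
    have := pdvM h1 (pdv_comp dB h2); move/pdv_I30; apply.
    - by apply: (cM (cvN i)); exact: (c_comp cB cfN).
    - by have := cg i; have := cgv i; have := cvN i => q1 q2 q3; rewrite /fN; cont.
    - by move=> x j; rewrite pvN pfN.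
  have : \sum_(i < 3) I3 (fun x => gradN N (v i) i x * B (fN x) + cv (jack N) (v i) x * (fN x * bpp (fN x) * gradN N f i x)) = 0.
    by rewrite big1.
  have cs1 i : continuous (fun x => gradN N (v i) i x * B (fN x)).
    by have := cgv i => q; rewrite /fN; cont.
  have cs2 i : continuous (fun x => cv (jack N) (v i) x * (fN x * bpp (fN x) * gradN N f i x)).
    by have := cg i; have := cvN i => q1 q2; rewrite /fN; cont.
  under eq_bigr => i _ do rewrite (I3D (cs1 i) (cs2 i)).
  rewrite big_split /= -I3_sum // (_ : I3 _ = 0); last first.
    rewrite -[RHS]I3_cst; apply: I3_ext => x _.
    by rewrite -mulr_suml dv mul0r.
  rewrite add0r => E; rewrite -[RHS]E; apply: eq_bigr => i _; apply: I3_ext => x _; ring.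
transitivity (flux bpp N f -
  \sum_(i < 3) I3 (fun x => bpp (fN x) * gradN N f i x * (cv (jack N) (v i) x * fN x))).
  by rewrite E0 subr0.
rewrite /flux -sumrB; apply: eq_bigr => i _.
have c2i := c2 i; have cgi := cg i; have cvi := cvN i.
rewrite -I3B; [|by cont|by rewrite /fN; cont].
by apply: I3_ext => x _; rewrite /comm /fN; ring.
Qed.

(** Three directions, [30 * 29] from the commutator, [C1] once for each of the two increments, and
    [rho * 24 pi] from the gradient. *)
Definition CF : R := 3 * ((30 * 29) * C1 R ^+ 2) * (rho R * (24 * pi)).

Lemma CF_gt0 : 0 < CF.
Proof.
have c0 := C1_gt0 R; have r0 := rho_gt0 R; have p0 := @pi_gt0 R.
have n0 (n : nat) : 0 < n.+1%:R :> R by rewrite ltr0n.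
have h1 : 0 < (30 * 29) * C1 R ^+ 2 by apply: mulr_gt0 (exprn_gt0 2 c0); apply: mulr_gt0; exact: n0.
have h2 : 0 < rho R * (24 * pi) by apply: (mulr_gt0 r0); exact: (mulr_gt0 (n0 _) p0).
by apply: mulr_gt0 h2; apply: mulr_gt0 h1; exact: n0.
Qed.

Lemma flux_bound (b bp bpp : R -> R) J f (B2 V A E : R) :
  (forall z : R, der b z (1 : R) (bp z)) ->
  (forall z : R, der bp z (1 : R) (bpp z)) -> continuous bpp ->
  continuous f -> periodic3 f -> (forall x, \sum_(i < 3) gradN (2 ^ J) (v i) i x = 0) ->
  (forall x, `|bpp (cv (jack (2 ^ J)) f x)| <= B2) ->
  (forall i n, wgt R n * Lq +oo%E (blk n (v i)) <= V) ->
  (forall n, wgt R n * n2 (blk n f) <= A) ->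
  (forall N', \sum_(n < N') rr R ^+ ee n J * (wgt R n * n2 (blk n f)) <= E) ->
  `|flux bpp (2 ^ J) f| <= CF * B2 * V * A * E.
Proof.
move=> db dbp cbpp cf pf dv HB HV HA HE; set N := (2 ^ J)%N.
have N0 : (0 < N)%N by rewrite expn_gt0.
have NE : N%:R = 2 ^+ J :> R by rewrite natrX.
have cj := @c_jack R N; have c0 := C1_gt0 R; have r0 := rr_gt0 R; have p0 := @pi_gt0 R; have rh0 := rho_gt0 R.
have q0 : 0 <= rr R ^+ J by apply: exprn_ge0; exact: ltW.
have A0 : 0 <= A by apply: le_trans (HA 0%N); rewrite mulr_ge0 ?n2_ge0 // ltW // wgt_gt0.
have V0 : 0 <= V by apply: le_trans (HV ord0 0%N); rewrite mulr_ge0 ?sup_ge0 // ltW // wgt_gt0.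
have B20 : 0 <= B2 by apply: le_trans (HB 0).
pose B := C1 R * V * rr R ^+ J; pose D := C1 R * A * rr R ^+ J.
have B0 : 0 <= B by rewrite /B; apply: mulr_ge0 => //; apply: mulr_ge0 => //; exact: ltW.
have D0 : 0 <= D by rewrite /D; apply: mulr_ge0 => //; apply: mulr_ge0 => //; exact: ltW.
have Hw i x y : cube y -> `|v i (x + y) - v i x| <= B * om N y.
  move=> cy; apply: (@le_trans _ _ (Lq +oo%E (fun x => v i (x + y) - v i x))).
    apply: (@sup_ub R (fun x => v i (x + y) - v i x)); first exact: c_delta.
    by move=> z j; rewrite addrAC !pv.
  by rewrite /om NE; apply: (besov_incr LP (@sup_snorm R)).
have Hf y : cube y -> n2 (fun x => f (x + y) - f x) <= D * om N y.
  by move=> cy; rewrite /om NE; apply: (besov_incr LP (@n2_snorm R)).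
have HS := n2_SS N0 cf D0 Hf.
have HR i : n2 (comm N (v i) f) <= 30 * 29 * B * D.
  have cS := @c_SS N f cf; have cR := @c_comm N (v i) f (@cv_v i) cf.
  apply: (@le_trans _ _ (30 * B * n2 (SS N f))).
    apply: le_n2; first by apply: mulr_ge0; [rewrite mulr_ge0|exact: n2_ge0].
    rewrite exprMn n2_sqr -I3Z; last by cont.
    apply: I3_le; [by cont|by cont|move=> x _].
    rewrite -exprMn -real_normK ?num_real //; apply: lerXn2r; rewrite ?nnegrE //.
      apply: mulr_ge0; first by rewrite mulr_ge0.
      apply: I3_ge0 => y; apply: mulr_ge0; first exact: jack_ge0.
      by apply: mulr_ge0 => //; exact: om_ge0.
    by apply: comm_le => // y; exact: Hw.
  have -> : 30 * 29 * B * D = 30 * B * (29 * D) by ring.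
  by apply: ler_wpM2l => //; rewrite mulr_ge0.
have HG i : n2 (gradN N f i) <= rho R * (24 * pi) * (2 ^+ J * rr R ^+ J) * E.
  have [df [cd pd Hd [N' HN']]] := cv_grad LP (@n2_snorm R) i J cf pf.
  have -> : gradN N f i = df by apply: funext => x; exact: pdv_val.
  apply: le_trans HN' _; apply: ler_wpM2l => //.
  apply: mulr_ge0; last by apply: mulr_ge0 => //; exact: exprn_ge0.
  by apply: mulr_ge0; [exact: ltW|apply: mulr_ge0 => //; exact: ltW].
rewrite (flux_comm db dbp) //.
apply: le_trans (ler_norm_sum _ _ _) _.
apply: (@le_trans _ _ (\sum_(i < 3) B2 * (n2 (gradN N f i) * n2 (comm N (v i) f)))).
  apply: ler_sum => i _; have [_ cg _] := gradP N i cf pf; have cR := @c_comm N (v i) f (@cv_v i) cf.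
  have cfN := cv_cont cj cf.
  apply: (@le_trans _ _ (n2 (fun x => bpp (cv (jack N) f x) * gradN N f i x) * n2 (comm N (v i) f))).
    by apply: n2_CS => //; cont.
  rewrite mulrA; apply: ler_wpM2r; first exact: n2_ge0.
  apply: le_n2; first by rewrite mulr_ge0 ?n2_ge0.
  rewrite exprMn n2_sqr -I3Z; last by cont.
  apply: I3_le; [by cont|by cont|move=> x _].
  rewrite exprMn; apply: ler_wpM2r; first exact: sqr_ge0.
  by rewrite -real_normK ?num_real //; apply: lerXn2r; rewrite ?nnegrE.
apply: (@le_trans _ _ (\sum_(i < 3) B2 * ((rho R * (24 * pi) * (2 ^+ J * rr R ^+ J) * E) * (30 * 29 * B * D)))).
  apply: ler_sum => i _; apply: ler_wpM2l => //; apply: ler_pM; rewrite ?n2_ge0 //.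
rewrite sumr_const card_ord -[leLHS]mulr_natl.
(* The critical balance [2 rr^3 = 1]: the powers of [N] cancel exactly. *)
have H1 : 2 ^+ J * rr R ^+ J * rr R ^+ J * rr R ^+ J = 1.
  rewrite -!exprMn (_ : 2 * rr R * rr R * rr R = 1) ?expr1n //.
  rewrite -(rho3 R) (_ : _ * rr R = (rho R * rr R) ^+ 3); last by ring.
  by rewrite rhorr expr1n.
rewrite le_eqVlt; apply/orP; left; apply/eqP.
transitivity (CF * B2 * V * A * E * (2 ^+ J * rr R ^+ J * rr R ^+ J * rr R ^+ J)); last by rewrite H1 mulr1.
by rewrite /CF /B /D; ring.
Qed.

(** For [n >= n0] the terms [a n] are small and the weights summable; the finitely many earlier
    terms are far from [J] and carry small weights. *)
Lemma tail_sum (a : nat -> R) (A e : R) : (forall n, 0 <= a n <= A) -> a @ \oo --> (0 : R) -> 0 < e ->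
  exists J0, forall J, (J0 <= J)%N -> forall N', \sum_(n < N') rr R ^+ ee n J * a n <= e.
Proof.
move=> Ha /cvgrPdist_le ca e0; have g0 := geoC_gt0 R; have r0 := rr_gt0 R; have r1 := rr_lt1 R.
have A0 : 0 <= A by case/andP: (Ha 0%N) => h1 h2; exact: le_trans h2.
have e2 : 0 < e / 2 / geoC R by apply: divr_gt0 => //; exact: divr_gt0.
have [n0 _ Hn0] := ca _ e2.
(* For [J >= n0 + k] each of the first [n0] weights is at most [rr ^+ k]; this [k] brings their
   total contribution below [e / 2]. *)
have [k Hk] : exists k : nat, n0%:R * A * rr R ^+ k <= e / 2.
  have : (fun k : nat => rr R ^+ k) @ \oo --> (0 : R) by apply: cvg_expr; rewrite ger0_norm ?ltW.
  move=> /cvgrPdist_le/(_ (e / 2 / (n0%:R * A + 1))) [].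
    by rewrite !divr_gt0 // ltr_wpDl // mulr_ge0.
  move=> k _ /(_ k (leqnn k)); rewrite sub0r normrN ger0_norm; last by rewrite exprn_ge0 // ltW.
  move=> H; exists k; apply: (@le_trans _ _ (n0%:R * A * (e / 2 / (n0%:R * A + 1)))).
    by apply: ler_wpM2l => //; rewrite mulr_ge0.
  rewrite mulrA ler_pdivrMr ?ltr_wpDl ?mulr_ge0 //.
  by rewrite mulrC ler_wpM2l ?lerDl // divr_ge0 // ltW.
exists (n0 + k)%N => J HJ N'.
apply: (@le_trans _ _ (\sum_(n < N') (e / 2 / geoC R * rr R ^+ ee n J + (n < n0)%N%:R * (A * rr R ^+ k)))).
  apply: ler_sum => n _; have /andP[a0 aA] := Ha n.
  have q0 : 0 <= rr R ^+ ee n J by rewrite exprn_ge0 // ltW.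
  case: (ltnP n n0) => nn.
    rewrite mul1r; apply: ler_wpDl; first by rewrite mulr_ge0 // ltW.
    rewrite mulrC; apply: ler_pM => //; apply: ler_wiXn2l; [exact: ltW|exact: ltW|].
    rewrite /ee; apply: leq_trans (leq_addl _ _).
    by rewrite leq_subRL; [apply: leq_trans HJ; rewrite leq_add2r ltnW|apply: leq_trans HJ; rewrite (leq_trans (ltnW nn)) // leq_addr].
  rewrite mul0r addr0 mulrC; apply: ler_wpM2r => //.
  by have := Hn0 n nn; rewrite sub0r normrN ger0_norm.
rewrite big_split /= -mulr_sumr -mulr_suml [leRHS]splitr; apply: lerD.
  apply: (@le_trans _ _ (e / 2 / geoC R * geoC R)).
    by apply: ler_wpM2l; [exact: ltW|exact: geo_sum].
  by rewrite divfK // gt_eqF.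
apply: le_trans Hk; rewrite -mulrA; apply: ler_wpM2r.
  by rewrite mulr_ge0 // exprn_ge0 // ltW.
rewrite -natr_sum ler_nat.
elim: N' => [|M IH]; first by rewrite big_ord0.
have H m : (\sum_(i < m) (i < n0) = minn m n0)%N.
  elim: m => [|m IHm]; first by rewrite big_ord0 min0n.
  rewrite big_ord_recr /= IHm; case: (ltnP m n0) => h.
    by rewrite addn1 (minn_idPl h).
  by rewrite addn0 (minn_idPr (leqW h)).
by rewrite H geq_minr.
Qed.

End Flux.

(** * Testing the weak formulation *)

Section Bump.
Variable R : realType.

Lemma der_inv (f : R -> R) (x df : R) : f x != 0 -> der f x (1 : R) df ->
  der (fun y => (f y)^-1) x (1 : R) (- (f x) ^- 2 * df).
Proof.
move=> fx [d <-]; split; first exact: derivableV.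
exact: deriveV.
Qed.

Variables (a l : R).
Hypothesis l0 : 0 < l.

(** The polynomial in [1 / (a - s)] makes the family of flat exponentials stable under
    differentiation, which gives smoothness to all orders at once. *)
Definition bmp (P : {poly R}) (s : R) : R :=
  if s < a then P.[(a - s)^-1] * expR (- (l * (a - s)^-1)) else 0.

(** For the monomial of degree [i], the exponential is compared with the term of degree [i + 2] of
    its series; the two extra powers give the decay [u^-2], hence quadratic vanishing of [bmp] at
    [a]. *)
Lemma poly_exp_bound (P : {poly R}) : exists2 C, 0 <= C &
  forall u, 0 < u -> `|P.[u] * expR (- (l * u))| <= C * u ^- 2.
Proof.
exists (\sum_(i < size P) `|P`_i| * ((i.+2)`!%:R / l ^+ i.+2)).
  by apply: sumr_ge0 => i _; rewrite mulr_ge0 // divr_ge0 // exprn_ge0 // ltW.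
move=> u u0; rewrite normrM (ger0_norm (expR_ge0 _)) horner_coef.
apply: (@le_trans _ _ (\sum_(i < size P) `|P`_i| * (u ^+ i * expR (- (l * u))))).
  rewrite (_ : \sum_(i < size P) `|P`_i| * _ = (\sum_(i < size P) `|P`_i| * u ^+ i) * expR (- (l * u))); last first.
    by rewrite mulr_suml; apply: eq_bigr => i _; rewrite mulrA.
  rewrite ler_wpM2r ?expR_ge0 //; apply: le_trans (ler_norm_sum _ _ _) _.
  by apply: ler_sum => i _; rewrite normrM (ger0_norm (exprn_ge0 _ (ltW u0))).
rewrite mulr_suml; apply: ler_sum => i _; rewrite -mulrA ler_wpM2l //.
have lu : 0 <= l * u by rewrite mulr_ge0 // ltW.
have := expR_ge1Dxn i.+1 lu; set F : R := (i.+2)`!%:R => H.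
have F0 : 0 < F by rewrite ltr0n fact_gt0.
have e0 : 0 < expR (l * u) by exact: expR_gt0.
have L0 : 0 < l ^+ i.+2 by exact: exprn_gt0.
have U2 : 0 < u ^+ 2 by exact: exprn_gt0.
have H2 : l ^+ i.+2 * (u ^+ i * u ^+ 2) <= F * expR (l * u).
  have : (l * u) ^+ i.+2 / F <= expR (l * u) by lra.
  by rewrite ler_pdivrMr // -exprD addn2 -exprMn (mulrC F).
rewrite expRN ler_pdivrMr // mulrAC ler_pdivlMr // mulrAC ler_pdivlMr //.
by apply: le_trans H2; rewrite le_eqVlt; apply/orP; left; apply/eqP; ring.
Qed.

Lemma bmp_bound (P : {poly R}) : exists2 C, 0 <= C & forall s, `|bmp P s| <= C * (s - a) ^+ 2.
Proof.
have [C C0 H] := poly_exp_bound P; exists C => // s; rewrite /bmp; case: ifPn => sa.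
  have u0 : 0 < (a - s)^-1 by rewrite invr_gt0 subr_gt0.
  by have := H _ u0; rewrite exprVn invrK -(sqrrN (s - a)) opprB.
by rewrite normr0 mulr_ge0 // sqr_ge0.
Qed.

(** With [u = 1 / (a - s)] one has [du/ds = u^2], so the prefactor [P] becomes [u^2 (P' - l P)]. *)
Definition dpoly (P : {poly R}) : {poly R} := 'X^2 * (P^`() - l *: P).

Lemma der_bmp (P : {poly R}) s : der (bmp P) s (1 : R) (bmp (dpoly P) s).
Proof.
case: (ltgtP s a) => sa.
- have E : \forall t \near s, P.[(a - t)^-1] * expR (- (l * (a - t)^-1)) = bmp P t.
    near=> t; rewrite /bmp ifT //; near: t; exact: lt_nbhsl.
  apply: (near_eq_is_derive E).
  have as0 : a - s != 0 by rewrite subr_eq0 gt_eqF.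
  have du : der (fun t => (a - t)^-1) s (1 : R) ((a - s) ^- 2).
    rewrite -[X in der _ _ _ X](_ : - (a - s) ^- 2 * (0 - 1) = _); last by ring.
    apply: (@der_inv (fun t => a - t)) => //.
    by apply: derD; [exact: der_cst|apply: derN; exact: der_id].
  have d1 : der (fun t => P.[(a - t)^-1]) s (1 : R) (P^`().[(a - s)^-1] * (a - s) ^- 2).
    by apply: (der_comp (g := horner P) du); exact: is_derive_poly.
  have d2 : der (fun t => expR (- (l * (a - t)^-1))) s (1 : R) (expR (- (l * (a - s)^-1)) * - (l * (a - s) ^- 2)).
    apply: (@der_comp R (fun t => - (l * (a - t)^-1)) expR); last exact: is_derive_expR.
    by apply: derN; apply: derZ.
  have := derM d1 d2; congr der.
  rewrite /bmp sa /dpoly hornerM hornerXn hornerD hornerN hornerZ -exprVn; ring.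
- have E : \forall t \near s, 0 = bmp P t.
    near=> t; rewrite /bmp ifF //; apply/negbTE; rewrite -leNgt ltW //; near: t; exact: lt_nbhsr.
  have -> : bmp (dpoly P) s = 0 by rewrite /bmp ifF // ltNge ltW.
  exact: (near_eq_is_derive E (der_cst _ _ _)).
(* At the junction the difference quotient is at most [C |h|], so the derivative is 0 from both
   sides. *)
- have [C C0 H] := bmp_bound P; rewrite sa.
  have b0 Q : bmp Q a = 0 by rewrite /bmp ltxx.
  rewrite b0; pose q h := h^-1 * bmp P (a + h).
  have q0 : q 0 = 0 by rewrite /q invr0 mul0r.
  have Hq h : `|q h| <= C * `|h|.
    have [->|h0] := eqVneq h 0; first by rewrite q0 normr0 mulr0.
    rewrite /q normrM normfV mulrC ler_pdivrMr ?normr_gt0 //.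
    by have := H (a + h); rewrite addrAC subrr add0r -real_normK ?num_real // expr2 mulrA.
  rewrite -[X in der _ _ _ X]q0; apply: der_slope.
    move=> h; rewrite b0 subr0 [h *: 1]mulr1 addrC /q mulrA.
    have [->|h0] := eqVneq h 0; first by rewrite addr0 b0 mulr0.
    by rewrite mulfV ?mul1r.
  rewrite /prop_for /continuous_at q0.
  apply/cvgrPdist_le => e e0.
  have cc : continuous (fun h : R => C * `|h|).
    by apply: cM; [exact: c_cst|apply: c_abs; exact: c_id].
  have /cvgrPdist_le/(_ e e0) := cc 0; apply: filterS => h.
  rewrite normr0 mulr0 !sub0r !normrN ger0_norm ?mulr_ge0 //.
  exact: le_trans.
Unshelve. all: by end_near. Qed.

Lemma c_bmp P : continuous (bmp P).
Proof. exact: (der_cont (der_bmp P)). Qed.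

Definition bumpf : R -> R := bmp 1.
Definition dbumpf : R -> R := bmp (dpoly 1).

Lemma bumpfE s : bumpf s = if s < a then expR (- (l * (a - s)^-1)) else 0.
Proof. by rewrite /bumpf /bmp hornerC mul1r. Qed.

Lemma dbumpfE s : dbumpf s = if s < a then - (l * (a - s) ^- 2 * expR (- (l * (a - s)^-1))) else 0.
Proof.
rewrite /dbumpf /bmp; case: ifP => // _.
by rewrite /dpoly derivC sub0r hornerM hornerXn hornerN hornerZ hornerC -exprVn; ring.
Qed.

Lemma dbumpf_le0 s : 0 <= - dbumpf s.
Proof.
rewrite dbumpfE; case: ifP => _; rewrite ?oppr0 // opprK.
by rewrite !mulr_ge0 ?expR_ge0 ?invr_ge0 ?sqr_ge0 // ltW.
Qed.

(** Paired with the quadratic remainder of [compact_ctrl], the derivative contributes only [O(l)]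
    away from [a]. *)
Lemma dbumpf_sq s : - dbumpf s * (s - a) ^+ 2 <= l.
Proof.
rewrite dbumpfE; case: ifP => sa; last by rewrite oppr0 mul0r ltW.
have as0 : a - s != 0 by rewrite subr_eq0 gt_eqF.
have -> : - - (l * (a - s) ^- 2 * expR (- (l * (a - s)^-1))) * (s - a) ^+ 2 = l * expR (- (l * (a - s)^-1)).
  by field.
rewrite ler_piMr ?(ltW l0) // -expR0 ler_expR oppr_le0 mulr_ge0 ?(ltW l0) // invr_ge0 subr_ge0 ltW //.
Qed.

End Bump.

(** * From the weak equation to an integral equation in time *)

Section DuBois.
Variable R : realType.

(* With -bumpf' = l (a - s)^-2 exp (- l / (a - s)) concentrating at a as l -> 0,
   the weak equation is evaluated at time a. *)
Lemma weak_integral (T hin : R) (h G : R -> R) : 0 < T -> continuous h -> continuous G ->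
  (forall a l, 0 < a < T -> 0 < l ->
    - (hin * bumpf a l 0) - J 0 T (fun s => dbumpf a l s * h s) = J 0 T (fun s => bumpf a l s * G s)) ->
  forall t, 0 <= t <= T -> h t = hin + J 0 t G.
Proof.
move=> T0 ch cG Hw; have [F dF] := prim_ex cG; have cF := der_cont dF.
pose H s := h s - F s + (F 0 - hin).
have cH : continuous H by rewrite /H; cont.
suff H0 t : 0 <= t <= T -> H t = 0.
  move=> t tT; have /andP[t0 _] := tT; rewrite (J_prim t0 cG dF).
  by have := H0 t tT; rewrite /H; lra.
have main a : 0 < a < T -> H a = 0.
  move=> /andP[a0 aT]; have T0' := ltW T0.
  (* Integration by parts moves the source onto its primitive [F]; the constant in [H] absorbs the
     boundary terms at 0, and at [T] the bump vanishes. *)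
  have key l : 0 < l -> J 0 T (fun s => dbumpf a l s * H s) = 0.
    move=> l0; have ce : continuous (bumpf a l) := @c_bmp R a l l0 1.
    have cd : continuous (dbumpf a l) := @c_bmp R a l l0 (dpoly l 1).
    have de s : der (bumpf a l) s (1 : R) (dbumpf a l s) := der_bmp a l0 1 s.
    have eT : bumpf a l T = 0 by rewrite bumpfE ifF // ltNge ltW.
    have E1 : J 0 T (dbumpf a l) = - bumpf a l 0 by rewrite (J_prim T0' cd de) eT sub0r.
    have E2 : J 0 T (fun s => dbumpf a l s * F s + bumpf a l s * G s) = - (bumpf a l 0 * F 0).
      rewrite (J_prim T0' _ (fun s => derM (de s) (dF s))); last by cont.
      by rewrite eT mul0r sub0r.
    rewrite JD in E2; [|by cont|by cont].
    have E3 := Hw a l _ l0; rewrite a0 aT in E3; have {}E3 := E3 isT.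
    rewrite (_ : J 0 T _ = J 0 T (fun s => dbumpf a l s * h s + ((- 1) * (dbumpf a l s * F s) + (F 0 - hin) * dbumpf a l s))); last first.
      by apply: J_ext => s _; rewrite /H; ring.
    rewrite JD; [|by cont|by cont]; rewrite JD; [|by cont|by cont].
    rewrite (@JZ R 0 T (-1)); last by cont.
    rewrite (JZ 0 T (F 0 - hin) cd) E1.
    by move: E2 E3; set X := J 0 T _; set Y := J 0 T _; set Z := J 0 T _; lra.
  suff : forall e, 0 < e -> `|H a| <= e.
    move=> He; apply/eqP; rewrite -normr_le0; apply/ler_addgt0Pr => e e0; rewrite add0r; exact: He.
  move=> e e0; have e4 : 0 < e / 4 by rewrite divr_gt0.
  have [C C0 HC] : exists2 C, 0 <= C & forall s, timeI 0 T s -> `|H s - H a| <= e / 4 + C * (s - a) ^+ 2.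
    apply: (@compact_ctrl R R (timeI 0 T) (fun s => `|H s - H a|) (fun s => (s - a) ^+ 2)) => //.
    - exact: timeI_compact.
    - by cont.
    - by cont.
    - by move=> s; exact: sqr_ge0.
    - by move=> s _ /eqP; rewrite sqrf_eq0 subr_eq0 => /eqP ->; rewrite subrr normr0.
  (* The first bound keeps the bump at least [1/2] at time 0, the second makes [C l T <= e / 4];
     together they give [|H a| / 2 <= e / 4 + e / 4]. *)
  pose l := Num.min (a / 2) (e / 4 / (C * T + 1)).
  have CT : 0 < C * T + 1 by rewrite ltr_wpDl // mulr_ge0.
  have l0 : 0 < l by rewrite /l lt_min !divr_gt0.
  have l1 : l <= a / 2 by rewrite /l ge_min lexx.
  have l2 : C * l * T <= e / 4.
    have : l <= e / 4 / (C * T + 1) by rewrite /l ge_min lexx orbT.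
    rewrite ler_pdivlMr // => HH; apply: le_trans HH.
    by rewrite mulrDr mulr1 mulrAC (mulrC _ l) lerDl ltW.
  have ce : continuous (bumpf a l) := @c_bmp R a l l0 1.
  have cd : continuous (dbumpf a l) := @c_bmp R a l l0 (dpoly l 1).
  have de s : der (bumpf a l) s (1 : R) (dbumpf a l s) := der_bmp a l0 1 s.
  have eT : bumpf a l T = 0 by rewrite bumpfE ifF // ltNge ltW.
  have e00 : 1 / 2 <= bumpf a l 0.
    rewrite bumpfE a0 subr0; apply: le_trans (expR_ge1Dx _).
    have : l * a^-1 <= 1 / 2 by rewrite ler_pdivrMr //; lra.
    lra.
  have e01 : bumpf a l 0 <= 1.
    by rewrite bumpfE a0 subr0 -expR0 ler_expR oppr_le0 divr_ge0 // ltW.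
  have E1 : J 0 T (fun s => - dbumpf a l s) = bumpf a l 0.
    have : J 0 T (fun s => - dbumpf a l s) = - J 0 T (dbumpf a l).
      by rewrite -mulN1r -JZ //; apply: J_ext => s _; rewrite mulN1r.
    by rewrite (J_prim T0' cd de) eT sub0r opprK.
  have K : H a * bumpf a l 0 = J 0 T (fun s => - dbumpf a l s * (H a - H s)).
    rewrite -E1 -JZ; last by cont.
    transitivity (J 0 T (fun s => H a * - dbumpf a l s + dbumpf a l s * H s)).
      by rewrite JD ?key ?addr0 //; cont.
    by apply: J_ext => s _; ring.
  have B : `|J 0 T (fun s => - dbumpf a l s * (H a - H s))| <= e / 4 * bumpf a l 0 + C * l * T.
    have up s : timeI 0 T s -> `|- dbumpf a l s * (H a - H s)| <= e / 4 * - dbumpf a l s + C * l.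
      move=> sT; rewrite normrM (ger0_norm (dbumpf_le0 a l0 s)) distrC.
      apply: le_trans (ler_wpM2l (dbumpf_le0 a l0 s) (HC s sT)) _.
      rewrite mulrDr (mulrC _ (e / 4)) lerD2l mulrCA ler_wpM2l //.
      exact: dbumpf_sq.
    rewrite -E1 -JZ; last by cont.
    have -> : C * l * T = J 0 T (fun _ => C * l) by rewrite J_cst // subr0.
    rewrite -JD; [|by cont|by cont].
    rewrite ler_norml; apply/andP; split.
      rewrite lerNl -mulN1r -JZ; last by cont.
      apply: J_le; [by cont|by cont|move=> s sT]; rewrite mulN1r.
      by apply: le_trans (up s sT); rewrite -normrN ler_norm.
    apply: J_le; [by cont|by cont|move=> s sT].
    by apply: le_trans (up s sT); exact: ler_norm.
  rewrite -K normrM (ger0_norm (le_trans _ e00)) in B; last by lra.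
  have n0 := normr_ge0 (H a); nra.
move=> /andP[t0 tT].
(* The concentration point has to lie strictly inside [(0, T)], so the end points are reached by
   continuity of [H]. *)
have clos b : (forall d, 0 < d -> exists2 s, 0 < s < T & `|b - s| < d) -> H b = 0.
  move=> Hb; apply/eqP; rewrite -normr_le0; apply/ler_addgt0Pr => e e0; rewrite add0r.
  have /cvgrPdist_lt/(_ e e0) := cH b; move=> /nbhs_ballP [d d0 Hd].
  have [s sT bs] := Hb d d0.
  by have := Hd s bs; rewrite (main s sT) subr0 => /ltW.
move: t0; rewrite le_eqVlt => /predU1P[<-|t0].
  apply: clos => d d0; exists (Num.min (d / 2) (T / 2)).
    by rewrite lt_min gt_min !divr_gt0 //=; apply/orP; right; lra.
  rewrite sub0r normrN ger0_norm; last by rewrite le_min !divr_ge0 // ltW.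
  by rewrite gt_min; apply/orP; left; lra.
move: tT; rewrite le_eqVlt => /predU1P[->|tT]; last by apply: main; rewrite t0.
apply: clos => d d0; exists (T - Num.min (d / 2) (T / 2)).
  have h1 : Num.min (d / 2) (T / 2) <= T / 2 by rewrite ge_min lexx orbT.
  have h2 : 0 < Num.min (d / 2) (T / 2) by rewrite lt_min !divr_gt0.
  lra.
rewrite opprB addrCA subrr addr0 ger0_norm; last by rewrite le_min !divr_ge0 // ltW.
by rewrite gt_min; apply/orP; left; lra.
Qed.

End DuBois.

(** * Smoothness of the test functions *)

Section Smooth.
Variable R : realType.
Local Notation pt := 'rV[R]_3.

(** A coinductive principle: a class of continuous, derivable functions that contains its first
    derivatives contains all iterated ones. *)
Lemma smooth_class (C : (pt -> R -> R) -> Prop) :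
  (forall f, C f -> [/\ continuous (fun p : pt * R => f p.1 p.2),
     forall d x s, derivable_dir d f x s & forall d, C (dirD d f)]) ->
  forall f, C f -> smooth_xt f.
Proof.
move=> HC f Cf l; have Cl : C (Defs.iterD l f).
  by elim: l => //= d l IH; case: (HC _ IH) => _ _; exact.
by case: (HC _ Cl).
Qed.

Lemma smooth_TP Q (A : pt -> R) : TP Q A -> smooth_x A.
Proof.
move=> TA; apply: (@smooth_class (fun f => exists2 A, TP Q A & f = (fun x _ => A x))); last by exists A.
move=> _ [B TB ->]; have cB := TP_cont TB; split.
- by cont.
- move=> [i|] x s /=; last exact: derivable_cst.
  by have [dB _ Hd] := TP_pdv i TB; exact: der_ex (Hd x).
- move=> [i|].
    have [dB Td Hd] := TP_pdv i TB; exists dB => //.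
    by apply: funext => x; apply: funext => s /=; exact: pdv_val.
  exists (fun _ => 0); first exact: TP0.
  by apply: funext => x; apply: funext => s /=; exact: derive_cst.
Qed.

Lemma smooth_bmp Q (A : pt -> R) (a l : R) P : 0 < l -> TP Q A -> smooth_xt (fun x s => A x * bmp a l P s).
Proof.
move=> l0 TA.
apply: (@smooth_class (fun f => exists A P, TP Q A /\ f = (fun x s => A x * bmp a l P s))); last by exists A, P.
move=> _ [B [P' [TB ->]]]; have cB := TP_cont TB; have cb := @c_bmp R a l l0 P'.
have D1 i : exists2 dB, TP Q dB & forall s, pdv i (fun x => B x * bmp a l P' s) (fun x => dB x * bmp a l P' s).
  have [dB Td Hd] := TP_pdv i TB; exists dB => // s x.
  rewrite -[X in der _ _ _ X]addr0 -(mulr0 (B x)).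
  by apply: derM; [exact: Hd|exact: der_cst].
have D2 x s : der (fun s => B x * bmp a l P' s) s (1 : R) (B x * bmp a l (dpoly l P') s).
  by apply: derZ; exact: der_bmp.
split.
- by cont.
- move=> [i|] x s /=; last exact: der_ex (D2 x s).
  by have [dB _ Hd] := D1 i; exact: der_ex (Hd s x).
- move=> [i|].
    have [dB Td Hd] := D1 i; exists dB, P'; split => //.
    by apply: funext => x; apply: funext => s /=; exact: (pdv_val x (Hd s)).
  exists B, (dpoly l P'); split => //.
  by apply: funext => x; apply: funext => s /=; exact: der_val (D2 x s).
Qed.

End Smooth.

(** * Balance laws for the regularised solution *)

Section Aux.
Variable R : realType.
Local Notation pt := 'rV[R]_3.

(** A nonzero value would persist on an interval of positive length, which a null set cannot
    contain. *)
Lemma ae_cont0 (T : R) (g : R -> R) : 0 < T -> continuous g -> ae_on T (fun t => g t = 0) ->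
  forall t, 0 <= t <= T -> g t = 0.
Proof.
move=> T0 cg [N [[A [mA A0 NA]] HN]] t /andP[t0 tT]; apply/eqP; apply: contraPT (A0) => gt.
have [d d0 Hd] : exists2 d, 0 < d & forall s, `|t - s| < d -> g s <> 0.
  have e0 : 0 < `|g t| by rewrite normr_gt0.
  have /cvgrPdist_lt/(_ _ e0) := cg t; move=> /nbhs_ballP [d d0 H]; exists d => // s ts gs.
  by have := H s ts; rewrite gs subr0 ltxx.
(* The interval extends from [t] towards the farther end of [[0, T]], so that it stays inside even
   when [t] is an end point. *)
have [c [e [ce cT eT tc te]]] : exists c e, [/\ c < e, 0 <= c, e <= T, t - d < c & e < t + d].
  have [h|h] := leP t (T / 2).
    by exists t, (Num.min (t + d / 2) T); rewrite lt_min gt_min ge_min; split => //;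
      rewrite ?lexx ?orbT //; [apply/andP; split; lra|lra|apply/orP; left; lra].
  exists (Num.max (t - d / 2) 0), t; rewrite gt_max le_max lt_max; split => //;
    rewrite ?lexx ?orbT //; [apply/andP; split; lra|apply/orP; left; lra|lra].
have sub : `[c, e]%classic `<=` A.
  move=> s; rewrite /= in_itv /= => /andP[cs se].
  have [Ns|Ns] := pselect (N s); first exact: NA.
  exfalso; apply: (@Hd s); last by apply: HN => //; apply/andP; split; lra.
  by rewrite ltr_norml; apply/andP; split; lra.
have : ((@lebesgue_measure R) `[c, e]%classic <= (@lebesgue_measure R) A)%E.
  by apply: le_measure => //; rewrite inE.
rewrite lebesgue_measure_itv /= lte_fin ce => H AE; move: H; rewrite AE -EFinD lee_fin; lra.
Qed.

Definition jgrad N i : pt -> R := fun x => 'D_(e3 R i) (jack N) x.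

Lemma jgradP N i : [/\ pdv i (jack N) (jgrad N i), continuous (jgrad N i) & periodic3 (jgrad N i)].
Proof.
have [df Td Hd] := TP_pdv i (TP_jack R N).
have -> : jgrad N i = df by apply: funext => x; exact: pdv_val.
by split => //; [exact: TP_cont Td|apply: TP_per Td => k []].
Qed.

Lemma gradN_E N f i x : continuous f -> periodic3 f ->
  gradN N f i x = I3 (fun y => jgrad N i (x - y) * f y).
Proof.
move=> cf pf; have [Hd cd _] := jgradP N i.
apply: (@pdv_val R i _ (fun x => I3 (fun y => jgrad N i (x - y) * f y))).
apply: (pdv_cvK _ _ _ cd cf pf Hd); [exact: c_jack|exact: jack_per|exact: jack_even].
Qed.

(** With the derivative carried by the kernel, joint continuity of [f] alone is enough. *)
Lemma c_gradN (X : topologicalType) N i (f : X -> pt -> R) :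
  continuous (fun p : X * pt => f p.1 p.2) -> (forall z, periodic3 (f z)) ->
  continuous (fun p : X * pt => gradN N (f p.1) i p.2).
Proof.
move=> cf pf; have [_ cd _] := jgradP N i.
have -> : (fun p : X * pt => gradN N (f p.1) i p.2) =
    (fun p => I3 (fun y => jgrad N i (p.2 - y) * f p.1 y)).
  by apply: funext => p; rewrite gradN_E //; exact: c_slice.
by apply: (@I3_param R (X * pt)%type (fun p y => jgrad N i (p.2 - y) * f p.1 y)); cont.
Qed.

Lemma pdv_jrefl N i x : pdv i (fun y => jack N (x - y)) (fun y => - jgrad N i (x - y)).
Proof.
have [Hd cd _] := jgradP N i; move=> y; apply/der_line.
have := pdv_line (x - y) 0 Hd; rewrite scale0r addr0 => H.
have := @der_comp R (fun s => - s) (fun s => jack N (x - y + s *: e3 R i)) 0 (-1) (jgrad N i (x - y)).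
rewrite oppr0 mulrN1 => H2; have := H2 (derN (der_id 0)) H.
by congr der; apply: funext => s; rewrite scaleNr opprD addrA addrAC.
Qed.

(** Each regularisation of [f] lies between 0 and the maximum of the kernel times the zero integral
    of [f], hence vanishes; the regularisations converge to [f]. *)
Lemma I3_eq0 (f : pt -> R) : continuous f -> periodic3 f -> (forall x, 0 <= f x) -> I3 f = 0 ->
  forall x, f x = 0.
Proof.
move=> cf pf f0 If x; apply/eqP; rewrite -normr_le0; apply/ler_addgt0Pr => e e0; rewrite add0r.
have cF : continuous (fun p : pt * R => f p.1) by cont.
have [N0 /(_ N0.+1 (leqnSn _) isT 0 x)] := @cv_unif R 1 (fun x _ => f x) e cF (fun=> pf) e0.
rewrite lexx ler01 => /(_ isT).
have cj := @c_jack R N0.+1.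
have [M HM] := per_bounded cj (@jack_per R N0.+1).
suff -> : cv (jack N0.+1) f x = 0 by rewrite sub0r normrN.
apply/eqP; rewrite eq_le; apply/andP; split; last first.
  by apply: I3_ge0 => y; apply: mulr_ge0 => //; exact: jack_ge0.
apply: (@le_trans _ _ (I3 (fun y => M * f (x + y)))).
  apply: I3_le; [by cont|by cont|move=> y _]; apply: ler_wpM2r => //.
  by apply: le_trans (HM y); exact: ler_norm.
rewrite I3Z; last by cont.
rewrite (_ : I3 _ = I3 (fun y => f (y + x))); last by apply: I3_ext => y _; rewrite addrC.
by rewrite I3_shift // If mulr0.
Qed.

Lemma cv_inj (f g : pt -> R) : continuous f -> periodic3 f -> continuous g -> periodic3 g ->
  (forall N x, cv (jack N) f x = cv (jack N) g x) -> forall x, f x = g x.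
Proof.
move=> cf pf cg pg H x; apply/eqP; rewrite -subr_eq0 -normr_le0; apply/ler_addgt0Pr => e e0; rewrite add0r.
have cF : continuous (fun p : pt * R => f p.1 - g p.1) by cont.
have pF : forall s : R, periodic3 (fun x => f x - g x) by move=> s y i; rewrite pf pg.
have [N0 /(_ N0.+1 (leqnSn _) isT 0 x)] := @cv_unif R 1 (fun x _ => f x - g x) e cF pF e0.
rewrite lexx ler01 => /(_ isT); rewrite cvB //; last exact: c_jack.
by rewrite H subrr sub0r normrN.
Qed.

Lemma c_flux N (bpp : R -> R) (v : 'I_3 -> pt -> R -> R) (f : pt -> R -> R) : continuous bpp ->
  (forall i, continuous (fun p : pt * R => v i p.1 p.2)) -> continuous (fun p : pt * R => f p.1 p.2) ->
  (forall s, periodic3 (f^~ s)) -> continuous (fun s => flux (fun i => (v i)^~ s) bpp N (f^~ s)).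
Proof.
move=> cb cvv cf pf; have cj := @c_jack R N.
have cf' : continuous (fun p : R * pt => f p.2 p.1) by cont.
have c1 := @cv_joint R R (jack N) (fun s x => f x s) cj cf'.
have c2 i := @c_gradN R N i (fun s x => f x s) cf' pf.
rewrite /flux; apply: c_sum => i.
have c3 : continuous (fun p : R * pt => cv (jack N) (fun y => v i y p.1 * f y p.1) p.2).
  by apply: (@cv_joint R R (jack N) (fun s y => v i y s * f y s) cj); cont.
apply: (@I3_param R R (fun s x => bpp (cv (jack N) (f^~ s) x) * gradN N (f^~ s) i x *
  cv (jack N) (fun y => v i y s * f y s) x)).
have c2i := c2 i.
apply: cM => //; apply: cM => //; exact: (c_comp cb c1).
Qed.

End Aux.

(** * Equations satisfied by a globally continuous weak solution *)

Section Sol.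
Variable R : realType.
Local Notation pt := 'rV[R]_3.
Variables (T : R) (vin : 'I_3 -> pt -> R) (thin : pt -> R) (v : 'I_3 -> pt -> R -> R) (th : pt -> R -> R).
Hypothesis T0 : 0 < T.
Hypothesis wsol : weak_solution T vin thin v th.
Hypothesis cvv : forall i, continuous (fun p : pt * R => v i p.1 p.2).
Hypothesis pvv : forall i s, periodic3 ((v i)^~ s).
Hypothesis cth : continuous (fun p : pt * R => th p.1 p.2).
Hypothesis pth : forall s, periodic3 (th^~ s).

Let cvs i s : continuous ((v i)^~ s).
Proof. by have cvi := @cvv i; cont. Qed.

Let cths s : continuous (th^~ s).
Proof. by cont. Qed.

Lemma JI3 a b (F : R -> pt -> R) :
  J a b (fun s => I3 (F s)) = \int[@lebesgue_measure R]_(s in timeI a b) intT3 (F s).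
Proof. by rewrite JE; congr Rintegral; apply: funext => s; rewrite I3E. Qed.

Lemma weak_scalar phi : test_scalar T phi ->
  - I3 (fun x => thin x * phi x 0) - J 0 T (fun s => I3 (fun x => dt phi x s * th x s))
  = J 0 T (fun s => I3 (fun x => (\sum_(i < 3) v i x s * dx i phi x s) * th x s)).
Proof.
have [_ [_ [_ [_ [_ [_ [_ H]]]]]]] := wsol.
by move=> /H; rewrite I3E !JI3.
Qed.

Lemma weak_vector phi : test_vector T phi ->
  - I3 (fun x => \sum_(i < 3) vin i x * phi i x 0)
  - J 0 T (fun s => I3 (fun x => \sum_(i < 3) dt (phi i) x s * v i x s))
  = J 0 T (fun s => I3 (fun x => \sum_(i < 3) \sum_(j < 3) dx j (phi i) x s * (v i x s * v j x s)
          + th x s * phi ord_max x s)).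
Proof.
have [_ [_ [_ [_ [_ [_ [H _]]]]]]] := wsol.
by move=> /H; rewrite I3E !JI3.
Qed.

Lemma smooth_cont (g : pt -> R) : smooth_x g -> continuous g.
Proof.
move=> /(_ [::]) [c _]; have c' : continuous (fun p : pt * R => g p.1) := c.
by apply: (@c_comp R pt (pt * R)%type _ (fun x => (x, 0))  c'); cont.
Qed.

Lemma smooth_pdv (g : pt -> R) i : smooth_x g -> pdv i g (dx0 i g) /\ continuous (dx0 i g).
Proof.
move=> sg; split.
  move=> x; have [_ /(_ (Some i) x 0) H] := sg [::]; split => //.
have [c _] := sg [:: Some i].
have c' : continuous (fun p : pt * R => dx0 i g p.1) := c.
by apply: (@c_comp R pt (pt * R)%type _ (fun x => (x, 0)) c'); cont.
Qed.

Lemma cvin i : continuous (vin i).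
Proof. by have [H _] := wsol; exact: smooth_cont (H i).1. Qed.

Lemma pvin i : periodic3 (vin i).
Proof. by have [H _] := wsol; exact: (H i).2. Qed.

Lemma cthin : continuous thin.
Proof. by have [_ [[H _] _]] := wsol; exact: smooth_cont. Qed.

Lemma pthin : periodic3 thin.
Proof. by have [_ [[_ H] _]] := wsol. Qed.

Lemma scalar_eq b (A : pt -> R) (dA : 'I_3 -> pt -> R) t : TP (Qc b) A -> (forall i, pdv i A (dA i)) ->
  (forall i, continuous (dA i)) -> 0 <= t <= T ->
  I3 (fun x => A x * th x t) = I3 (fun x => thin x * A x) +
    J 0 t (fun s => I3 (fun x => (\sum_(i < 3) v i x s * dA i x) * th x s)).
Proof.
move=> TA HA cdA tT; have cA := TP_cont TA; have ct := cthin.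
apply: (@weak_integral R T _ (fun t => I3 (fun x => A x * th x t))) => //.
- by apply: (@I3_param R R (fun s x => A x * th x s)); cont.
- by apply: (@I3_param R R (fun s x => (\sum_(i < 3) v i x s * dA i x) * th x s)); cont.
move=> a l /andP[a0 aT] l0.
pose phi x s := A x * bumpf a l s.
have Ht : test_scalar T phi.
  split; first exact: smooth_bmp TA.
  split; first by move=> s x i; rewrite /phi (TP_per _ TA) // => k [].
  by exists a; split => // x s sa; rewrite /phi bumpfE ifF ?mulr0 // ltNge sa.
have := weak_scalar Ht.
have E1 x s : dt phi x s = A x * dbumpf a l s.
  by apply: (@der_val R R); apply: derZ; exact: der_bmp.
have E2 i x s : dx i phi x s = dA i x * bumpf a l s.
  apply: (@pdv_val R i (fun x => A x * bumpf a l s) (fun x => dA i x * bumpf a l s)) => y.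
  rewrite -[X in der _ _ _ X]addr0 -(mulr0 (A y)).
  by apply: derM; [exact: HA|exact: der_cst].
have -> : I3 (fun x => thin x * phi x 0) = I3 (fun x => thin x * A x) * bumpf a l 0.
  rewrite mulrC -I3Z; last by cont.
  by apply: I3_ext => x _; rewrite /phi; ring.
have -> : J 0 T (fun s => I3 (fun x => dt phi x s * th x s)) =
    J 0 T (fun s => dbumpf a l s * I3 (fun x => A x * th x s)).
  apply: J_ext => s _; rewrite -I3Z; last by cont.
  by apply: I3_ext => x _; rewrite E1; ring.
move=> ->; apply: J_ext => s _; rewrite -I3Z; last by cont.
apply: I3_ext => x _; rewrite mulrA mulr_sumr; congr (_ * _).
by apply: eq_bigr => i _; rewrite E2; ring.
Qed.

(** The time factor of the test field is common to the three components, so the divergence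
    constraint falls on [A] alone. *)
Lemma vector_eq b (A : 'I_3 -> pt -> R) (dA : 'I_3 -> 'I_3 -> pt -> R) t :
  (forall i, TP (Qc b) (A i)) -> (forall i j, pdv j (A i) (dA i j)) ->
  (forall i j, continuous (dA i j)) -> (forall x, \sum_(i < 3) dA i i x = 0) -> 0 <= t <= T ->
  I3 (fun x => \sum_(i < 3) A i x * v i x t) = I3 (fun x => \sum_(i < 3) vin i x * A i x) +
    J 0 t (fun s => I3 (fun x => \sum_(i < 3) \sum_(j < 3) dA i j x * (v i x s * v j x s)
      + th x s * A ord_max x)).
Proof.
move=> TA HA cdA dv tT; have cA i := TP_cont (TA i); have ci := cvin.
have cdA2 : continuous (fun p : pt * R => \sum_(i < 3) \sum_(j < 3) dA i j p.1 * (v i p.1 p.2 * v j p.1 p.2)).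
  by apply: c_sum => i; apply: c_sum => j; have := cdA i j => cij; cont.
have cF2 : continuous (fun p : R * pt => \sum_(i < 3) \sum_(j < 3) dA i j p.2 * (v i p.2 p.1 * v j p.2 p.1)
      + th p.2 p.1 * A ord_max p.2).
  apply: cD; last by cont.
  apply: (@c_comp R (R * pt)%type (pt * R)%type _ (fun p => (p.2, p.1)) cdA2); cont.
apply: (@weak_integral R T _ (fun t => I3 (fun x => \sum_(i < 3) A i x * v i x t))) => //.
- by apply: (@I3_param R R (fun s x => \sum_(i < 3) A i x * v i x s)); cont.
- exact: (@I3_param R R (fun s x => \sum_(i < 3) \sum_(j < 3) dA i j x * (v i x s * v j x s)
      + th x s * A ord_max x) cF2).
move=> a l /andP[a0 aT] l0.
pose phi i x s := A i x * bumpf a l s.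
have E2 i j x s : dx j (phi i) x s = dA i j x * bumpf a l s.
  apply: (@pdv_val R j (fun x => A i x * bumpf a l s) (fun x => dA i j x * bumpf a l s)) => y.
  rewrite -[X in der _ _ _ X]addr0 -(mulr0 (A i y)).
  by apply: derM; [exact: HA|exact: der_cst].
have Ht : test_vector T phi.
  split.
    move=> i; split; first exact: smooth_bmp (TA i).
    by move=> s x j; rewrite /phi (TP_per _ (TA i)) // => k [].
  split; first by exists a; split => // i x s sa; rewrite /phi bumpfE ifF ?mulr0 // ltNge sa.
  by move=> x s _; under eq_bigr do rewrite E2; rewrite -mulr_suml dv mul0r.
have := weak_vector Ht.
have E1 i x s : dt (phi i) x s = A i x * dbumpf a l s.
  by apply: (@der_val R R); apply: derZ; exact: der_bmp.
have -> : I3 (fun x => \sum_(i < 3) vin i x * phi i x 0) = I3 (fun x => \sum_(i < 3) vin i x * A i x) * bumpf a l 0.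
  rewrite mulrC -I3Z; last by cont.
  by apply: I3_ext => x _; rewrite mulr_sumr; apply: eq_bigr => i _; rewrite /phi; ring.
have -> : J 0 T (fun s => I3 (fun x => \sum_(i < 3) dt (phi i) x s * v i x s)) =
    J 0 T (fun s => dbumpf a l s * I3 (fun x => \sum_(i < 3) A i x * v i x s)).
  apply: J_ext => s _; rewrite -I3Z; last by cont.
  by apply: I3_ext => x _; rewrite mulr_sumr; apply: eq_bigr => i _; rewrite E1; ring.
move=> ->; apply: J_ext => s _; rewrite -I3Z; last exact: (@c_slice R R pt (fun s x => _) s cF2).
apply: I3_ext => x _; rewrite mulrDr mulr_sumr; congr (_ + _); last by rewrite /phi; ring.
by apply: eq_bigr => i _; rewrite mulr_sumr; apply: eq_bigr => j _; rewrite E2; ring.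
Qed.

(** Testing incompressibility with [y] mapped to [jack N (x - y)] gives the claim at almost every
    time; continuity in time gives it at all times. *)
Lemma div_free N t x : 0 <= t <= T -> \sum_(i < 3) gradN N ((v i)^~ t) i x = 0.
Proof.
move: t; apply: (ae_cont0 T0).
  apply: c_sum => i; have cvi := @cvv i.
  have c1 : continuous (fun p : R * pt => v i p.2 p.1) by cont.
  have c2 := @c_gradN R R N i (fun s x => v i x s) c1 (pvv i).
  by apply: (@c_comp R R (R * pt)%type _ (fun s => (s, x)) c2); cont.
have [_ [_ [_ [_ [_ [[Z [nZ HZ]] _]]]]]] := wsol.
exists Z; split => // t tT Zt; have := HZ t tT Zt (fun y => jack N (x - y)).
have TJ := TP_refl x (TP_jack R N).
have PJ : periodic3 (fun y => jack N (x - y)) by apply: TP_per TJ => k [].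
move=> /(_ (smooth_TP TJ) PJ); rewrite -I3E.
have cg i : continuous (@jgrad R N i) by have [_ c _] := jgradP R N i; exact: c.
have -> : I3 (fun y => \sum_(i < 3) v i y t * dx0 i (fun y => jack N (x - y)) y) =
  - \sum_(i < 3) gradN N ((v i)^~ t) i x.
  rewrite -sumrN; transitivity (\sum_(i < 3) I3 (fun y => - (jgrad N i (x - y) * v i y t))).
    rewrite -I3_sum; last first.
      by move=> i; have ci := @cvs i t; have cgi := cg i; cont.
    apply: I3_ext => y _; apply: eq_bigr => i _; rewrite /dx0 (pdv_val y (pdv_jrefl N i x)); ring.
  apply: eq_bigr => i _; rewrite gradN_E //.
  by rewrite I3N //; have ci := @cvs i t; have cgi := cg i; cont.
by move=> /eqP; rewrite oppr_eq0 => /eqP.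
Qed.

Lemma J00 (f : R -> R) : J 0 0 f = 0.
Proof. by rewrite JE timeIE set_itv1 Rintegral_set1. Qed.

Lemma gradN_cv N i (f : pt -> R) : continuous f -> periodic3 f -> pdv i (cv (jack N) (cv (jack N) f)) (cv (jack N) (gradN N f i)).
Proof.
move=> cf pf; have cj := @c_jack R N; have [Hd cd _] := gradP N i cf pf.
by apply: pdv_cv => //; exact: cv_cont.
Qed.

Lemma cv_sum K n (F : 'I_n -> pt -> R) x : continuous K -> (forall i, continuous (F i)) ->
  \sum_(i < n) cv K (F i) x = cv K (fun x => \sum_(i < n) F i x) x.
Proof.
move=> cK cF; rewrite /cv -I3_sum; last by move=> i; cont.
by apply: I3_ext => y _; rewrite mulr_sumr.
Qed.

(** The weak equation at time 0 sees only divergence-free fields. The difference [w] of the two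
    initial velocities is itself divergence free, so its double regularisation is an admissible test
    field and self-adjointness yields the squared norm of the regularised [w]. *)
Lemma v_init i x : v i x 0 = vin i x.
Proof.
have ci := cvin; have c0 j := @cvs j 0; have pin := pvin.
pose w j x := v j x 0 - vin j x.
have cw j : continuous (w j) by have cj := c0 j; rewrite /w; cont.
have pw j : periodic3 (w j) by move=> y k; rewrite /w pvv pin.
suff H : forall j x, w j x = 0 by have := H i x; rewrite /w; lra.
move=> j; have t00 : (0 : R) <= 0 <= T by rewrite lexx ltW.
apply: (@cv_inj R (w j) (fun _ => 0)) => //; first by cont.
move=> N; have cj := @c_jack R N; have pj := @jack_per R N; have ej := @jack_even R N.
have cN k := cv_cont cj (cw k); have pN k := cv_per (jack N) (pw k).
have gP k l := gradP N l (cw k) (pw k).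
have gd y : \sum_(k < 3) gradN N (w k) k y = 0.
  have E k : gradN N (w k) k y = gradN N ((v k)^~ 0) k y - cv (jack N) (dx0 k (vin k)) y.
    have [_ [_ [_ _]]] := wsol; have [H _] := wsol; have [Hd cd] := smooth_pdv k (H k).1.
    have [H1 _ _] := gradP N k (c0 k) (pvv k 0).
    apply: (@pdv_val R k _ (fun y => gradN N ((v k)^~ 0) k y - cv (jack N) (dx0 k (vin k)) y)).
    apply: (@pdv_ext R k (fun y => cv (jack N) ((v k)^~ 0) y - cv (jack N) (vin k) y)).
      by move=> z; rewrite -cvB.
    by apply: pdvD => //; apply: pdvN; exact: pdv_cv.
  under eq_bigr do rewrite E; rewrite big_split /= div_free // add0r sumrN.
  have [H [_ [dv _]]] := wsol; rewrite cv_sum //; last by move=> k; have [_ c] := smooth_pdv k (H k).1; exact: c.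
  rewrite (_ : cv _ _ _ = 0) ?oppr0 // -[RHS](I3_cst 0); apply: I3_ext => z _.
  by rewrite dv mulr0.
have TA k : TP (Qc (fun _ => 2 * N%:R)) (cv (jack N) (cv (jack N) (w k))) by exact: TP_cvj.
have := vector_eq TA (fun k l => @gradN_cv N l (w k) (cw k) (pw k)) _ _ t00.
rewrite J00 addr0 => H.
have {}H : \sum_(k < 3) I3 (fun x => cv (jack N) (w k) x ^+ 2) = 0.
  transitivity (\sum_(k < 3) I3 (fun x => cv (jack N) (cv (jack N) (w k)) x * w k x)).
    by apply: eq_bigr => k _; rewrite cv_adj //; apply: I3_ext => y _; rewrite expr2.
  have cA k := TP_cont (TA k).
  have c1 : continuous (fun x => \sum_(k < 3) cv (jack N) (cv (jack N) (w k)) x * v k x 0).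
    by apply: c_sum => k; have := c0 k => ck; have := cA k => cAk; cont.
  have c2 : continuous (fun x => \sum_(k < 3) vin k x * cv (jack N) (cv (jack N) (w k)) x).
    by apply: c_sum => k; have := cA k => cAk; cont.
  rewrite -I3_sum; last by move=> k; have := cw k => ck; have := cA k => cAk; cont.
  transitivity (I3 (fun x => \sum_(k < 3) cv (jack N) (cv (jack N) (w k)) x * v k x 0) -
    I3 (fun x => \sum_(k < 3) vin k x * cv (jack N) (cv (jack N) (w k)) x)).
    rewrite -I3B //; apply: I3_ext => y _; rewrite -sumrB; apply: eq_bigr => k _; rewrite /w; ring.
  apply/eqP; rewrite subr_eq0; apply/eqP; apply: H.
    move=> k l; apply: cv_cont => //; by have [_ c _] := gP k l; exact: c.
  move=> y; rewrite cv_sum //; last by move=> k; have [_ c _] := gP k k; exact: c.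
  by rewrite -[RHS](I3_cst 0); apply: I3_ext => z _; rewrite gd mulr0.
have Hj : I3 (fun x => cv (jack N) (w j) x ^+ 2) = 0.
  move/eqP: H; rewrite psumr_eq0; last by move=> k _; apply: I3_ge0 => y; exact: sqr_ge0.
  by move=> /allP/(_ j); rewrite mem_index_enum => /(_ isT) /eqP.
move=> y; have := I3_eq0 _ _ _ Hj y.
have -> : cv (jack N) (fun _ => 0) y = 0.
  by rewrite -[RHS](I3_cst 0); apply: I3_ext => z _; rewrite mulr0.
move=> H0; apply/eqP; rewrite -(sqrf_eq0 (cv (jack N) (w j) y)); apply/eqP; apply: H0.
- by have := cN j => cNj; cont.
- by move=> z k; rewrite pN.
- by move=> z; exact: sqr_ge0.
Qed.

Lemma energy_th (b bp bpp : R -> R) N t : (forall z : R, der b z (1 : R) (bp z)) ->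
  (forall z : R, der bp z (1 : R) (bpp z)) -> continuous bpp -> 0 <= t <= T ->
  I3 (fun x => b (cv (jack N) (th^~ t) x)) = I3 (fun x => b (cv (jack N) thin x)) +
    J 0 t (fun s => flux (fun i => (v i)^~ s) bpp N (th^~ s)).
Proof.
move=> db dbp cbpp /andP[t0 tT].
have cj := @c_jack R N; have pj := @jack_per R N; have ej := @jack_even R N.
have cb := der_cont db; have cbp := der_cont dbp.
have cF s i : continuous (fun y => v i y s * th y s).
  by have := @cvs i s => c1; have := @cths s => c2; cont.
have pF s i : periodic3 (fun y => v i y s * th y s) by apply: perM; [exact: pvv|exact: pth].
pose G x s := - \sum_(i < 3) gradN N (fun y => v i y s * th y s) i x.
have cG : continuous (fun p : pt * R => G p.1 p.2).
  rewrite /G; apply: cN; apply: c_sum => i.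
  have c1 : continuous (fun p : R * pt => v i p.2 p.1 * th p.2 p.1) by cont.
  have c2 := @c_gradN R R N i (fun s y => v i y s * th y s) c1 (fun s => pF s i).
  by apply: (@c_comp R (pt * R)%type (R * pt)%type _ (fun p => (p.2, p.1)) c2); cont.
have eqn x s : 0 <= s <= T -> cv (jack N) (th^~ s) x = cv (jack N) thin x + J 0 s (G x).
  move=> sT; have cti := cthin; have pti := pthin; have ct := @cths s; rewrite !cvE //.
  have cg i : continuous (@jgrad R N i) by have [_ c _] := jgradP R N i; exact: c.
  rewrite (scalar_eq (TP_refl x (TP_jack R N)) (fun i => pdv_jrefl N i x) _ sT); last first.
    by move=> i; have := cg i => cgi; cont.
  congr (_ + _); first by apply: I3_ext => y _; rewrite mulrC.
  apply: J_ext => r _; rewrite /G -sumrN.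
  transitivity (\sum_(i < 3) I3 (fun y => - (jgrad N i (x - y) * (v i y r * th y r)))).
    rewrite -I3_sum; last by move=> i; have := cg i => cgi; have := cF r i => cFi; cont.
    by apply: I3_ext => y _; rewrite mulr_suml; apply: eq_bigr => i _; ring.
  apply: eq_bigr => i _; rewrite gradN_E // I3N //.
  by have := cg i => cgi; have := cF r i => cFi; cont.
have cfN : continuous (fun p : pt * R => cv (jack N) (th^~ p.2) p.1).
  have c1 : continuous (fun p : R * pt => th p.2 p.1) by cont.
  have c2 := @cv_joint R R (jack N) (fun s y => th y s) cj c1.
  by apply: (@c_comp R (pt * R)%type (R * pt)%type _ (fun p => (p.2, p.1)) c2); cont.
have cH : continuous (fun p : pt * R => bp (cv (jack N) (th^~ p.2) p.1) * G p.1 p.2).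
  by apply: cM => //; exact: (c_comp cbp cfN).
have ptw x : b (cv (jack N) (th^~ t) x) = b (cv (jack N) thin x) +
    J 0 t (fun s => bp (cv (jack N) (th^~ s) x) * G x s).
  have cGx : continuous (G x) := @c_slice R pt R G x cG.
  have [F dF] := prim_ex cGx.
  (* [eqn] holds only on [[0, T]]; [H] extends its right-hand side to a differentiable function on
     the whole line, to which the chain rule applies. *)
  pose H s := cv (jack N) thin x + (F s - F 0).
  have HE s : 0 <= s <= T -> cv (jack N) (th^~ s) x = H s.
    by move=> sT; rewrite eqn // (J_prim _ cGx dF) //; case/andP: sT.
  have dH s : der H s (1 : R) (G x s).
    rewrite /H -[X in der _ _ _ X](_ : 0 + (G x s - 0) = _); last by ring.
    apply: derD; first exact: der_cst.
    by apply: derD; [exact: dF|apply: derN; exact: der_cst].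
  have cHx := der_cont dH.
  have HJ := @J_prim R 0 t (fun s => bp (H s) * G x s) (fun s => b (H s)) t0.
  rewrite HE ?t0 // (_ : J 0 t _ = J 0 t (fun s => bp (H s) * G x s)); last first.
    by apply: J_ext => s /andP[s0 st]; rewrite HE // s0 (le_trans st).
  rewrite HJ; [|by cont|by move=> s; apply: der_comp].
  by rewrite /H subrr addr0; ring.
transitivity (I3 (fun x => b (cv (jack N) thin x) + J 0 t (fun s => bp (cv (jack N) (th^~ s) x) * G x s))).
  by apply: I3_ext => x _; exact: ptw.
have cti := cv_cont cj cthin.
rewrite I3D; last 2 first.
- by cont.
- exact: (@J_param R pt 0 t (fun x s => bp (cv (jack N) (th^~ s) x) * G x s) t0 cH).
congr (_ + _); rewrite (@I3_J R 0 t (fun x s => bp (cv (jack N) (th^~ s) x) * G x s)) //.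
apply: J_ext => s _; rewrite /flux.
have cfs : continuous (cv (jack N) (th^~ s)) by apply: cv_cont.
have pfs : periodic3 (cv (jack N) (th^~ s)) by apply: cv_per.
have [g1 g2] : (forall i, pdv i (cv (jack N) (th^~ s)) (gradN N (th^~ s) i)) /\ (forall i, continuous (gradN N (th^~ s) i)).
  by split => i; have [] := gradP N i (@cths s) (pth s).
have [h1 h2] : (forall i, pdv i (cv (jack N) (fun y => v i y s * th y s)) (gradN N (fun y => v i y s * th y s) i))
    /\ (forall i, continuous (gradN N (fun y => v i y s * th y s) i)).
  by split => i; have [] := gradP N i (cF s i) (pF s i).
have cVN i : continuous (cv (jack N) (fun y => v i y s * th y s)) by apply: cv_cont.
transitivity (\sum_(i < 3) - I3 (fun x => bp (cv (jack N) (th^~ s) x) * gradN N (fun y => v i y s * th y s) i x)).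
  rewrite /G; transitivity (\sum_(i < 3) I3 (fun x => - (bp (cv (jack N) (th^~ s) x) * gradN N (fun y => v i y s * th y s) i x))).
    rewrite -I3_sum; last by move=> i; have := h2 i => h2i; cont.
    by apply: I3_ext => x _; rewrite mulrN mulr_sumr sumrN.
  by apply: eq_bigr => i _; rewrite I3N //; have := h2 i => h2i; cont.
apply: eq_bigr => i _; have cVi := cVN i; have g2i := g2 i; have h2i := h2 i.
(* Integration by parts: the derivative of this product has zero integral, which transfers the
   derivative to [bp] of the regularised scalar and produces the flux. *)
have Hp := pdvM (pdv_comp dbp (g1 i)) (h1 i).
have := pdv_I30 Hp; rewrite I3D; [|by cont|by cont].
move=> H; apply/eqP; rewrite eq_sym -addr_eq0; apply/eqP; apply: H.
- by cont.
- by cont.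
- by apply: perM; [move=> x k; rewrite pfs|exact: cv_per].
Qed.

Local Notation vN N i s := (cv (jack N) ((v i)^~ s)).

Lemma energy_v N t : 0 <= t <= T ->
  \sum_(i < 3) I3 (fun x => vN N i t x ^+ 2) = \sum_(i < 3) I3 (fun x => cv (jack N) (vin i) x ^+ 2) +
    2 * (J 0 t (fun s => \sum_(i < 3) flux (fun j => (v j)^~ s) (fun _ => 1) N ((v i)^~ s)) +
         J 0 t (fun s => I3 (fun x => th x s * cv (jack N) (vN N ord_max s) x))).
Proof.
move=> /andP[t0 tT].
have cj := @c_jack R N; have pj := @jack_per R N; have ej := @jack_even R N.
have cN i s : continuous (vN N i s) by apply: (cv_cont cj); exact: (@cvs i s).
have pN i s : periodic3 (vN N i s) by apply: cv_per; exact: pvv.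
have cvs' i : continuous (fun p : R * pt => v i p.2 p.1) by have := @cvv i => ci; cont.
have cNj i : continuous (fun p : R * pt => vN N i p.1 p.2).
  exact: (@cv_joint R R (jack N) (fun s x => v i x s) cj (cvs' i)).
have cNNj i : continuous (fun p : R * pt => cv (jack N) (vN N i p.1) p.2).
  exact: (@cv_joint R R (jack N) (fun s x => vN N i s x) cj (cNj i)).
have cgj i j : continuous (fun p : R * pt => gradN N ((v i)^~ p.1) j p.2).
  exact: (@c_gradN R R N j (fun s x => v i x s) (cvs' i) (pvv i)).
have cgNj i j : continuous (fun p : R * pt => cv (jack N) (gradN N ((v i)^~ p.1) j) p.2).
  exact: (@cv_joint R R (jack N) (fun s x => gradN N ((v i)^~ s) j x) cj (cgj i j)).
have gP s i j := gradP N j (@cvs i s) (pvv i s).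
(* Two separate times: for fixed [r] this is the velocity at time [s] tested with the double
   regularisation frozen at [r], while the diagonal is the energy. *)
pose D s r := \sum_(i < 3) I3 (fun x => vN N i r x * vN N i s x).
pose f s r x := \sum_(i < 3) \sum_(j < 3) cv (jack N) (gradN N ((v i)^~ r) j) x * (v i x s * v j x s)
      + th x s * cv (jack N) (vN N ord_max r) x.
pose F s r := I3 (f s r).
have cf : continuous (fun p : (R * R) * pt => f p.1.1 p.1.2 p.2).
  rewrite /f; apply: cD.
    apply: c_sum => i; apply: c_sum => j; have c1 := cgNj i j; have c2 := cvs' i; have c3 := cvs' j.
    apply: cM; last by cont.
    by apply: (@c_comp R _ (R * pt)%type _ (fun p : (R * R) * pt => (p.1.2, p.2)) c1); cont.
  have c1 := cNNj ord_max; apply: cM; first by cont.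
  by apply: (@c_comp R _ (R * pt)%type _ (fun p : (R * R) * pt => (p.1.2, p.2)) c1); cont.
have cF : continuous (fun p : R * R => F p.1 p.2) by exact: (@I3_param R (R * R)%type (fun p x => f p.1 p.2 x) cf).
have DE s r : 0 <= s <= T -> 0 <= r <= T -> D s r = D 0 r + J 0 s (F^~ r).
  move=> sT rT.
  have TA i : TP (Qc (fun _ => 2 * N%:R)) (cv (jack N) (vN N i r)) by exact: TP_cvj.
  have cA i := TP_cont (TA i).
  have DI s' : D s' r = I3 (fun x => \sum_(i < 3) cv (jack N) (vN N i r) x * v i x s').
    rewrite I3_sum; last by move=> i; have c1 := cA i; have c2 := @cvs i s'; cont.
    by apply: eq_bigr => i _; rewrite [RHS]cv_adj //.
  have H s' : 0 <= s' <= T -> D s' r =  I3 (fun x => \sum_(i < 3) vin i x * cv (jack N) (vN N i r) x) + J 0 s' (F^~ r).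
    move=> sT'; rewrite DI; apply: (vector_eq TA (fun i j => @gradN_cv N j _ (@cvs i r) (pvv i r)) _ _ sT').
      by move=> i j; apply: (cv_cont cj); have [_ c _] := gP r i j; exact: c.
    move=> x; rewrite cv_sum //; last by move=> k; have [_ c _] := gP r k k; exact: c.
    by rewrite -[RHS](I3_cst 0); apply: I3_ext => z _; rewrite div_free ?mulr0.
  have t00 : (0 : R) <= 0 <= T by rewrite lexx ltW.
  by rewrite (H s) // (H 0) // J00 addr0.
have Dsym s r : D s r = D r s.
  by apply: eq_bigr => i _; apply: I3_ext => x _; rewrite mulrC.
have cFr r : continuous (F^~ r) by cont.
have slope s h r : 0 <= s <= T -> 0 <= s + h <= T -> 0 <= r <= T ->
    D (s + h) r - D s r = h * J 0 1 (fun y => F (s + y * h) r).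
  move=> sT shT rT; rewrite (DE (s + h)) // (DE s) //.
  have [P dP] := prim_ex (cFr r).
  have /andP[s0 _] := sT; have /andP[sh0 _] := shT.
  rewrite (J_prim sh0 (cFr r) dP) (J_prim s0 (cFr r) dP) -(J_slope s h (cFr r) dP); ring.
have cE : continuous (fun s => D s s).
  rewrite /D; apply: c_sum => i; have c1 := cNj i.
  by apply: (@I3_param R R (fun s x => vN N i s x * vN N i s x)); cont.
have dE s : 0 < s < T -> der (fun s => D s s) s (1 : R) (2 * F s s).
  move=> /andP[s0 sT].
  (* The diagonal increment is split through [D s (s + h)], which by symmetry equals [D (s + h) s];
     each half is an increment in the first time only, and the two halves account for the factor
     2. *)
  pose q h := J 0 1 (fun y => F (s + y * h) (s + h)) + J 0 1 (fun y => F (s + y * h) s).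
  have -> : 2 * F s s = q 0.
    rewrite /q addr0 (_ : J 0 1 _ = J 0 1 (fun _ => F s s)); last by apply: J_ext => y _; rewrite mulr0 addr0.
    by rewrite J01_cst; ring.
  apply: der_slope_near; last first.
    suff : continuous q by apply.
    apply: cD.
      by apply: (@J_param R R 0 1 (fun h y => F (s + y * h) (s + h))) => //; cont.
    by apply: (@J_param R R 0 1 (fun h y => F (s + y * h) s)) => //; cont.
  near=> h; rewrite [h *: 1]mulr1 (addrC h).
  have hs : `|h| < Num.min s (T - s).
    near: h; apply/nbhs_ballP; exists (Num.min s (T - s)); first by rewrite /= lt_min s0 subr_gt0.
    by move=> h; rewrite /ball /= sub0r normrN.
  move: hs; rewrite lt_min !ltr_norml => /andP[/andP[h1 h2] /andP[h3 h4]].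
  have sT' : 0 <= s <= T by rewrite !ltW.
  have shT : 0 <= s + h <= T by apply/andP; split; lra.
  rewrite /q mulrDr -(slope _ _ _ sT' shT shT) -(slope _ _ _ sT' shT sT') (Dsym (s + h) s); ring.
(* Self-adjointness moves the outer regularisation from the gradient to [v i * v j]; the result is
   the flux of the scalar [v i] for a function with second derivative 1. *)
have EF s : F s s = \sum_(i < 3) flux (fun j => (v j)^~ s) (fun _ => 1) N ((v i)^~ s) +
    I3 (fun x => th x s * cv (jack N) (vN N ord_max s) x).
  have cg i j : continuous (gradN N ((v i)^~ s) j) by have [_ c _] := gP s i j; exact: c.
  have cA i := cv_cont cj (cN i s).
  have cB i j := cv_cont cj (cg i j).
  have cvv' i j : continuous (fun x => v i x s * v j x s).
    by have c1 := @cvs i s; have c2 := @cvs j s; cont.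
  have cT i j : continuous (fun x => cv (jack N) (gradN N ((v i)^~ s) j) x * (v i x s * v j x s)).
    by apply: cM; [exact: (cB i j)|exact: (cvv' i j)].
  rewrite /F /f I3D; last 2 first.
  - by apply: c_sum => i; apply: c_sum => j; exact: (cT i j).
  - by have c1 := cA ord_max; have c2 := @cths s; cont.
  congr (_ + _); rewrite I3_sum; last by move=> i; apply: c_sum => j; exact: (cT i j).
  apply: eq_bigr => i _; rewrite I3_sum; last by move=> j; exact: (cT i j).
  rewrite /flux; apply: eq_bigr => j _.
  have [_ _ pg] := gP s i j.
  rewrite (cv_adj cj pj ej (cg i j) pg (cvv' i j) (perM (pvv i s) (pvv j s))).
  by apply: I3_ext => x _; rewrite mul1r; congr (_ * cv _ _ _); apply: funext => y; rewrite mulrC.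
have cFd : continuous (fun s => 2 * F s s) by cont.
have tmp s : s < t -> s < T by move=> st; exact: lt_le_trans st tT.
have HJ : J 0 t (fun s => 2 * F s s) = D t t - D 0 0.
  by apply: (J_FTC t0 cFd cE) => s /andP[s0 st]; apply: dE; rewrite s0 tmp.
have cflux i : continuous (fun s => flux (fun j => (v j)^~ s) (fun _ => 1) N ((v i)^~ s)).
  by apply: c_flux => //; cont.
rewrite -JD; last 2 first.
- by apply: c_sum => i; exact: (cflux i).
- by have c1 := cNNj ord_max; apply: (@I3_param R R (fun s x => th x s * cv (jack N) (vN N ord_max s) x)); cont.
rewrite -(@J_ext R 0 t (fun s => F s s)); last by move=> s _; exact: EF.
rewrite -JZ; last by cont.
rewrite HJ; have -> : \sum_(i < 3) I3 (fun x => cv (jack N) (vin i) x ^+ 2) = D 0 0.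
  apply: eq_bigr => i _; apply: I3_ext => x _; rewrite expr2.
  by congr (cv _ _ _ * cv _ _ _); apply: funext => y; rewrite v_init.
rewrite addrCA subrr addr0; apply: eq_bigr => i _; apply: I3_ext => x _; exact: expr2.
Unshelve. all: by end_near. Qed.

End Sol.

(** * Passage to the limit *)

Section Powers.
Variable R : realType.
Local Notation pt := 'rV[R]_3.
Implicit Types (f g : pt -> R).

(** Off 0 the power is an exponential of a logarithm; at 0 its value is conventional, and the radius
    [e^(1/r)] is used directly. *)
Lemma c_powabs (r : R) : 0 < r -> continuous (fun z : R => `|z| `^ r).
Proof.
move=> r0 z; have [->|z0] := eqVneq z 0.
  apply/cvgrPdist_le => e e0; rewrite normr0 powR0 ?gt_eqF //.
  have d0 : 0 < e `^ r^-1 by rewrite powR_gt0.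
  apply/nbhs_ballP; exists (e `^ r^-1) => // y; rewrite /ball /= !sub0r !normrN => yd.
  rewrite ger0_norm ?powR_ge0 //; apply: le_trans (ge0_ler_powR (ltW r0) _ _ (ltW yd)) _.
  - by rewrite nnegrE.
  - by rewrite nnegrE ltW.
  - by rewrite -powRrM mulVf ?gt_eqF // powRr1 // ltW.
have nz : \forall y \near z, y != 0.
  apply/nbhs_ballP; exists `|z|; first by rewrite /= normr_gt0.
  by move=> y; rewrite /ball /=; apply: contraTneq => ->; rewrite subr0 ltxx.
rewrite /continuous_at /powR (negbTE (_ : `|z| != 0)) ?normr_eq0 //.
apply: (@cvg_trans _ ((fun y : R => expR (r * ln `|y|)) @ z)).
  apply: near_eq_cvg; near=> y; rewrite ifF //; apply/negbTE; rewrite normr_eq0; near: y.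
  exact: nz.
apply: (@cvg_comp _ _ _ (fun y : R => r * ln `|y|) expR); last exact: continuous_expR.
apply: cvgM; first exact: cvg_cst.
apply: (@cvg_comp _ _ _ (fun y : R => `|y|) (@ln R)); last by apply: continuous_ln; rewrite normr_gt0.
exact: norm_continuous.
Unshelve. all: by end_near. Qed.

Lemma young1 (m s : R) : 1 <= m -> 0 <= s -> s <= s `^ m / m + (1 - m^-1).
Proof.
move=> m1 s0; have m0 : 0 < m by lra.
have [->|mn1] := eqVneq m 1; first by rewrite powRr1 // invr1 mulr1 subrr addr0.
have mi : m^-1 < 1 by rewrite invf_lt1 // lt_neqAle eq_sym mn1.
have q0 : 0 < 1 - m^-1 by rewrite subr_gt0.
have := @conjugate_powR R s 1 m (1 - m^-1)^-1 s0 ler01 m0.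
rewrite invr_gt0 => /(_ q0); rewrite invrK addrCA subrr addr0 => /(_ erefl).
by rewrite powR1 mulr1 mul1r.
Qed.

(** For finite [q], Young's inequality is applied pointwise to [f / lam] and integrated over a space
    of mass one. Taking [lam] slightly above the norm keeps it positive when the norm is zero. *)
Lemma n2_Lq q f : (2%:E <= q)%E -> continuous f -> periodic3 f -> n2 f <= Lq q f.
Proof.
case: q => [q||//]; last first.
  move=> _ cf pf; apply: le_n2; first exact: sup_ge0.
  rewrite -[leRHS](I3_cst _); apply: I3_le; [by cont|by cont|move=> x _].
  by rewrite -real_normK ?num_real // lerXn2r ?nnegrE ?sup_ge0 //; exact: sup_ub.
rewrite lee_fin => q2 cf pf; have q0 : 0 < q by lra.
have qn0 : q != 0 by rewrite gt_eqF.
have cp := c_powabs q0.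
have cfp : continuous (fun x => `|f x| `^ q) := c_comp cp cf.
set L := Lq _ _; have L0 : 0 <= L by rewrite /L /= powR_ge0.
have LE : L `^ q = I3 (fun x => `|f x| `^ q).
  rewrite /L /= -I3E -powRrM mulVf // powRr1 //.
  by apply: I3_ge0 => x; exact: powR_ge0.
apply/ler_addgt0Pr => e e0; set lam := L + e.
have l0 : 0 < lam by rewrite /lam; lra.
apply: le_n2; first exact: ltW.
have H x : f x ^+ 2 <= lam ^+ 2 * (2 / q) * lam `^ (- q) * `|f x| `^ q + lam ^+ 2 * (1 - 2 / q).
  have m1 : 1 <= q / 2 by rewrite ler_pdivlMr // mul1r.
  have u0 : 0 <= `|f x| / lam by rewrite divr_ge0 // ltW.
  have E : ((`|f x| / lam) ^+ 2) `^ (q / 2) = lam `^ (- q) * `|f x| `^ q.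
    rewrite -(powR_mulrn 2 u0) -powRrM (_ : 2%:R * (q / 2) = q); last by field.
    rewrite powRM //; last by rewrite invr_ge0 ltW.
    by rewrite mulrC -(powR_inv1 (ltW l0)) -powRrM mulN1r.
  have := young1 m1 (sqr_ge0 (`|f x| / lam)); rewrite E.
  have -> : f x ^+ 2 = lam ^+ 2 * (`|f x| / lam) ^+ 2.
    by rewrite -exprMn mulrCA mulfV ?gt_eqF // mulr1 real_normK // num_real.
  move=> /(ler_wpM2l (sqr_ge0 lam)); set X := lam `^ _; set Y := `|f x| `^ _; set Z := _ ^+ 2 * _.
  by move=> H; apply: le_trans H _; rewrite le_eqVlt; apply/orP; left; apply/eqP; field.
apply: (@le_trans _ _ (I3 (fun x => lam ^+ 2 * (2 / q) * lam `^ (- q) * `|f x| `^ q + lam ^+ 2 * (1 - 2 / q)))).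
  by apply: I3_le; [by cont|by cont|move=> x _; exact: H].
rewrite I3D; [|by cont|by cont]; rewrite I3Z // I3_cst -LE.
have lq : lam `^ (- q) * L `^ q <= 1.
  rewrite powRN mulrC ler_pdivrMr ?powR_gt0 // mul1r.
  apply: ge0_ler_powR; rewrite ?nnegrE ?(ltW q0) ?(ltW l0) //.
  by rewrite /lam lerDl ltW.
have h : 0 <= lam ^+ 2 * (2 / q) by rewrite mulr_ge0 ?sqr_ge0 // divr_ge0 // ltW.
have := ler_wpM2l h lq; rewrite mulr1 mulrA; lra.
Qed.

End Powers.

(** * Vanishing of the time-integrated flux *)

Section Blocks.
Variable R : realType.
Local Notation pt := 'rV[R]_3.
Variables (chi vphi : pt -> R).
Hypothesis LP : LP_pair chi vphi.
Local Notation blk := (LPblock chi vphi).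
Local Notation mu := (@lebesgue_measure R).

Lemma blk_joint n (f : pt -> R -> R) : continuous (fun p : pt * R => f p.1 p.2) ->
  continuous (fun p : R * pt => blk n (f^~ p.1) p.2).
Proof.
move=> cf.
have -> : (fun p : R * pt => blk n (f^~ p.1) p.2) = (fun p : R * pt =>
  \sum_(a < (2 * LPdeg n).+1) \sum_(b < (2 * LPdeg n).+1) \sum_(c < (2 * LPdeg n).+1)
   LPmult chi vphi n (kk R n a b c) * I3 (fun y => mode (kk R n a b c) 0 (p.2 - y) * f y p.1)).
  by apply: funext => p; exact: LPblockE.
apply: c_sum => a; apply: c_sum => b; apply: c_sum => c; apply: cM; first by cont.
have cm := @c_mode R (kk R n a b c) 0.
by apply: (@I3_param R (R * pt)%type (fun p y => mode (kk R n a b c) 0 (p.2 - y) * f y p.1)); cont.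
Qed.

Lemma c_n2blk n (f : pt -> R -> R) : continuous (fun p : pt * R => f p.1 p.2) ->
  continuous (fun t => n2 (blk n (f^~ t))).
Proof.
move=> cf; have cb := @blk_joint n f cf.
have c1 : continuous (fun t => I3 (fun x => blk n (f^~ t) x ^+ 2)).
  by apply: (@I3_param R R (fun t x => blk n (f^~ t) x ^+ 2)); cont.
rewrite /n2; exact: (c_comp (@sqrt_continuous R) c1).
Qed.

Definition aseq (f : pt -> R -> R) n t : R := wgt R n * n2 (blk n (f^~ t)).

(** What the flux limit asks of [f]: an integrable majorant of the squared weighted block norms, and
    their boundedness and decay at almost every time. The Besov assumptions on [th] and on the
    velocity components are both reduced to this. *)
Definition L2dom (T : R) (f : pt -> R -> R) : Prop := exists G : R -> \bar R,
  mu.-integrable (timeI 0 T) G /\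
  ae_on T (fun t => (forall n, ((aseq f n t ^+ 2)%:E <= G t)%E) /\
                    exists2 A, forall n, aseq f n t <= A & (aseq f ^~ t) @ \oo --> (0 : R)).

Lemma aseq_ge0 f n t : 0 <= aseq f n t.
Proof. by rewrite /aseq mulr_ge0 ?n2_ge0 // ltW // wgt_gt0. Qed.

Lemma ae_onI (T : R) P Q : ae_on T P -> ae_on T Q -> ae_on T (fun t => P t /\ Q t).
Proof.
move=> [N [nN HN]] [M [nM HM]]; exists (N `|` M); split; first exact: negligibleU.
move=> t tT NM; split; [apply: HN|apply: HM] => // H; apply: NM; [left|right] => //.
Qed.

Lemma ae_onS (T : R) (P Q : R -> Prop) : (forall t, 0 <= t <= T -> P t -> Q t) -> ae_on T P -> ae_on T Q.
Proof. by move=> PQ [N [nN HN]]; exists N; split => // t tT Nt; apply: PQ => //; exact: HN. Qed.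

Lemma ae_on_ae (T : R) (P Q : R -> Prop) : ae_on T P -> (forall t, (timeI 0 T t -> P t) -> Q t) ->
  {ae mu, forall t, Q t}.
Proof.
move=> [N [nN HN]] PQ; apply: negligibleS nN => t /= H; apply: contrapT => Nt; apply: H.
by apply: PQ => tT; exact: HN.
Qed.

(** Measurability in time of the Besov norm is not established, so the comparison is read off the
    definition of the integral as a supremum over simple functions. *)
Lemma le_integral_nomeas (D : set R) (f g : R -> \bar R) :
  (forall x, D x -> (0 <= f x)%E) -> (forall x, D x -> (f x <= g x)%E) ->
  (\int[mu]_(x in D) f x <= \int[mu]_(x in D) g x)%E.
Proof.
move=> f0 fg; rewrite !ge0_integralE //; last by move=> x Dx; exact: le_trans (f0 x Dx) (fg x Dx).
apply: ereal_sup_le => _ [h hf <-]; exists h => // x; apply: le_trans (hf x) _.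
by rewrite /patch; case: ifPn => // /[!inE]; exact: fg.
Qed.

Lemma L_besov_dom (r q : \bar R) T f : (2%:E <= q)%E -> (2%:E <= r)%E ->
  continuous (fun p : pt * R => f p.1 p.2) ->
  L_besov chi vphi r q T f -> L2dom T f.
Proof.
move=> q2 r2 cf [Hc Ht].
have cs t : continuous (f^~ t) by cont.
have cb n t : continuous (blk n (f^~ t)) := TP_cont (LPblock_TP chi vphi n (cs t)).
have le_a n t : aseq f n t <= wgt R n * Lq q (blk n (f^~ t)).
  rewrite /aseq; apply: ler_wpM2l; first by rewrite ltW // wgt_gt0.
  exact: (n2_Lq q2 (cb n t) (@blk_per R chi vphi n _ (cs t))).
have Hc' : ae_on T (fun t => exists2 A, forall n, aseq f n t <= A & (aseq f ^~ t) @ \oo --> (0 : R)).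
  apply: ae_onS Hc => t tT [[M HM] H0]; exists M; first by move=> n; exact: le_trans (HM n).
  apply: (@squeeze_cvgr _ _ _ _ (fun _ => 0) (fun n => wgt R n * Lq q (blk n (f^~ t)))) => //.
    by near=> n; rewrite aseq_ge0 le_a.
  exact: cvg_cst.
have le_b n t : ((aseq f n t)%:E <= besov_norm chi vphi q (f^~ t))%E.
  apply: le_ereal_sup_tmp; exists (wgt R n * Lq q (blk n (f^~ t)))%:E; first by exists n.
  by rewrite lee_fin.
case: r r2 Ht => [r||//] r2 /= Ht; last first.
  have [M HM] := Ht; exists (EFin \o cst (M ^+ 2)); split.
    by apply: cont_integrable; exact: (@c_cst R R (M ^+ 2)).
  apply: ae_onS (ae_onI HM Hc') => t tT [H1 H2]; split => // n.
  rewrite /= lee_fin lerXn2r // ?nnegrE ?aseq_ge0 //.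
    by have := le_trans (le_b n t) H1; rewrite lee_fin; apply: le_trans; exact: aseq_ge0.
  by have := le_trans (le_b n t) H1; rewrite lee_fin.
rewrite lee_fin in r2; have r0 : 0 < r by lra.
(* A countable supremum of functions continuous in time, hence measurable; it lies below the
   corresponding power of the Besov norm. *)
pose H : R -> \bar R := fun t : R => esups (fun n => (aseq f n t `^ r)%:E) 0%N.
have HE n t : ((aseq f n t `^ r)%:E <= H t)%E.
  by apply: ereal_sup_ubound; exists n.
have H0 t : (0 <= H t)%E by apply: le_trans (HE 0%N t); rewrite lee_fin powR_ge0.
have iH : mu.-integrable (timeI 0 T) H.
  apply/integrableP; split.
    apply: measurable_fun_esups => n; apply/measurable_EFinP.
    apply: (@measurableT_comp _ _ _ _ _ _ (@powR R ^~ r)) => //.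
    have ca : continuous (aseq f n).
      by rewrite /aseq; have c1 := @c_n2blk n f cf; cont.
    by apply: measurable_funTS; exact: continuous_measurable_fun.
  apply: le_lt_trans Ht; apply: le_integral_nomeas => t _ //; rewrite gee0_abs //.
  apply: ge_ereal_sup => _ [n _ <-]; rewrite -poweR_EFin.
  apply: gt0_ler_poweR; rewrite ?(ltW r0) //.
  - by rewrite in_itv /= leey lee_fin aseq_ge0.
  - rewrite in_itv /= leey andbT; apply: le_trans (le_b 0%N t); by rewrite lee_fin aseq_ge0.
have i1 : mu.-integrable (timeI 0 T) (EFin \o cst (1 : R)).
  by apply: cont_integrable; exact: (@c_cst R R 1).
exists (fun t => ((1 : R)%:E + H t)%E); split.
  apply: (@integrableD _ _ _ mu (timeI 0 T) _ (EFin \o cst (1 : R)) H) => //.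
  exact: timeI_measurable.
apply: ae_onS Hc' => t tT H1; split => // n /=.
apply: (@le_trans _ _ (1%:E + (aseq f n t `^ r)%:E)%E); last exact: leeD2l.
rewrite -EFinD lee_fin.
(* Since [r >= 2], a square is at most 1 or at most the [r]-th power; this is why the majorant is
   [1 + H]. *)
have a0 := aseq_ge0 f n t; have [a1|a1] := leP (aseq f n t) 1.
  by rewrite ler_wpDr ?powR_ge0 // expr_le1.
rewrite -powR_mulrn // ler_wpDl // ler_powR // ltW //.
Unshelve. all: by end_near. Qed.

Lemma cv_sup_le N u (M : R) x : (0 < N)%N -> continuous u -> (forall y, `|u y| <= M) -> `|cv (jack N) u x| <= M.
Proof.
move=> N0 cu HM; have cj := @c_jack R N; have j0 := @jack_ge0 R N.
apply: le_trans (I3_abs _) _; first by cont.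
rewrite -[leRHS]mulr1 -(I3_jack R N0) -I3Z //; apply: I3_le; [by cont|by cont|move=> y _].
by rewrite normrM ger0_norm // mulrC ler_wpM2r.
Qed.

(** Dominated convergence. At a fixed good time [tail_sum] makes the last factor of [flux_bound]
    small, and a multiple of [G] dominates for all [k]. *)
Lemma flux_lim T (v : 'I_3 -> pt -> R -> R) (f : pt -> R -> R) (b bp bpp : R -> R) (V : R) t :
  (forall z : R, der b z (1 : R) (bp z)) -> (forall z : R, der bp z (1 : R) (bpp z)) -> continuous bpp ->
  (forall i, continuous (fun p : pt * R => v i p.1 p.2)) -> (forall i s, periodic3 ((v i)^~ s)) ->
  continuous (fun p : pt * R => f p.1 p.2) -> (forall s, periodic3 (f^~ s)) ->
  (forall N s x, 0 <= s <= T -> \sum_(i < 3) gradN N ((v i)^~ s) i x = 0) ->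
  ae_on T (fun s => forall i n, wgt R n * Lq +oo%E (blk n ((v i)^~ s)) <= V) ->
  L2dom T f -> 0 <= t <= T ->
  (fun k => J 0 t (fun s => flux (fun i => (v i)^~ s) bpp (2 ^ k) (f^~ s))) @ \oo --> (0 : R).
Proof.
move=> db dbp cbpp cvv pvv cf pf dv HV [G [iG HG]] /andP[t0 tT].
have [M HM] : exists M, forall s x, 0 <= s <= T -> `|f x s| <= M.
  have cK : compact (@cube R `*` timeI 0 T).
    by apply: compact_setX; [exact: cube_compact|exact: timeI_compact].
  have ca : continuous (fun p : pt * R => `|f p.1 p.2|) by cont.
  have := compact_bounded (continuous_compact (continuous_subspaceT ca) cK).
  move=> [M [_ HM]]; exists (M + 1) => s x sT; have [y cy E] := cube_rep x.
  have {}E := E (f^~ s) (pf s); rewrite /= in E.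
  rewrite E -[`|f y s|]normr_id; apply: (HM (M + 1)); first by rewrite ltrDl.
  by exists (y, s).
have [B2 HB] : exists B2, forall z, `|z| <= M -> `|bpp z| <= B2.
  have := compact_bounded (continuous_compact (continuous_subspaceT cbpp) (@timeI_compact R (- M) M)).
  move=> [B [_ HB]]; exists (B + 1) => z zM; apply: (HB (B + 1)); first by rewrite ltrDl.
  by exists z => //; rewrite /timeI /= -ler_norml.
have fsc s : continuous (f^~ s) by cont.
have vsc i s : continuous ((v i)^~ s) by have := cvv i => c1; cont.
have pk k : (0 < 2 ^ k)%N by rewrite expn_gt0.
pose F k s := flux (fun i => (v i)^~ s) bpp (2 ^ k) (f^~ s).
have cF k : continuous (F k) by exact: c_flux.
have bound s k A E : 0 <= s <= T -> (forall i n, wgt R n * Lq +oo%E (blk n ((v i)^~ s)) <= V) ->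
    (forall n, aseq f n s <= A) -> (forall N', \sum_(n < N') rr R ^+ ee n k * aseq f n s <= E) ->
    `|F k s| <= CF R * B2 * V * A * E.
  move=> sT H1 H2 H3; apply: (@flux_bound R chi vphi LP _ _ _ b bp bpp) => //.
  - by move=> x; exact: dv.
  - by move=> x; apply: HB; apply: cv_sup_le => // y; exact: HM.
(* The 1 makes [C] strictly positive, so that [C] times an infinite [G s] is infinite. Moduli are
   taken because the signs of [B2] and [V] are not yet known; that of [V] is visible only at good
   times. *)
pose C := CF R * `|B2| * `|V| * geoC R + 1.
have C0 : 0 < C.
  rewrite /C ltr_wpDl //; apply: mulr_ge0; last by rewrite ltW // geoC_gt0.
  apply: mulr_ge0 => //; apply: mulr_ge0 => //; by rewrite ltW // CF_gt0.
have sub : timeI 0 t `<=` timeI 0 T.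
  by move=> s /andP[s0 st]; rewrite /timeI /= s0 (le_trans st).
have B20 : 0 <= B2.
  have := HB 0; rewrite normr0; have [m0|m0] := leP 0 M; first by move=> /(_ isT); exact: le_trans.
  have := HM 0 0; rewrite lexx (le_trans t0 tT) => /(_ isT) H.
  by have := le_lt_trans H m0; rewrite ltNge normr_ge0.
have aeH := ae_onI HV HG.
have [] := @dominated_convergence _ _ R mu (timeI 0 t) (@timeI_measurable R 0 t)
  (fun k s => (F k s)%:E) (cst 0%E) (fun s => C%:E * G s)%E.
- by move=> k; have /integrableP[] := @cont_integrable R 0 t (F k) (cF k).
- exact: measurable_cst.
- apply: (ae_on_ae aeH) => s Hs st; have sT := sub s st.
  have [H1 [H2 [A HA H3]]] := Hs sT.
  apply/fine_cvgP; split; first by near=> k.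
  apply/cvgrPdist_le => e e0 /=.
  have A0 : 0 <= A by exact: le_trans (aseq_ge0 f 0 s) (HA 0%N).
  have V0 : 0 <= V.
    by apply: le_trans (H1 ord0 0%N); rewrite mulr_ge0 ?sup_ge0 // ltW // wgt_gt0.
  pose X := CF R * B2 * V * A.
  have X0 : 0 <= X.
    exact: (mulr_ge0 (mulr_ge0 (mulr_ge0 (ltW (CF_gt0 R)) B20) V0) A0).
  have e1 : 0 < e / (X + 1) by rewrite divr_gt0 // ltr_wpDl.
  have [k0 Hk] := @tail_sum R (aseq f ^~ s) A _ (fun n => introT andP (conj (aseq_ge0 f n s) (HA n))) H3 e1.
  exists k0 => // k /= kk; rewrite sub0r normrN.
  apply: le_trans (bound s k A _ sT H1 HA (Hk k kk)) _.
  by rewrite -/X mulrA ler_pdivrMr ?ltr_wpDl // mulrC ler_wpM2l ?lerDl // ltW.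
- apply: integrableZl; first exact: timeI_measurable.
  by apply: (@integrableS _ _ _ mu (timeI 0 T)) => //; exact: timeI_measurable.
- apply: (ae_on_ae aeH) => s Hs k st; have sT := sub s st.
  have [H1 [H2 [A HA H3]]] := Hs sT.
  rewrite /=; have V0 : 0 <= V.
    by apply: le_trans (H1 ord0 0%N); rewrite mulr_ge0 ?sup_ge0 // ltW // wgt_gt0.
  case EG : (G s) H2 => [g||] H2; last by have := H2 0%N.
    have g0 : 0 <= g by have := H2 0%N; rewrite lee_fin; apply: le_trans; exact: sqr_ge0.
    have Hg n : aseq f n s <= Num.sqrt g.
      by rewrite -(@ger0_norm _ (aseq f n s)) ?aseq_ge0 // -sqrtr_sqr ler_wsqrtr // -lee_fin.
    (* Both the supremum of the block norms and their weighted sum are of order [sqrt g], and their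
       product is of order [g]. *)
    rewrite -EFinM lee_fin; apply: le_trans (bound s k (Num.sqrt g) (geoC R * Num.sqrt g) sT H1 Hg _) _.
      move=> N'; apply: (@le_trans _ _ (\sum_(n < N') rr R ^+ ee n k * Num.sqrt g)).
        by apply: ler_sum => n _; apply: ler_wpM2l => //; apply: exprn_ge0; rewrite ltW // rr_gt0.
      by rewrite -mulr_suml ler_wpM2r ?sqrtr_ge0 // geo_sum.
    rewrite (_ : _ * (geoC R * _) = CF R * B2 * V * geoC R * Num.sqrt g ^+ 2); last by ring.
    rewrite sqr_sqrtr // /C (ger0_norm B20) (ger0_norm V0).
    by rewrite ler_wpM2r // lerDl.
  by rewrite gt0_muley ?lte_fin // leey.
move=> _ _; rewrite integral0_eq // => H.
have -> : (fun k => J 0 t (fun s => flux (fun i => (v i)^~ s) bpp (2 ^ k) (f^~ s))) =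
    fine \o (fun k => \int[mu]_(x in timeI 0 t) (F k x)%:E)%E.
  by apply: funext => k; rewrite JE.
exact: (@fine_cvg _ _ _ _ _ 0 H).
Unshelve. all: by end_near. Qed.

End Blocks.

(** * Limits of the regularised quantities *)

Section Limits.
Variable R : realType.
Local Notation pt := 'rV[R]_3.

Lemma der_lip (b bp : R -> R) (M : R) : (forall z : R, der b z (1 : R) (bp z)) -> continuous bp ->
  exists2 B, 0 <= B & forall y z, `|y| <= M -> `|z| <= M -> `|b y - b z| <= B * `|y - z|.
Proof.
move=> db cbp.
have [B0 [_ HB]] := compact_bounded (continuous_compact (continuous_subspaceT cbp) (@timeI_compact R (- M) M)).
exists (`|B0| + 1) => [|y z yM zM]; first by rewrite addr_ge0.
rewrite -{1}(subrK z y) (addrC _ z) (J_slope z (y - z) cbp db) normrM mulrC ler_wpM2r //.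
have -> : `|B0| + 1 = (`|B0| + 1) * (1 - 0) by rewrite subr0 mulr1.
apply: J_abs_le => //.
  by apply: (c_comp cbp); exact: c_affine.
move=> s /andP[s0 s1]; apply: (HB (`|B0| + 1)).
  by rewrite ltr_pwDr // ler_norm.
exists (z + s * (y - z)) => //; rewrite /timeI /= -ler_norml.
have -> : z + s * (y - z) = (1 - s) * z + s * y by ring.
apply: le_trans (ler_normD _ _) _; rewrite !normrM (ger0_norm s0) (@ger0_norm _ (1 - s)) ?subr_ge0 //.
have -> : M = (1 - s) * M + s * M by ring.
by apply: lerD; apply: ler_wpM2l; rewrite ?subr_ge0.
Qed.

Lemma cv_lim_I3 (b bp : R -> R) (u : pt -> R) : (forall z : R, der b z (1 : R) (bp z)) -> continuous bp ->
  continuous u -> periodic3 u ->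
  (fun k => I3 (fun x => b (cv (jack (2 ^ k)) u x))) @ \oo --> I3 (fun x => b (u x)).
Proof.
move=> db cbp cu pu; have cb := der_cont db.
have [M HM] := per_bounded cu pu; have [B B0 HB] := der_lip M db cbp.
apply/cvgrPdist_le => e e0; have e1 : 0 < e / (B + 1) by rewrite divr_gt0 // ltr_wpDl.
have cF : continuous (fun p : pt * R => u p.1) by cont.
have [N0 HN] := @cv_unif R 1 (fun x _ => u x) _ cF (fun=> pu) e1.
exists N0 => // k /= Nk; have pk : (0 < 2 ^ k)%N by rewrite expn_gt0.
have cj := @c_jack R (2 ^ k); have cN := cv_cont cj cu.
rewrite -I3B; [|by cont|by cont]; apply: I3_bound; first by cont.
move=> x _; apply: (@le_trans _ _ (B * (e / (B + 1)))).
  apply: le_trans (HB _ _ (HM x) _) _; first exact: cv_sup_le.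
  rewrite distrC; apply: ler_wpM2l => //; apply: (HN _ _ pk 0); last by rewrite lexx ler01.
  by apply: leq_trans Nk _; exact: ltnW (ltn_expl k _).
by rewrite mulrA ler_pdivrMr ?ltr_wpDl // mulrC ler_wpM2l ?lerDl // ltW.
Qed.

(** The work of the buoyancy involves a doubly regularised velocity: the second regularisation does
    not increase the sup norm of the first error, so the total error is at most twice it. *)
Lemma cv_lim_time (t : R) (f g : pt -> R -> R) : 0 <= t ->
  continuous (fun p : pt * R => f p.1 p.2) -> (forall s, periodic3 (f^~ s)) ->
  continuous (fun p : pt * R => g p.1 p.2) ->
  (fun k => J 0 t (fun s => I3 (fun x => g x s * cv (jack (2 ^ k)) (cv (jack (2 ^ k)) (f^~ s)) x))) @ \oo -->
  J 0 t (fun s => I3 (fun x => g x s * f x s)).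
Proof.
move=> t0 cf pf cg.
have cf' : continuous (fun p : R * pt => f p.2 p.1) by cont.
have [M HM] : exists M, forall s x, 0 <= s <= t -> cube x -> `|g x s| <= M.
  have cK : compact (@cube R `*` timeI 0 t).
    by apply: compact_setX; [exact: cube_compact|exact: timeI_compact].
  have [M [_ HM]] := compact_bounded (continuous_compact (continuous_subspaceT cg) cK).
  exists (M + 1) => s x sT cx; apply: (HM (M + 1)); first by rewrite ltrDl.
  by exists (x, s).
apply/cvgrPdist_le => e e0.
have Mt : 0 < 2 * `|M| * t + 1 by rewrite ltr_wpDl // !mulr_ge0.
have e1 : 0 < e / (2 * `|M| * t + 1) by rewrite divr_gt0.
set e' := e / _ in e1.
have [N0 HN] := @cv_unif R t f _ cf pf e1.
exists N0 => // k /= Nk; have pk : (0 < 2 ^ k)%N by rewrite expn_gt0.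
have N0k : (N0 <= 2 ^ k)%N by apply: leq_trans Nk _; exact: ltnW (ltn_expl k _).
have cj := @c_jack R (2 ^ k).
have c1 := @cv_joint R R (jack (2 ^ k)) (fun s x => f x s) cj cf'.
have c2 := @cv_joint R R (jack (2 ^ k)) (fun s x => cv (jack (2 ^ k)) (f^~ s) x) cj c1.
have ca : continuous (fun s => I3 (fun x => g x s * f x s)).
  by apply: (@I3_param R R (fun s x => g x s * f x s)); cont.
have cb : continuous (fun s => I3 (fun x => g x s * cv (jack (2 ^ k)) (cv (jack (2 ^ k)) (f^~ s)) x)).
  apply: (@I3_param R R (fun s x => g x s * cv (jack (2 ^ k)) (cv (jack (2 ^ k)) (f^~ s)) x)).
  by apply: cM => //; cont.
rewrite -mulN1r -JZ // -JD //; last by cont.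
apply: (@le_trans _ _ (`|M| * (2 * e') * (t - 0))).
  apply: J_abs_le => //; first by cont.
  move=> s sT; have cfs : continuous (f^~ s) by cont.
  have cgs : continuous (g^~ s) by cont.
  have cA := cv_cont cj cfs; have cB := cv_cont cj cA.
  rewrite mulN1r -I3B; [|by cont|by cont]; apply: I3_bound; first by cont.
  move=> x cx; rewrite -mulrBr normrM; apply: ler_pM => //.
    by apply: le_trans (HM s x sT cx) _; exact: ler_norm.
  have h1 y := HN _ N0k pk s y sT.
  have h2 : `|cv (jack (2 ^ k)) (fun y => cv (jack (2 ^ k)) (f^~ s) y - f y s) x| <= e'.
    by apply: cv_sup_le => //; cont.
  rewrite cvB // in h2.
  rewrite distrC (_ : _ - _ = (cv (jack (2 ^ k)) (cv (jack (2 ^ k)) (f^~ s)) x - cv (jack (2 ^ k)) (f^~ s) x) +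
     (cv (jack (2 ^ k)) (f^~ s) x - f x s)); last by ring.
  by apply: le_trans (ler_normD _ _) _; have := h1 x; lra.
rewrite subr0 (_ : _ * t = 2 * `|M| * t * e'); last by ring.
rewrite /e' mulrA ler_pdivrMr // mulrC ler_wpM2l ?lerDl //; exact: ltW.
Qed.

Lemma der_expn (n : nat) (z : R) : der (fun z : R => z ^+ n) z (1 : R) (n%:R * z ^+ n.-1).
Proof.
elim: n => [|n IH]; first by rewrite mul0r; exact: der_cst.
have -> : n.+1%:R * z ^+ n.+1.-1 = 1 * z ^+ n + z * (n%:R * z ^+ n.-1).
  rewrite -natr1 /=; case: n IH => [|n] IH /=; first by ring.
  by rewrite [X in _ = _ + X]mulrCA -exprS; ring.
have := derM (der_id z) IH; congr der.
by apply: funext => y; rewrite exprS.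
Qed.

(** For [lam] above the sup norm of [w], all even moments of [u / lam] are at most 1. The positive
    part [g] of [(u / lam)^2 - 1] then satisfies [n * I3 g <= 1] for every [n], hence vanishes. *)
Lemma sup_le_moments (u w : pt -> R) : continuous u -> periodic3 u -> continuous w -> periodic3 w ->
  (forall n, I3 (fun x => u x ^+ (2 * n)) = I3 (fun x => w x ^+ (2 * n))) -> Lq +oo u <= Lq +oo w.
Proof.
move=> cu pu cw pw H; set S := Lq +oo w; have S0 : 0 <= S := sup_ge0 w.
apply/ler_addgt0Pr => e e0; set lam := S + e.
have l0 : 0 < lam by rewrite /lam; lra.
pose h x := (u x / lam) ^+ 2 - 1.
have ch : continuous h by rewrite /h; cont.
pose g x := (h x + `|h x|) / 2.
have cg : continuous g by rewrite /g; cont.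
have pg : periodic3 g by move=> x i; rewrite /g /h pu.
have g0 x : 0 <= g x by rewrite /g divr_ge0 // -lerBlDr sub0r lerNl -normrN ler_norm.
(* Bernoulli's inequality [n (q - 1) <= q^n] where [q > 1]; elsewhere [g] is zero. *)
have bern (n : nat) x : n%:R * g x <= (u x / lam) ^+ (2 * n).
  rewrite exprM; set q := (u x / lam) ^+ 2; have q0 : 0 <= q := sqr_ge0 _.
  have hE : h x = q - 1 by [].
  have [q1|q1] := leP q 1.
    have -> : g x = 0 by rewrite /g ler0_norm hE ?subr_le0 //; lra.
    by rewrite mulr0 exprn_ge0.
  have -> : g x = q - 1 by rewrite /g ger0_norm hE ?subr_ge0 ?(ltW q1) //; lra.
  elim: n => [|n IH]; first by rewrite mul0r.
  rewrite exprS -natr1; have qn : 1 <= q ^+ n by rewrite exprn_ege1 // ltW.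
  nra.
have I0 (n : nat) : n%:R * I3 g <= 1.
  rewrite -I3Z //; apply: (@le_trans _ _ (I3 (fun x => (u x / lam) ^+ (2 * n)))).
    by apply: I3_le; [by cont|by cont|move=> x _; exact: bern].
  rewrite (_ : I3 _ = lam ^- (2 * n) * I3 (fun x => w x ^+ (2 * n))); last first.
    by rewrite -H -I3Z; [apply: I3_ext => x _; rewrite exprMn exprVn mulrC|cont].
  rewrite mulrC ler_pdivrMr ?exprn_gt0 // mul1r -[leRHS](I3_cst _).
  apply: I3_le; [by cont|by cont|move=> x _].
  rewrite !exprM; apply: lerXn2r; rewrite ?nnegrE ?sqr_ge0 //.
  rewrite -real_normK ?num_real //; apply: lerXn2r; rewrite ?nnegrE // ?(ltW l0) //.
  by apply: le_trans (sup_ub cw pw x) _; rewrite /lam lerDl ltW.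
have Ig : I3 g = 0.
  apply/eqP; rewrite eq_le I3_ge0 // andbT leNgt; apply/negP => Ig0.
  have := I0 (Num.truncn (I3 g)^-1).+1; apply/negP; rewrite -ltNge.
  by rewrite -ltr_pdivrMr // div1r; exact: truncnS_gt.
apply: sup_le => x _; have := I3_eq0 cg pg g0 Ig x; rewrite /g => Hg.
have : h x <= 0 by have := ler_norm (h x); lra.
rewrite /h subr_le0 => H1.
have : `|u x / lam| <= 1 by rewrite -(@expr_le1 _ 2) // real_normK ?num_real.
by rewrite normrM normfV (gtr0_norm l0) ler_pdivrMr // mul1r.
Qed.

Section Beta.
Variables (p d : R).
Hypothesis d0 : 0 < d.
Let u (z : R) := z ^+ 2 + d.
Let u0 z : 0 < u z. Proof. by rewrite /u ltr_wpDl // sqr_ge0. Qed.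
(** The power [(z^2 + d)^(p/2)] through exponential and logarithm, which are easy to differentiate.
    The shift [d] is essential: for [p < 2] the function [|z|^p] is not twice differentiable at
    0. *)
Definition bet (z : R) := expR (p / 2 * ln (u z)).
Definition betp (z : R) := bet z * (p / 2 * ((u z)^-1 * (2 * z))).
Definition betpp (z : R) := betp z * (p / 2 * ((u z)^-1 * (2 * z))) +
  bet z * (p / 2 * ((- (u z) ^- 2 * (2 * z)) * (2 * z) + (u z)^-1 * 2)).

Let du z : der u z (1 : R) (2 * z).
Proof.
rewrite -[X in der _ _ _ X]addr0; apply: derD; last exact: der_cst.
by have := der_expn 2 z; rewrite expr1.
Qed.

Lemma der_bet z : der bet z (1 : R) (betp z).
Proof.
apply: (@der_comp R (fun z => p / 2 * ln (u z)) expR); last exact: is_derive_expR.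
apply: derZ; apply: (@der_comp R u (@ln R)); first exact: du.
exact: is_derive1_ln.
Qed.

Let dw z : der (fun z => (u z)^-1) z (1 : R) (- (u z) ^- 2 * (2 * z)).
Proof. by apply: (@der_inv R u); [rewrite gt_eqF|exact: du]. Qed.

Lemma der_betp z : der betp z (1 : R) (betpp z).
Proof.
apply: derM; first exact: der_bet.
apply: derZ; apply: derM; first exact: dw.
by rewrite -[X in der _ _ _ X]mulr1; apply: derZ; exact: der_id.
Qed.

Lemma c_betpp : continuous betpp.
Proof.
have c1 := der_cont der_bet; have c2 := der_cont der_betp; have c3 := der_cont dw.
rewrite /betpp; have -> : (fun z => betp z * (p / 2 * ((u z)^-1 * (2 * z))) +
  bet z * (p / 2 * ((- (u z) ^- 2 * (2 * z)) * (2 * z) + (u z)^-1 * 2))) =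
  (fun z => betp z * (p / 2 * ((u z)^-1 * (2 * z))) +
  bet z * (p / 2 * ((- ((u z)^-1 * (u z)^-1) * (2 * z)) * (2 * z) + (u z)^-1 * 2))).
  by apply: funext => z; rewrite -exprVn expr2.
by cont.
Qed.

Lemma betE z : bet z = `|z ^+ 2 + `|d| | `^ (p / 2).
Proof.
by rewrite /bet (gtr0_norm d0) (gtr0_norm (u0 z)) /powR gt_eqF.
Qed.
End Beta.

(** The form of [bet] given by [betE], with [|d|], makes sense and is continuous for every real [d],
    so equality for [d > 0] passes to [d = 0] by ordinary continuity. *)
Lemma Lp_moments (p : R) (u w : pt -> R) : 0 < p -> continuous u -> continuous w ->
  (forall d, 0 < d -> I3 (fun x => bet p d (u x)) = I3 (fun x => bet p d (w x))) ->
  I3 (fun x => `|u x| `^ p) = I3 (fun x => `|w x| `^ p).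
Proof.
move=> p0 cu cw H; have p2 : 0 < p / 2 by rewrite divr_gt0.
have cp := c_powabs p2.
pose Phi d f := I3 (fun x => `|f x ^+ 2 + `|d : R| | `^ (p / 2)).
have cPhi f : continuous f -> continuous (fun d => Phi d f).
  move=> cf; apply: (@I3_param R R (fun d x => `|f x ^+ 2 + `|d| | `^ (p / 2))).
  by apply: (@c_comp R _ R (fun z => `|z| `^ (p / 2)) (fun q : R * pt => f q.2 ^+ 2 + `|q.1|) cp); cont.
have P0 f : Phi 0 f = I3 (fun x => `|f x| `^ p).
  apply: I3_ext => x _; rewrite normr0 addr0 ger0_norm ?sqr_ge0 // -real_normK ?num_real //.
  by rewrite -powR_mulrn // -powRrM; congr powR; field.
rewrite -!P0; apply/eqP; rewrite -subr_eq0 -normr_le0; apply/ler_addgt0Pr => e e0; rewrite add0r.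
have cD : continuous (fun d => Phi d u - Phi d w).
  by have c1 := cPhi u cu; have c2 := cPhi w cw; cont.
have /cvgrPdist_lt/(_ e e0)/nbhs_ballP [d d0 Hd] := cD 0.
have d2 : 0 < d / 2 by rewrite divr_gt0.
have := Hd (d / 2); rewrite /ball /= sub0r normrN gtr0_norm //.
have -> : d / 2 < d by rewrite ltr_pdivrMr //; lra.
move=> /(_ isT); rewrite (_ : Phi (d / 2) u = Phi (d / 2) w) ?subrr ?subr0 => [/ltW //|].
rewrite /Phi; transitivity (I3 (fun x => bet p (d / 2) (u x))); first by apply: I3_ext => x _; rewrite betE.
by rewrite H //; apply: I3_ext => x _; rewrite betE.
Qed.

End Limits.

(** * Conservation laws for the extended solution *)

Section Conservation.
Variable R : realType.

Lemma lim_eq (u w : nat -> R) (a c : R) : u @ \oo --> a -> w @ \oo --> c -> (forall k, u k = w k) -> a = c.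
Proof.
move=> Hu Hw /funext E; rewrite -E in Hw.
by rewrite -(cvg_lim (@norm_hausdorff R R) Hu) -(cvg_lim (@norm_hausdorff R R) Hw).
Qed.

Lemma seqD (u w : nat -> R) (a c : R) : u @ \oo --> a -> w @ \oo --> c -> (fun k => u k + w k) @ \oo --> a + c.
Proof. by move=> Hu Hw; exact: cvgD. Qed.

Lemma seqZ (b : R) (u : nat -> R) (a : R) : u @ \oo --> a -> (fun k => b * u k) @ \oo --> b * a.
Proof. by move=> Hu; apply: cvgM => //; exact: cvg_cst. Qed.

Local Notation pt := 'rV[R]_3.
Variables (chi vphi : pt -> R).
Hypothesis LP : LP_pair chi vphi.
Variables (T : R) (vin : 'I_3 -> pt -> R) (thin : pt -> R) (v : 'I_3 -> pt -> R -> R) (th : pt -> R -> R).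
Hypothesis T0 : 0 < T.
Hypothesis wsol : weak_solution T vin thin v th.
Hypothesis cvv : forall i, continuous (fun p : pt * R => v i p.1 p.2).
Hypothesis pvv : forall i s, periodic3 ((v i)^~ s).
Hypothesis cth : continuous (fun p : pt * R => th p.1 p.2).
Hypothesis pth : forall s, periodic3 (th^~ s).
Hypothesis Bv : forall i, L_besov chi vphi +oo%E +oo%E T (v i).

Lemma v_bound : exists V, ae_on T (fun s => forall i n, wgt R n * Lq +oo%E (LPblock chi vphi n ((v i)^~ s)) <= V).
Proof.
have H i : exists M, ae_on T (fun s => forall n, wgt R n * Lq +oo%E (LPblock chi vphi n ((v i)^~ s)) <= M).
  have [_ /= [M HM]] := Bv i; exists M; apply: ae_onS HM => s _ Hs n.
  rewrite -lee_fin; apply: le_trans Hs; apply: ereal_sup_ubound; by exists n.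
have [M0 H0] := H ord0; have [M1 H1] := H (lift ord0 ord0); have [M2 H2] := H ord_max.
exists (`|M0| + `|M1| + `|M2|); apply: ae_onS (ae_onI H0 (ae_onI H1 H2)) => s _ [h0 [h1 h2]] i n.
have := ler_norm M0; have := ler_norm M1; have := ler_norm M2.
have := normr_ge0 M0; have := normr_ge0 M1; have := normr_ge0 M2.
elim/ord3P: i; [have := h0 n|have := h1 n|have := h2 n]; lra.
Qed.

Lemma conserve_th (b bp bpp : R -> R) t : (forall z : R, der b z (1 : R) (bp z)) ->
  (forall z : R, der bp z (1 : R) (bpp z)) -> continuous bpp -> L2dom chi vphi T th -> 0 <= t <= T ->
  I3 (fun x => b (th x t)) = I3 (fun x => b (thin x)).
Proof.
move=> db dbp cbpp dth tT; have [V HV] := v_bound; have cbp := der_cont dbp.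
have L1 := flux_lim LP db dbp cbpp cvv pvv cth pth
  (fun N s x => @div_free R T vin thin v th T0 wsol cvv pvv N s x) HV dth tT.
have L2 := cv_lim_I3 db cbp (@cthin _ _ _ _ _ _ wsol) (pthin wsol).
have cts : continuous (th^~ t) by cont.
have L3 := cv_lim_I3 db cbp cts (pth t).
have L4 := seqD L2 L1; rewrite addr0 in L4.
apply: (lim_eq L3 L4) => k; exact: (energy_th T0 wsol cvv pvv cth pth (2 ^ k) db dbp cbpp tT).
Qed.

Lemma conserve_v t : 0 <= t <= T ->
  I3 (fun x => \sum_(i < 3) v i x t ^+ 2) = I3 (fun x => \sum_(i < 3) vin i x ^+ 2)
    + 2 * J 0 t (fun s => I3 (fun x => th x s * v ord_max x s)).
Proof.
move=> tT; have /andP[t0 _] := tT; have [V HV] := v_bound.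
have cvs i : continuous ((v i)^~ t) by have ci := @cvv i; cont.
have ci i : continuous (vin i) := @cvin _ _ _ _ _ _ wsol i.
(* The normalisation makes [b'' = 1], matching the flux in [energy_v]. *)
pose b (z : R) := 2^-1 * z ^+ 2.
have db z : der b z (1 : R) z.
  by rewrite -[X in der _ _ _ X](_ : 2^-1 * (2%:R * z ^+ 1) = z); [apply: derZ; exact: der_expn|field].
have L1 i : (fun k => J 0 t (fun s => flux (fun j => (v j)^~ s) (fun _ => 1) (2 ^ k) ((v i)^~ s))) @ \oo --> (0 : R).
  apply: (flux_lim LP db (fun z => der_id z) _ cvv pvv (@cvv i) (pvv i) _ HV _ tT).
  - by cont.
  - by move=> N s x; exact: (@div_free R T vin thin v th T0 wsol cvv pvv N s x).
  - by apply: (@L_besov_dom R chi vphi +oo%E +oo%E T (v i) _ _ (@cvv i) (Bv i)); exact: leey.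
have dq z : der (fun z : R => z ^+ 2) z (1 : R) (2%:R * z ^+ 1) := der_expn 2 z.
have cq : continuous (fun z : R => 2%:R * z ^+ 1) by cont.
have L2 i := cv_lim_I3 dq cq (cvs i) (pvv i t).
have L3 i := cv_lim_I3 dq cq (ci i) (pvin wsol i).
have L4 := cv_lim_time t0 (@cvv ord_max) (pvv ord_max) cth.
have cf k i : continuous (fun s => flux (fun j => (v j)^~ s) (fun _ => 1) (2 ^ k) ((v i)^~ s)).
  by apply: c_flux => //; cont.
have E (w : 'I_3 -> pt -> R) : (forall i, continuous (w i)) ->
    I3 (fun x => \sum_(i < 3) w i x ^+ 2) = \sum_(i < 3) I3 (fun x => w i x ^+ 2).
  by move=> cw; rewrite I3_sum // => i; have := cw i => cwi; cont.
rewrite (E (fun i => (v i)^~ t)) // E //.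
have S2 := seqD (seqD (L2 ord0) (L2 (lift ord0 ord0))) (L2 ord_max).
have S3 := seqD (seqD (L3 ord0) (L3 (lift ord0 ord0))) (L3 ord_max).
have S1 := seqD (seqD (L1 ord0) (L1 (lift ord0 ord0))) (L1 ord_max).
have S4 := @seqZ 2 _ _ (seqD S1 L4).
have S5 := seqD S3 S4; rewrite !addr0 add0r in S5.
rewrite !sum3; apply: (lim_eq S2 S5) => k.
have := energy_v T0 wsol cvv pvv cth (2 ^ k) tT; rewrite !sum3.
rewrite (_ : J 0 t (fun s => \sum_(i < 3) _) =
   J 0 t (fun s => flux (fun j => (v j)^~ s) (fun _ => 1) (2 ^ k) ((v ord0)^~ s)) +
   J 0 t (fun s => flux (fun j => (v j)^~ s) (fun _ => 1) (2 ^ k) ((v (lift ord0 ord0))^~ s)) +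
   J 0 t (fun s => flux (fun j => (v j)^~ s) (fun _ => 1) (2 ^ k) ((v ord_max)^~ s))); last first.
  have c0 := cf k ord0; have c1 := cf k (lift ord0 ord0); have c2 := cf k ord_max.
  rewrite -JD // -JD //; last by cont.
  by apply: J_ext => s _; rewrite sum3.
exact.
Qed.

Lemma conserve_Lq p t : (1 <= p)%E -> L2dom chi vphi T th -> 0 <= t <= T -> Lq p (th^~ t) = Lq p thin.
Proof.
move=> p1 dth tT; have cts : continuous (th^~ t) by cont.
have cti : continuous thin := @cthin _ _ _ _ _ _ wsol.
case: p p1 => [p||//] p1.
  rewrite lee_fin in p1; have p0 : 0 < p by lra.
  rewrite /Lq -!I3E; congr powR; apply: Lp_moments => // d d0.
  by apply: (conserve_th (der_bet p d0) (der_betp p d0) (@c_betpp R p d d0)).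
have M n : I3 (fun x => th x t ^+ (2 * n)) = I3 (fun x => thin x ^+ (2 * n)).
  set m := (2 * n)%N.
  apply: (@conserve_th (fun z => z ^+ m) (fun z => m%:R * z ^+ m.-1) (fun z => m%:R * (m.-1%:R * z ^+ m.-2))) => //.
  - by move=> z; exact: der_expn.
  - by move=> z; apply: derZ; exact: der_expn.
  - by cont.
have pti := pthin wsol; have pt' := pth t.
by apply/eqP; rewrite eq_le; apply/andP; split; apply: sup_le_moments.
Qed.

End Conservation.

(** * Extension by constants in time *)

Section Clamp.
Variable R : realType.
Local Notation pt := 'rV[R]_3.
Variable T : R.
Hypothesis T0 : 0 < T.

(** Composition with this retraction turns continuity relative to the strip [[0, T]] into global
    continuity. *)
Definition clamp (s : R) : R := Num.max 0 (Num.min s T).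

Lemma clampE s : 0 <= s <= T -> clamp s = s.
Proof. by move=> /andP[s0 sT]; rewrite /clamp (min_idPl sT) (max_idPr s0). Qed.

Lemma clamp_in s : 0 <= clamp s <= T.
Proof. by rewrite /clamp le_max lexx /= ge_max (ltW T0) /= ge_min lexx orbT. Qed.

Lemma c_clamp : continuous clamp.
Proof.
move=> s; apply: (@continuous_max R R (cst 0) (fun s => Num.min s T)); first exact: cvg_cst.
by apply: continuous_min; [exact: cvg_id|exact: cvg_cst].
Qed.

Definition cl (f : pt -> R -> R) : pt -> R -> R := fun x s => f x (clamp s).

Lemma c_within (X Y : topologicalType) (A : set Y) (g : Y -> R) (h : X -> Y) :
  {within A, continuous g} -> continuous h -> (forall x, A (h x)) -> continuous (fun x => g (h x)).
Proof.
move=> /subspace_continuousP cg ch hA x; apply: cvg_comp (cg _ (hA x)).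
move=> P HP; have HP' : nbhs (h x) [set y | A y -> P y] := HP.
have : nbhs x [set y | A (h y) -> P (h y)] := ch x _ HP'.
by apply: filterS => y H; exact: H (hA y).
Qed.

Lemma c_cl f : cont_T3 T f -> continuous (fun p : pt * R => cl f p.1 p.2).
Proof.
move=> [cf _]; have cc := c_clamp.
apply: (c_within cf (h := fun p : pt * R => (p.1, clamp p.2))); first by cont.
by move=> p; exact: clamp_in.
Qed.

Lemma p_cl f s : cont_T3 T f -> periodic3 ((cl f)^~ s).
Proof. by move=> [_ pf]; apply: pf; exact: clamp_in. Qed.

Lemma int_ext t (F G : R -> R) : (forall s, 0 <= s <= t -> F s = G s) ->
  \int[@lebesgue_measure R]_(s in timeI 0 t) F s = \int[@lebesgue_measure R]_(s in timeI 0 t) G s.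
Proof. by rewrite -!JE; exact: J_ext. Qed.

Lemma L_besov_cl chi vphi r q f : L_besov chi vphi r q T f -> L_besov chi vphi r q T (cl f).
Proof.
move=> [H1 H2]; split; first by apply: ae_onS H1 => t tT; rewrite /cl clampE.
case: r H2 => [r||] H2; last by case: H2.
  rewrite /Ltime (_ : (\int[_]_(t in _) _)%E =
    (\int[@lebesgue_measure R]_(t in timeI 0 T) (besov_norm chi vphi q (f^~ t) `^ r))%E); first exact: H2.
  by apply: eq_integral => t /[!inE] tT; rewrite /cl clampE.
have [M HM] := H2; exists M; apply: ae_onS HM => t tT; rewrite /cl clampE //.
Qed.

(** The integral and almost-everywhere conditions look only at times in [[0, T]], where [clamp] is
    the identity. *)
Lemma weak_solution_cl vin thin v th : weak_solution T vin thin v th ->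
  weak_solution T vin thin (fun i => cl (v i)) (cl th).
Proof.
move=> [h1 [h2 [h3 [h4 [h5 [h6 [h7 h8]]]]]]]; split; first exact: h1.
split; first exact: h2.
split; first exact: h3.
have cc f : cont_T3 T f -> cont_T3 T (cl f).
  move=> cf; split; last by move=> s _; exact: p_cl.
  by apply: continuous_subspaceT; exact: c_cl.
split; first by move=> i; exact: cc.
split; first exact: cc.
split; first by apply: ae_onS h6 => t tT; rewrite /cl clampE.
split=> phi Hphi.
- have E1 : \int[@lebesgue_measure R]_(s in timeI 0 T) intT3 (fun x => \sum_(i < 3) dt (phi i) x s * cl (v i) x s) =
      \int[@lebesgue_measure R]_(s in timeI 0 T) intT3 (fun x => \sum_(i < 3) dt (phi i) x s * v i x s).
    by apply: int_ext => s sT; rewrite /cl (clampE sT); reflexivity.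
  have E2 : \int[@lebesgue_measure R]_(s in timeI 0 T) intT3 (fun x =>
          \sum_(i < 3) \sum_(j < 3) dx j (phi i) x s * (cl (v i) x s * cl (v j) x s)
          + cl th x s * phi ord_max x s) =
      \int[@lebesgue_measure R]_(s in timeI 0 T) intT3 (fun x =>
          \sum_(i < 3) \sum_(j < 3) dx j (phi i) x s * (v i x s * v j x s)
          + th x s * phi ord_max x s).
    by apply: int_ext => s sT; rewrite /cl (clampE sT); reflexivity.
  exact: (etrans (congr1 (fun z => - intT3 (fun x => \sum_(i < 3) vin i x * phi i x 0) - z) E1)
    (etrans (h7 phi Hphi) (esym E2))).
- have E1 : \int[@lebesgue_measure R]_(s in timeI 0 T) intT3 (fun x => dt phi x s * cl th x s) =
      \int[@lebesgue_measure R]_(s in timeI 0 T) intT3 (fun x => dt phi x s * th x s).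
    by apply: int_ext => s sT; rewrite /cl (clampE sT); reflexivity.
  have E2 : \int[@lebesgue_measure R]_(s in timeI 0 T) intT3 (fun x =>
          (\sum_(i < 3) cl (v i) x s * dx i phi x s) * cl th x s) =
      \int[@lebesgue_measure R]_(s in timeI 0 T) intT3 (fun x =>
          (\sum_(i < 3) v i x s * dx i phi x s) * th x s).
    by apply: int_ext => s sT; rewrite /cl (clampE sT); reflexivity.
  exact: (etrans (congr1 (fun z => - intT3 (fun x => thin x * phi x 0) - z) E1)
    (etrans (h8 phi Hphi) (esym E2))).
Qed.

End Clamp.

Theorem theorem1p2 (R : realType) (chi vphi : 'rV[R]_3 -> R)
  (T : R) (vin : 'I_3 -> 'rV[R]_3 -> R) (thin : 'rV[R]_3 -> R)
  (v : 'I_3 -> 'rV[R]_3 -> R -> R) (th : 'rV[R]_3 -> R -> R) (p : \bar R) :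
  LP_pair chi vphi ->
  0 < T ->
  weak_solution T vin thin v th ->
  (1 <= p)%E ->
  (forall i, L_besov chi vphi +oo%E +oo%E T (v i)) ->
  C_Lq p T th ->
  ((p < 2%:E)%E -> L_besov chi vphi 2%:E (conj_exp p) T th) ->
  ((2%:E <= p)%E -> L_besov chi vphi p p T th) ->
  forall t, 0 <= t <= T ->
    intT3 (fun x => \sum_(i < 3) v i x t ^+ 2)
      = intT3 (fun x => \sum_(i < 3) vin i x ^+ 2)
        + 2 * \int[@lebesgue_measure R]_(s in timeI 0 t) intT3 (fun x => th x s * v ord_max x s)
    /\ Lq p (th^~ t) = Lq p thin.
Proof.
move=> LP T0 wsol p1 Bv _ H1 H2 t tT.
have [_ [_ [_ [cv_ [ct_ _]]]]] := wsol.
have wcl := weak_solution_cl T0 wsol.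
have cvv i := @c_cl R T T0 (v i) (cv_ i); have pvv i s := @p_cl R T T0 (v i) s (cv_ i).
have cth := @c_cl R T T0 th ct_; have pth s := @p_cl R T T0 th s ct_.
have Bv' i := L_besov_cl (Bv i).
(* The two cases merge here: for [p < 2] the conjugate exponent [p / (p - 1)], infinite at [p = 1],
   is at least 2, and for [p >= 2] both exponents equal [p]. *)
have dth : L2dom chi vphi T (cl T th).
  have [p2|p2] := ltP p 2%:E; last exact: (@L_besov_dom R chi vphi p p T _ p2 p2 cth (L_besov_cl (H2 p2))).
  apply: (@L_besov_dom R chi vphi 2%:E (conj_exp p) T _ _ (lexx _) cth (L_besov_cl (H1 p2))).
  case: p p1 p2 {H1 H2} => [p||] //=; rewrite lee_fin lte_fin => p1 p2.
  have [//|pn1] := eqVneq p 1; first by rewrite leey.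
  have p0 : 0 < p - 1 by rewrite subr_gt0 lt_neqAle eq_sym pn1.
  rewrite lee_fin ler_pdivlMr //; lra.
have E := clampE tT; split.
  have := conserve_v LP T0 wcl cvv pvv cth Bv' tT; rewrite /cl E I3E [X in _ = X + _]I3E JI3 => H.
  apply: (etrans H); apply: congr1; apply: congr1; apply: int_ext => s /andP[s0 st].
  rewrite clampE; first reflexivity.
  by rewrite s0 (le_trans st) //; case/andP: tT.
have := conserve_Lq LP T0 wcl cvv pvv cth pth Bv' p1 dth tT.
by rewrite /cl E.
Qed.
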